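(* Let $T\ge2$, $\mathcal{T}=\{1,\dots,T\}$, and consider the special model described in the context. For each $i\in\mathcal{T}$ with $i\ge2$, writing $g=\prod_{s=T-i+1}^{T-1}f_s$, $$\operatorname{E}\bigg[\frac{(C^{\alpha}_{i,T}-C^{\alpha}_{i,T-i+1}g)^2}{C^{\alpha}_{i,T-i+1}}\,\Big|\,\mathcal{D}^{\alpha}\bigg]=\frac{\alpha}{C^{\alpha}_{i,T-i+1}}\bigg(\frac{\operatorname{E}[M^{\alpha}_i]}{\alpha}\operatorname{E}[Z^2]\,\mathbb{P}(D>T-i+1)+(H^{\alpha})^2(g-1)^2\bigg),$$ and, as $\alpha\to\infty$, this converges in distribution to $$\frac{\operatorname{E}[Z^2]}{\operatorname{E}[Z]}\Big((g-1)+(g-1)^2\chi^2_1\Big),$$ where $$(H^{\alpha})^2=\frac{(C^{\alpha}_{i,T-i+1}-\operatorname{E}[C^{\alpha}_{i,T-i+1}])^2}{\alpha}\xrightarrow{d}\lambda_i\operatorname{E}[Z^2]\,\mathbb{P}(D\le T-i+1)\chi^2_1=:H^2,$$ and $\chi^2_1$ has a chi-squared distribution with one degree of freedom. In particular, the expectation of the limit variable equals $$\frac{\lambda_i\operatorname{E}[Z^2]\mathbb{P}(D>T-i+1)+\operatorname{E}[H^2](g-1)^2}{\lambda_i\operatorname{E}[Z]\mathbb{P}(D\le T-i+1)}=\sum_{t=T-i+1}^{T-1}f_{T-i+1}\cdots f_{t-1}\,\sigma^2_t\,f_{t+1}^2\cdots f_{T-1}^2.$$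
   Context: Special model. Fix an integer $T\ge2$, $\mathcal{T}=\{1,\dots,T\}$. For each $i\in\mathcal{T}$, $(M^{\alpha}_i)_{\alpha\ge0}$ is a homogeneous Poisson process with intensity $\lambda_i\in(0,\infty)$, and $(D_{i,k},Z_{i,k})_{k\ge1}$ is an i.i.d. sequence of pairs with $D_{i,k}\in\mathcal{T}$, whose common distribution is that of a generic pair $(D,Z)$ not depending on $i$, where $D$ and $Z$ are independent, $\operatorname{E}[Z^2]<\infty$ and $\operatorname{E}[ZI\{D=t\}]>0$ for all $t\in\mathcal{T}$. For each $i$, $(D_{i,k},Z_{i,k})_{k}$ is independent of $(M^\alpha_i)_\alpha$, and the families $\{(M^{\alpha}_i)_\alpha,(D_{i,k},Z_{i,k})_k\}$, $i=1,\dots,T$, are independent. Define $C^{\alpha}_{i,t}=\sum_{k=1}^{M^{\alpha}_i}Z_{i,k}I\{D_{i,k}\le t\}$. Let $\mathcal{D}^{\alpha}$ be the $\sigma$-algebra generated by $\{C^{\alpha}_{j,t}:j,t\in\mathcal{T},\ j+t\le T+1\}$. For $t\le T-1$, $f_t=\operatorname{E}[ZI\{D\le t+1\}]/\operatorname{E}[ZI\{D\le t\}]$ and $$\sigma^2_t=(f_t-1)\bigg(\frac{\operatorname{E}[Z^2I\{D=t+1\}]}{\operatorname{E}[ZI\{D=t+1\}]}+(f_t-1)\frac{\operatorname{E}[Z^2I\{D\le t\}]}{\operatorname{E}[ZI\{D\le t\}]}\bigg).$$ *)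

(* Defs.v *)
From HB Require Import structures.
From mathcomp Require Import all_boot all_order all_algebra.
From mathcomp Require Import all_classical all_reals all_analysis.
Import Order.TTheory GRing.Theory Num.Theory.
Import numFieldTopology.Exports numFieldNormedType.Exports.

Set Implicit Arguments.
Unset Strict Implicit.
Unset Printing Implicit Defensive.

Local Open Scope classical_set_scope.
Local Open Scope ring_scope.

Section defs.
Context {R : realType} {d : measure_display} {Om : measurableType d}.
Variable P : probability Om R.

(** Expectation of a real random variable (meaningful when it is integrable)
    and probability of an event, as real numbers. *)
Definition Ex (X : Om -> R) : R := fine (\int[P]_w (X w)%:E)%E.
Definition Pr (A : set Om) : R := fine (P A).

Definition indep {I : eqType} (F : I -> set_system Om) : Prop :=
  forall s : seq I, uniq s -> forall A : I -> set Om,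
    (forall j, j \in s -> F j (A j)) ->
    P (\bigcap_(j in [set` s]) A j) = (\prod_(j <- s) P (A j))%E.

Definition preR {S : Type} (dom : set S) (X : S -> Om -> R) : set_system Om :=
  [set A | exists s, dom s /\ exists2 B : set R, measurable B & A = X s @^-1` B].
Definition preN {S : Type} (dom : set S) (X : S -> Om -> nat) : set_system Om :=
  [set A | exists s, dom s /\ exists B : set nat, A = X s @^-1` B].

Definition sigma_gen (G : set_system Om) : set_system Om := <<s G >>.

Record poisson_process (lam : R) (N : R -> Om -> nat) : Prop := {
  pp_zero : forall w, N 0 w = 0%N;
  pp_meas : forall a, 0 <= a -> forall B : set nat, measurable (N a @^-1` B);
  pp_mono : forall w a b, 0 <= a <= b -> (N a w <= N b w)%N;
  pp_rcont : forall w a, 0 <= a -> exists2 e : R, 0 < e &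
                     forall b, a <= b < a + e -> N b w = N a w;
  pp_incr_law : forall a b, 0 <= a <= b -> forall n : nat,
         P [set w | (N b w - N a w)%N = n] =
         (expR (- (lam * (b - a))) * (lam * (b - a)) ^+ n / (n`!)%:R)%:E;
  pp_indep_incr : forall ts : seq R, (forall t, t \in ts -> 0 <= t) -> sorted <%R ts ->
         indep (fun j : 'I_(size ts).-1 =>
           sigma_gen (preN setT (fun _ : unit =>
              fun w => subn (N (nth 0 ts j.+1) w) (N (nth 0 ts j) w)))) }.

(** C^a_{i,t} = sum_{k=1}^{M^a_i} Z_{i,k} 1{D_{i,k} <= t}  (claims indexed from 0) *)
Definition Cl (M : nat -> R -> Om -> nat) (Dk : nat -> nat -> Om -> nat)
  (Zk : nat -> nat -> Om -> R) (a : R) (i t : nat) (w : Om) : R :=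
  \sum_(k < M i a w) Zk i k w * (Dk i k w <= t)%N%:R.

Definition Dsig (T : nat) M Dk Zk (a : R) : set_system Om :=
  sigma_gen (preR [set jt : nat * nat |
      [/\ (1 <= jt.1 <= T)%N, (1 <= jt.2 <= T)%N & (jt.1 + jt.2 <= T.+1)%N]]
    (fun jt => Cl M Dk Zk a jt.1 jt.2)).

Definition sigM (M : nat -> R -> Om -> nat) (i : nat) :=
  sigma_gen (preN [set a : R | 0 <= a] (M i)).
Definition sigDZ (Dk : nat -> nat -> Om -> nat) (Zk : nat -> nat -> Om -> R) i :=
  sigma_gen (preN setT (Dk i) `|` preR setT (Zk i)).
Definition sigDZk (Dk : nat -> nat -> Om -> nat) (Zk : nat -> nat -> Om -> R) i k :=
  sigma_gen (preN setT (fun _ : unit => Dk i k) `|` preR setT (fun _ : unit => Zk i k)).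
Definition sigRow M (Dk : nat -> nat -> Om -> nat) (Zk : nat -> nat -> Om -> R) i :=
  sigma_gen (preN [set a : R | 0 <= a] (M i) `|` preN setT (Dk i) `|` preR setT (Zk i)).

(** The special model.  (D, Z) is the generic pair (only its law matters). *)
Record special_model (T : nat) (lam : nat -> R) (M : nat -> R -> Om -> nat)
  (Dk : nat -> nat -> Om -> nat) (Zk : nat -> nat -> Om -> R)
  (D : Om -> nat) (Z : Om -> R) : Prop := {
  sm_D_range : forall w, (1 <= D w <= T)%N;
  sm_D_meas : forall B : set nat, measurable (D @^-1` B);
  sm_Z_meas : measurable_fun setT Z;
  sm_DZ_indep : indep (fun b : bool => sigma_gen
     (if b then preN setT (fun _ : unit => D) else preR setT (fun _ : unit => Z)));
  sm_Z2 : P.-integrable setT (fun w => (Z w ^+ 2)%:E);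
  sm_ZD_pos : forall t, (1 <= t <= T)%N -> 0 < Ex (fun w => Z w * (D w == t)%:R);
  sm_lam : forall i, (1 <= i <= T)%N -> 0 < lam i;
  sm_poisson : forall i, (1 <= i <= T)%N -> poisson_process (lam i) (M i);
  sm_Dk_range : forall i, (1 <= i <= T)%N -> forall k w, (1 <= Dk i k w <= T)%N;
  sm_Dk_meas : forall i, (1 <= i <= T)%N -> forall k (B : set nat),
     measurable (Dk i k @^-1` B);
  sm_Zk_meas : forall i, (1 <= i <= T)%N -> forall k, measurable_fun setT (Zk i k);
  sm_ident : forall i, (1 <= i <= T)%N -> forall k (n : nat) (B : set R),
     measurable B ->
     P (Dk i k @^-1` [set n] `&` Zk i k @^-1` B) = P (D @^-1` [set n] `&` Z @^-1` B);
  sm_iid : forall i, (1 <= i <= T)%N -> indep (fun k : nat => sigDZk Dk Zk i k);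
  sm_M_DZ : forall i, (1 <= i <= T)%N ->
     indep (fun b : bool => if b then sigM M i else sigDZ Dk Zk i);
  sm_rows : indep (fun j : 'I_T => sigRow M Dk Zk j.+1) }.

(** Generalized conditional expectation: Y is a version of E[X | G] if Y is
    G-measurable and, along G-sets A_n increasing to the whole space on which
    X and Y are integrable, int_{B cap A_n} X = int_{B cap A_n} Y for B in G.
    (For integrable X one may take A_n = setT: the usual definition.) *)
Definition is_cond_exp (G : set_system Om) (X Y : Om -> R) : Prop :=
  (forall B : set R, measurable B -> G (Y @^-1` B)) /\
  exists A : nat -> set Om,
    [/\ (forall n, G (A n)), (forall n, A n `<=` A n.+1),
        \bigcup_n A n = setT &
        forall n, [/\ P.-integrable (A n) (EFin \o X),
                      P.-integrable (A n) (EFin \o Y) &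
                      forall B, G B ->
                        (\int[P]_(w in B `&` A n) (X w)%:E =
                         \int[P]_(w in B `&` A n) (Y w)%:E)%E]].

(** Convergence in distribution of (V a) as a -> +oo to a limit law given by
    its expectation functional limE (limE f = E[f(L)] for the limit L). *)
Definition cvg_distr (V : R -> Om -> R) (limE : (R -> R) -> R) : Prop :=
  forall f : R -> R, continuous f -> (exists Mb : R, forall x, `|f x| <= Mb) ->
    Ex (f \o V a) @[a --> +oo] --> limE f.

End defs.

Definition chi2_1_E {R : realType} (phi : R -> R) : R :=
  fine (\int[normal_prob (0:R) 1]_x (phi (x ^+ 2))%:E)%E.

Definition fdev {R : realType} {d} {Om : measurableType d} (P : probability Om R)
  (D : Om -> nat) (Z : Om -> R) (t : nat) : R :=
  Ex P (fun w => Z w * (D w <= t.+1)%N%:R) / Ex P (fun w => Z w * (D w <= t)%N%:R).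

Definition sigma2 {R : realType} {d} {Om : measurableType d} (P : probability Om R)
  (D : Om -> nat) (Z : Om -> R) (t : nat) : R :=
  (fdev P D Z t - 1) *
  (Ex P (fun w => Z w ^+ 2 * (D w == t.+1)%:R) / Ex P (fun w => Z w * (D w == t.+1)%:R)
   + (fdev P D Z t - 1) *
     (Ex P (fun w => Z w ^+ 2 * (D w <= t)%N%:R) / Ex P (fun w => Z w * (D w <= t)%N%:R))).

(* Main.v *)
(* The aggregate claims of row i form a compound Poisson sum, so all moments follow from Mecke's
   formula.  Conditionally on the observed run-off triangle the part of the row reported after
   development year k is still compound Poisson with the same parameters, because a thinned
   Poisson process splits into independent pieces; this gives the conditional expectation.
   For the limit law, a Stein identity (again Mecke's formula, and a Taylor expansion) turns into
   an approximate differential equation for the Laplace transform of H^2, which forces it to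
   converge to (1 + 2 s sig2)^(-1/2); Bernstein polynomials in exp(-y) upgrade this to weak
   convergence, and C/a -> E[C]/a gives the limit of the conditional expectation.  The final sum
   telescopes, since f_t = P(D <= t + 1) / P(D <= t). *)

Require Import Defs.
From HB Require Import structures.
From mathcomp Require Import all_boot all_order all_algebra.
From mathcomp Require Import all_classical all_reals all_analysis.
From mathcomp Require Import measurable_realfun zify ring lra.
Import Order.TTheory GRing.Theory Num.Theory.
Import numFieldTopology.Exports numFieldNormedType.Exports.
Local Open Scope classical_set_scope.
Local Open Scope ring_scope.

(** * Expectations and independence *)

(** A row is handled as one compound Poisson sum of sequences: a claim is the whole path t -> Z 1{D
    <= t}, so all development years of a row are functions of a single sum, and Mecke's formula can
    be tested with functions of several years at once. The split of the thinned process is never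
    constructed: it shows up as the vanishing, for every claim with D <= k, of the increment between
    k and T. Two obstacles shape the rest. First, C can be 0 or arbitrarily close to it (Z has no
    prescribed sign), so the conditional expectation has to be localized. Second, only second
    moments are at hand, so the Taylor remainder in the Stein argument is bounded by the smaller of
    a first-order and a second-order estimate, and a truncation of the claim size makes it
    negligible. The Laplace transform L is that of H^2, whose mean is the same number sig2 for every
    a. This one fact gives the tightness required for weak convergence and the initial condition 1 -
    s sig2 <= L(s) <= 1, uniform in a, of the differential equation. *)

Section law.
Context {R : realType} {d d1 d2 : measure_display} {Om : measurableType d}
  {T1 : measurableType d1} {T2 : measurableType d2}.
Variable P : probability Om R.

Definition law (X : Om -> T1) (mX : measurable_fun setT X) : probability T1 R :=
  distribution P (mfun_Sub (mem_set mX)).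

Lemma ge0_integral_law (X : Om -> T1) (mX : measurable_fun setT X) (f : T1 -> \bar R) :
  measurable_fun setT f -> (forall x, 0 <= f x)%E ->
  (\int[law X mX]_x f x = \int[P]_w f (X w))%E.
Proof. by move=> mf f0; rewrite ge0_integral_distribution. Qed.

Lemma integrable_law (X : Om -> T1) (mX : measurable_fun setT X) (f : T1 -> \bar R) :
  measurable_fun setT f ->
  ((law X mX).-integrable setT f <-> P.-integrable setT (f \o X)).
Proof.
move=> mf; split=> /integrableP[_ h]; apply/integrableP; split => //.
- exact: measurableT_comp.
- by rewrite -(ge0_integral_law X mX (fun x => `|f x|)%E) //; exact: measurableT_comp.
- by rewrite ge0_integral_law //; exact: measurableT_comp.
Qed.

Lemma integral_law (X : Om -> T1) (mX : measurable_fun setT X) (f : T1 -> \bar R) :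
  measurable_fun setT f -> P.-integrable setT (f \o X) ->
  (\int[law X mX]_x f x = \int[P]_w f (X w))%E.
Proof. by move=> mf f0; rewrite integral_distribution. Qed.

End law.

Section indep_pair.
Context {R : realType} {d d1 d2 : measure_display} {Om : measurableType d}
  {T1 : measurableType d1} {T2 : measurableType d2}.
Variable P : probability Om R.
Variables (m1 : probability T1 R) (m2 : probability T2 R).
Variables (X : Om -> T1) (Y : Om -> T2).
Hypotheses (mX : measurable_fun setT X) (mY : measurable_fun setT Y).
Hypothesis XY : forall A B, measurable A -> measurable B ->
  (P (X @^-1` A `&` Y @^-1` B) = m1 A * m2 B)%E.

(** A product measure is determined by its values on rectangles. The marginals [m1], [m2] are free
    measures and not the laws of [X] and [Y], so that the common claim law can stand for the law of
    any particular claim. *)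
Lemma indep_pair_preimage (A : set (T1 * T2)) : measurable A ->
  P [set w | A (X w, Y w)] = (m1 \x m2)%E A.
Proof.
move=> mA; have mXY : measurable_fun setT (fun w => (X w, Y w)).
  exact: measurable_fun_pair.
rewrite (@product_measure_unique _ _ _ _ _ m1 m2 (law P _ mXY)) //.
Qed.

Lemma ge0_integral_indep_pair (f : T1 * T2 -> \bar R) :
  measurable_fun setT f -> (forall x, 0 <= f x)%E ->
  (\int[P]_w f (X w, Y w) = \int[m1 \x m2]_z f z)%E.
Proof.
move=> mf f0; have mXY : measurable_fun setT (fun w => (X w, Y w)).
  exact: measurable_fun_pair.
rewrite -(ge0_integral_law P _ mXY) //.
by apply: eq_measure_integral => A mA _; exact: indep_pair_preimage.
Qed.

End indep_pair.

Section prodfun.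
Context {R : realType} {d1 d2 : measure_display}
  {T1 : measurableType d1} {T2 : measurableType d2}.
Variables (m1 : probability T1 R) (m2 : probability T2 R).
Variables (u : T1 -> R) (v : T2 -> R).
Hypotheses (iu : m1.-integrable setT (EFin \o u))
           (iv : m2.-integrable setT (EFin \o v)).

Let mu : measurable_fun setT u.
Proof. by apply/measurable_EFinP; exact: measurable_int iu. Qed.
Let mv : measurable_fun setT v.
Proof. by apply/measurable_EFinP; exact: measurable_int iv. Qed.

Lemma integrable_prodM :
  (m1 \x m2)%E.-integrable setT (fun z => (u z.1 * v z.2)%:E).
Proof.
have mf : measurable_fun [set: T1 * T2] (fun z => (u z.1 * v z.2)%:E).
  by apply/measurable_EFinP/measurable_funM; exact: measurableT_comp.
apply/(integrable12ltyP m1 m2) => //=.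
under eq_integral => x _.
  under eq_integral => y _ do rewrite normrM EFinM.
  rewrite ge0_integralZl//; last 1 first.
    - by apply/measurable_EFinP; exact: measurableT_comp.
  over.
rewrite /= ge0_integralZr//; last 2 first.
  - by apply/measurable_EFinP; exact: measurableT_comp.
  - exact: integral_ge0.
rewrite lte_mul_pinfty//.
- exact: integral_ge0.
- by move/integrableP : iu => [_]; rewrite ge0_fin_numE//; exact: integral_ge0.
- by move/integrableP : iv => [_].
Qed.

Lemma integral_prodM :
  (\int[m1 \x m2]_z (u z.1 * v z.2)%:E =
   (\int[m1]_x (u x)%:E) * (\int[m2]_y (v y)%:E))%E.
Proof.
rewrite -integral12_prod_meas1; last exact: integrable_prodM.
rewrite /fubini_F /=.
under eq_integral => x _.
  under eq_integral => y _ do rewrite EFinM.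
  rewrite integralZl//.
  over.
rewrite -[X in (_ = _ * X)%E]fineK; last exact: integrable_fin_num.
under eq_integral => x _.
  rewrite -[X in (_ * X)%E]fineK; last exact: integrable_fin_num.
  over.
by rewrite integralZr.
Qed.

End prodfun.

Set Implicit Arguments.
Unset Strict Implicit.

Section L1.
Context {R : realType} {d : measure_display} {Om : measurableType d}.
Variable P : probability Om R.
Implicit Types f g : Om -> R.

Definition L1 (f : Om -> R) := P.-integrable setT (EFin \o f).

Lemma L1_meas f : L1 f -> measurable_fun setT f.
Proof. by move=> /(measurable_int P) /measurable_EFinP. Qed.

Lemma L1_fin f : L1 f -> (\int[P]_w (f w)%:E)%E \is a fin_num.
Proof. by move=> fi; exact: integrable_fin_num. Qed.

Lemma ExE f : L1 f -> (\int[P]_w (f w)%:E)%E = (Ex P f)%:E.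
Proof. by move=> fi; rewrite /Ex fineK//; exact: L1_fin. Qed.

Lemma eq_Ex f g : f =1 g -> Ex P f = Ex P g.
Proof. by move=> fg; congr (Ex P _); exact/funext. Qed.

Lemma L1D f g : L1 f -> L1 g -> L1 (fun w => f w + g w).
Proof. by move=> fi gi; exact: (integrableD _ fi gi). Qed.

Lemma L1B f g : L1 f -> L1 g -> L1 (fun w => f w - g w).
Proof. by move=> fi gi; exact: (integrableB _ fi gi). Qed.

Lemma L1Z c f : L1 f -> L1 (fun w => c * f w).
Proof. by move=> fi; exact: (integrableZl _ _ fi). Qed.

Lemma ExD f g : L1 f -> L1 g -> Ex P (fun w => f w + g w) = Ex P f + Ex P g.
Proof.
by move=> fi gi; rewrite /Ex -fineD ?L1_fin// -integralD.
Qed.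

Lemma ExB f g : L1 f -> L1 g -> Ex P (fun w => f w - g w) = Ex P f - Ex P g.
Proof.
by move=> fi gi; rewrite /Ex -fineB ?L1_fin// -integralB.
Qed.

Lemma ExZ c f : L1 f -> Ex P (fun w => c * f w) = c * Ex P f.
Proof. by move=> fi; apply: RintegralZl. Qed.

Lemma L1Zr c f : L1 f -> L1 (fun w => f w * c).
Proof. by move=> fi; under eq_fun do rewrite mulrC; exact: L1Z. Qed.

Lemma ExZr c f : L1 f -> Ex P (fun w => f w * c) = Ex P f * c.
Proof. by move=> fi; rewrite mulrC -ExZ//; apply: eq_Ex => w; rewrite mulrC. Qed.

Lemma L1_dom (f g : Om -> R) : measurable_fun setT f -> L1 g ->
  (forall w, `|f w| <= `|g w|) -> L1 f.
Proof.
move=> mf gi fg; apply: le_integrable gi => //; first exact/measurable_EFinP.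
by move=> w _; rewrite lee_fin.
Qed.

Lemma L1_cst c : L1 (fun=> c).
Proof. exact: finite_measure_integrable_cst. Qed.

Lemma Ex_cst c : Ex P (fun=> c) = c.
Proof. rewrite /Ex (integral_cst P measurableT (c%:E)) [X in (_ * X)%E]probability_setT.
by rewrite mule1. Qed.

Lemma L1_bounded (f : Om -> R) c : measurable_fun setT f -> (forall w, `|f w| <= c) -> L1 f.
Proof.
move=> mf fc; apply: (L1_dom mf (L1_cst c)) => w.
by rewrite (le_trans (fc w))// ler_norm.
Qed.

Lemma L1_norm f : L1 f -> L1 (fun w => `|f w|).
Proof. exact: integrable_norm. Qed.

Lemma Ex_ge0 f : (forall w, 0 <= f w) -> 0 <= Ex P f.
Proof. by move=> f0; apply/fine_ge0/integral_ge0 => w _; rewrite lee_fin. Qed.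

Lemma le_Ex f g : L1 f -> L1 g -> (forall w, f w <= g w) -> Ex P f <= Ex P g.
Proof.
move=> fi gi fg; rewrite -subr_ge0 -ExB//; apply: Ex_ge0 => w.
by rewrite subr_ge0.
Qed.

Lemma normr_Ex f : L1 f -> `|Ex P f| <= Ex P (fun w => `|f w|).
Proof. by move=> fi; exact: le_normr_Rintegral. Qed.

Lemma L1_indic A : measurable A -> L1 (\1_A).
Proof. by move=> mA; exact: integrable_indic. Qed.

Lemma Ex_indic A : measurable A -> Ex P (\1_A) = fine (P A).
Proof. by move=> mA; rewrite /Ex integral_indic// setIT. Qed.

Lemma integral_indicM (A : set Om) (f : Om -> R) : measurable A ->
  (\int[P]_(w in A) (f w)%:E = \int[P]_w (\1_A w * f w)%:E)%E.
Proof.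
move=> mA; rewrite integral_mkcond; apply: eq_integral => w _.
rewrite /patch indicE; case: (w \in A); rewrite ?mul1r ?mul0r//.
Qed.

End L1.

Unset Implicit Arguments.

Section L1_law.
Context {R : realType} {d d1 : measure_display} {Om : measurableType d}
  {T1 : measurableType d1}.
Variable P : probability Om R.

Lemma L1_law (X : Om -> T1) (mX : measurable_fun setT X) (f : T1 -> R) :
  measurable_fun setT f -> (L1 (law P X mX) f <-> L1 P (fun w => f (X w))).
Proof. by move=> mf; apply: integrable_law; exact/measurable_EFinP. Qed.

Lemma Ex_law (X : Om -> T1) (mX : measurable_fun setT X) (f : T1 -> R) :
  measurable_fun setT f -> L1 P (fun w => f (X w)) ->
  Ex (law P X mX) f = Ex P (fun w => f (X w)).
Proof.
move=> mf fi; rewrite /Ex (integral_law P X mX (EFin \o f))//.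
exact/measurable_EFinP.
Qed.

Lemma Ex_prodM {d2} {T2 : measurableType d2} (m1 : probability T1 R)
  (m2 : probability T2 R) (u : T1 -> R) (v : T2 -> R) : L1 m1 u -> L1 m2 v ->
  Ex (m1 \x m2)%E (fun z => u z.1 * v z.2) = Ex m1 u * Ex m2 v.
Proof.
by move=> iu iv; rewrite /Ex (integral_prodM m1 m2)// fineM//; exact: L1_fin.
Qed.

(** Integrability is asked of every section, not of almost every one, so that the inner integral is
    a real number everywhere and can be written with [Ex]. *)
Lemma Ex_fubini {d2} {T2 : measurableType d2} (m1 : probability T1 R)
  (m2 : probability T2 R) (G : T1 * T2 -> R) : L1 (m1 \x m2)%E G ->
  (forall y, L1 m2 (fun z => G (y, z))) ->
  L1 m1 (fun y => Ex m2 (fun z => G (y, z))) /\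
  Ex (m1 \x m2)%E G = Ex m1 (fun y => Ex m2 (fun z => G (y, z))).
Proof.
move=> iG iGy.
have E : fubini_F m2 (EFin \o G) = EFin \o (fun y => Ex m2 (fun z => G (y, z))).
  by apply/funext => y; rewrite /fubini_F /= ExE.
split; first by rewrite /L1 -E; exact: integrable_fubini_F.
by rewrite /Ex -(integral12_prod_meas1 iG) E.
Qed.

End L1_law.

Section Ex_indep_pair.
Context {R : realType} {d d1 d2 : measure_display} {Om : measurableType d}
  {T1 : measurableType d1} {T2 : measurableType d2}.
Variable P : probability Om R.
Variables (X : Om -> T1) (Y : Om -> T2).
Hypotheses (mX : measurable_fun setT X) (mY : measurable_fun setT Y).
Hypothesis XY : forall A B, measurable A -> measurable B ->
  (P (X @^-1` A `&` Y @^-1` B) = P (X @^-1` A) * P (Y @^-1` B))%E.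

Lemma Ex_indep_pair (u : T1 -> R) (v : T2 -> R) :
  measurable_fun setT u -> measurable_fun setT v ->
  L1 P (fun w => u (X w)) -> L1 P (fun w => v (Y w)) ->
  L1 P (fun w => u (X w) * v (Y w)) /\
  Ex P (fun w => u (X w) * v (Y w)) = Ex P (fun w => u (X w)) * Ex P (fun w => v (Y w)).
Proof.
move=> mu mv iu iv.
have iu' := (L1_law P X mX u mu).2 iu; have iv' := (L1_law P Y mY v mv).2 iv.
have mXY : measurable_fun setT (fun w => (X w, Y w)) by exact: measurable_fun_pair.
have mf : measurable_fun setT (fun z : T1 * T2 => u z.1 * v z.2).
  by apply: measurable_funM; exact: measurableT_comp.
have eqm A : measurable A -> (law P X mX \x law P Y mY)%E A = law P _ mXY A.
  by move=> mA; rewrite -(indep_pair_preimage P (law P X mX) (law P Y mY) X Y mX mY XY).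
have ip := integrable_prodM _ _ _ _ iu' iv'.
have il : L1 (law P _ mXY) (fun z => u z.1 * v z.2).
  move/integrableP : ip => [_ h]; apply/integrableP; split; first exact/measurable_EFinP.
  rewrite (eq_measure_integral (law P X mX \x law P Y mY)%E)//.
  by move=> A mA _; exact/esym/eqm.
have ilP := (L1_law P _ mXY _ mf).1 il.
split => //.
rewrite -(Ex_law P _ mXY _ mf ilP) -(Ex_law P _ mX _ mu iu) -(Ex_law P _ mY _ mv iv).
rewrite -(Ex_prodM _ _ _ _ iu' iv'); rewrite /Ex; congr fine.
by apply: eq_measure_integral => A mA _; exact/esym/eqm.
Qed.

End Ex_indep_pair.

(** * Pi-lambda arguments for independence and for equality of integrals *)

Section grouping.
Context {R : realType} {d : measure_display} {Om : measurableType d}.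
Variable P : probability Om R.

(** The events B that are independent of A are stable under proper differences and increasing
    unions, so the pi-lambda theorem extends independence from a pi-system to the sigma-algebra it
    generates. *)
Lemma indep_pi_lambda (A : set Om) (G : set_system Om) : measurable A ->
  setI_closed G -> (forall B, G B -> measurable B) ->
  (forall B, G B -> P (A `&` B) = P A * P B)%E ->
  forall B, <<s G >> B -> (P (A `&` B) = P A * P B)%E.
Proof.
move=> mA GI Gm GP.
pose H := [set B : set Om | measurable B /\ (P (A `&` B) = P A * P B)%E].
have : <<s G >> `<=` H.
  apply: (@lambda_system_subset _ _ GI setT) => //; last 1 first.
    by move=> B GB; split; [exact: Gm|exact: GP].
  split.
  - by [].
  - by split => //; rewrite setIT probability_setT mule1.
  - move=> B C CB [mB PB] [mC PC]; split; first exact: measurableD.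
    have PD X Y : measurable X -> measurable Y -> Y `<=` X ->
        (P (X `\` Y) = P X - P Y)%E.
      move=> mX mY YX; rewrite measureD//; first by rewrite (setIidr YX).
      by rewrite -ge0_fin_numE// fin_num_measure.
    have -> : A `&` (B `\` C) = (A `&` B) `\` (A `&` C).
      by apply/seteqP; split=> w /=; tauto.
    rewrite PD//; [|exact: measurableI|exact: measurableI|exact: setIS].
    rewrite PB PC PD// muleBr// ?fin_num_measure//.
    by rewrite fin_num_adde_defr// fin_num_measure.
  - move=> F ndF HF.
    have mF n : measurable (F n) by have [] := HF n.
    split; first exact: bigcupT_measurable.
    rewrite setI_bigcupr.
    have h1 : P (A `&` F n) @[n --> \oo] --> P (\bigcup_n (A `&` F n)).
      apply: nondecreasing_cvg_mu.
      - by move=> n; exact: measurableI.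
      - by apply: bigcup_measurable => n _; exact: measurableI.
      - by move=> m n mn; apply/subsetPset; apply: setIS; apply/subsetPset/ndF.
    have h2 : P (F n) @[n --> \oo] --> P (\bigcup_n F n).
      by apply: nondecreasing_cvg_mu => //; exact: bigcup_measurable.
    have h3 : (P A * P (F n))%E @[n --> \oo] --> (P A * P (\bigcup_n F n))%E.
      by apply: cvgeZl => //; rewrite fin_num_measure.
    have h4 : (fun n => P (A `&` F n)) = (fun n => P A * P (F n))%E.
      by apply/funext => n; have [] := HF n.
    rewrite h4 in h1.
    by move/cvg_lim : h1 => <- //; move/cvg_lim : h3 => <-.
by move=> h B /h[].
Qed.

End grouping.

Section pi_lambda_integral.
Context {R : realType} {d : measure_display} {Om : measurableType d}.
Variable P : probability Om R.

(** The sets over which two integrable functions have the same integral form a lambda-system: proper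
    differences by additivity, increasing unions by dominated convergence. This reduces the defining
    property of a conditional expectation to a generating pi-system. *)
Lemma integral_pi_lambda (f g : Om -> R) (G : set_system Om) :
  P.-integrable setT (EFin \o f) -> P.-integrable setT (EFin \o g) ->
  setI_closed G -> (forall B, G B -> measurable B) -> G setT ->
  (forall B, G B -> \int[P]_(w in B) (f w)%:E = \int[P]_(w in B) (g w)%:E)%E ->
  forall B, <<s G >> B ->
    (\int[P]_(w in B) (f w)%:E = \int[P]_(w in B) (g w)%:E)%E.
Proof.
move=> fi gi GI Gm GT Gfg.
pose H := [set B : set Om | measurable B /\
  (\int[P]_(w in B) (f w)%:E = \int[P]_(w in B) (g w)%:E)%E].
have intD h X Y : P.-integrable setT (EFin \o h) -> measurable X ->
    measurable Y -> Y `<=` X ->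
    (\int[P]_(w in X `\` Y) (h w)%:E =
     \int[P]_(w in X) (h w)%:E - \int[P]_(w in Y) (h w)%:E)%E.
  move=> hi mX mY YX.
  have hX Z : measurable Z -> P.-integrable Z (EFin \o h).
    by move=> mZ; exact: integrableS hi.
  rewrite -{2}(setDUK YX) integral_setU//=; first last.
  - by apply/disj_setPS => w [? []].
  - by rewrite setDUK//; apply: measurable_int (hX _ mX).
  - exact: measurableD.
  rewrite [X in (_ = X - _)%E]addeC addeK//.
  by apply: integrable_fin_num => //; exact: hX.
have intU h (F : (set Om)^nat) : P.-integrable setT (EFin \o h) ->
    (forall n, measurable (F n)) -> nondecreasing_seq F ->
    (\int[P]_(w in F n) (h w)%:E)%E @[n --> \oo] -->
    (\int[P]_(w in \bigcup_n F n) (h w)%:E)%E.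
  move=> hi mF ndF.
  have mU : measurable (\bigcup_n F n) by exact: bigcupT_measurable.
  have mh : measurable_fun setT h by apply/measurable_EFinP; exact: measurable_int hi.
  rewrite [X in X @ _ --> _](_ : _ = fun n =>
      (\int[P]_w ((h \_ (F n)) w)%:E)%E); last first.
    apply/funext => n; rewrite integral_mkcond; apply: eq_integral => w _.
    by rewrite /patch; case: ifP.
  rewrite [X in _ --> X](_ : _ =
      (\int[P]_w ((h \_ (\bigcup_n F n)) w)%:E)%E); last first.
    rewrite integral_mkcond; apply: eq_integral => w _.
    by rewrite /patch; case: ifP.
  have mr (B : set Om) : measurable B ->
      measurable_fun setT (fun w => ((h \_ B) w)%:E).
    move=> mB; apply/measurable_EFinP.
    by apply/(measurable_restrictT _ _).1 => //; exact: measurable_funTS.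
  have hc : {ae P, forall w, setT w ->
      (fun n => ((h \_ (F n)) w)%:E) @ \oo --> ((h \_ (\bigcup_n F n)) w)%:E}.
    apply: aeW => w _; apply/cvg_EFin; first by near=> n.
    rewrite /patch; case: ifPn => [|wF].
      rewrite inE => -[m _ Fm]; apply: cvg_near_cst.
      near=> n; rewrite /= mem_set//; suff /subsetPset : (F m <= F n)%O by apply.
      by apply: ndF; near: n; exact: nbhs_infty_ge.
    apply: cvg_near_cst; near=> n; rewrite /= memNset// => Fn.
    by move/negP : wF; apply; rewrite inE; exists n.
  have hb : {ae P, forall w n, setT w ->
      (`|((h \_ (F n)) w)%:E| <= `|(h w)%:E|)%E}.
    apply: aeW => w n _; rewrite /patch; case: ifP => // _.
    (* Off the set, the restriction takes the default value [point], which is 0 in the reals. *)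
    by rewrite [point%:E](_ : _ = 0%E)// abse0 abse_ge0.
  by have [_ _] := dominated_convergence measurableT (fun n => mr _ (mF n))
    (mr _ mU) hc (integrable_abse hi) hb.
have : <<s G >> `<=` H.
  apply: (@lambda_system_subset _ _ GI setT) => //; last 1 first.
    by move=> B GB; split; [exact: Gm|exact: Gfg].
  split.
  - by [].
  - by split => //; exact: Gfg.
  - move=> B C CB [mB PB] [mC PC]; split; first exact: measurableD.
    by rewrite !intD// PB PC.
  - move=> F ndF HF.
    have mF n : measurable (F n) by have [] := HF n.
    split; first exact: bigcupT_measurable.
    have h1 := intU f F fi mF ndF; have h2 := intU g F gi mF ndF.
    have h4 : (fun n => \int[P]_(w in F n) (f w)%:E)%E =
              (fun n => \int[P]_(w in F n) (g w)%:E)%E.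
      by apply/funext => n; have [] := HF n.
    rewrite h4 in h1.
    by move/cvg_lim : h1 => <- //; move/cvg_lim : h2 => <-.
by move=> h B /h[].
Unshelve. all: by end_near. Qed.

End pi_lambda_integral.

Section indep_family.
Context {R : realType} {d : measure_display} {Om : measurableType d}.
Variable P : probability Om R.

(** Finite intersections of events taken from the families in J form a pi-system generating the
    grouped sigma-algebra, and on it independence from A is the joint independence of finitely many
    families. *)
Lemma indep_grouping (I : choiceType) (F : I -> set_system Om) (i : I) (J : set I) :
  (forall j, F j `<=` measurable) -> (forall j, F j setT) ->
  (forall j, setI_closed (F j)) -> indep P F -> ~ J i ->
  forall A B, F i A -> <<s \bigcup_(j in J) F j >> B ->
  (P (A `&` B) = P A * P B)%E.
Proof.
move=> Fm FT FI indF nJi A B FA.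
(* The choice [c] is defined at all indices, with [setT] where nothing is imposed, so that two
   intersections over different lists merge into one. *)
pose G := [set C : set Om | exists (s : seq I) (c : I -> set Om),
  [/\ uniq s, (forall j, j \in s -> J j), (forall j, F j (c j)) &
      C = \bigcap_(j in [set` s]) c j]].
have GI : setI_closed G.
  move=> _ _ [s1 [c1 [us1 sJ1 Fc1 ->]]] [s2 [c2 [us2 sJ2 Fc2 ->]]].
  exists (undup (s1 ++ s2)), (fun j => (if j \in s1 then c1 j else setT) `&`
                                 (if j \in s2 then c2 j else setT)); split.
  - exact: undup_uniq.
  - by move=> j; rewrite mem_undup mem_cat => /orP[/sJ1|/sJ2].
  - by move=> j; apply: FI; case: ifP.
  - apply/seteqP; split => w /=.
      move=> [h1 h2] j _; split.
        by case: ifPn => // js; exact: h1.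
      by case: ifPn => // js; exact: h2.
    move=> h; split=> j /= js.
      have := h j; rewrite /= mem_undup mem_cat js => /(_ isT)[+ _].
      by [].
    have := h j; rewrite /= mem_undup mem_cat js orbT => /(_ isT)[_ +].
    by [].
have Gm : forall C, G C -> measurable C.
  move=> _ [s [c [_ _ Fc ->]]]; rewrite bigcap_seq.
  by apply: bigsetI_measurable => j _; exact: Fm (Fc j).
have GP : forall C, G C -> (P (A `&` C) = P A * P C)%E.
  move=> _ [s [c [us sJ Fc ->]]].
  have nis : i \notin s by apply/negP => /sJ.
  rewrite (indF s us c)//.
  (* The event A is attached to the extra index i, which is not in s because i is not in J. *)
  have e : \bigcap_(j in [set` i :: s]) (if j == i then A else c j) =
           A `&` \bigcap_(j in [set` s]) c j.
    apply/seteqP; split => w /=.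
      move=> h; split; first by have := h i; rewrite /= mem_head eqxx => /(_ isT).
      move=> j /= js; have := h j; rewrite /= inE js orbT => /(_ isT).
      by case: ifPn => // /eqP ji; rewrite -ji js in nis.
    move=> [Aw h] j /=; rewrite inE; case: eqP => [//|_] /= js.
    exact: h.
  rewrite -e indF//=; last 2 first.
  - by rewrite nis.
  - by move=> j _; case: ifPn => // /eqP ->.
  rewrite big_cons eqxx; congr (_ * _)%E.
  apply: eq_big_seq => j js; case: ifPn => // /eqP ji.
  by rewrite -ji js in nis.
move=> sB; apply: (@indep_pi_lambda _ _ _ P A G (Fm _ _ FA)) => //.
apply: sub_sigma_algebra2 sB => C [j Jj FC].
exists [:: j], (fun k => if k == j then C else setT); split => //.
- by move=> k; rewrite inE => /eqP ->.
- by move=> k; case: ifPn => // /eqP ->.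
- apply/seteqP; split => w /=; first by move=> Cw k /=; rewrite inE => ->.
  by move/(_ j); rewrite /= inE eqxx => /(_ isT).
Qed.

End indep_family.

Definition vcoord (R : realType) : set_system (nat -> R) :=
  [set A | exists t, exists2 B : set R, measurable B & A = (fun x => x t) @^-1` B].

(** The alias lets sequences carry the sigma-algebra generated by the coordinates, for which a
    random sequence is measurable as soon as each coordinate is. *)
Definition vec (R : realType) : Type := nat -> R.
HB.instance Definition _ (R : realType) :=
  Measurable.copy (vec R) (g_sigma_algebraType (vcoord R)).

Section vec.
Context {R : realType} {d : measure_display} {Om : measurableType d}.

Lemma measurable_vcoord t : measurable_fun setT (fun x : vec R => x t).
Proof.
move=> _ B mB; rewrite setTI; apply: sub_sigma_algebra.
by exists t, B.
Qed.

Lemma measurable_vecP (f : Om -> vec R) :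
  (forall t, measurable_fun setT (fun w => f w t)) -> measurable_fun setT f.
Proof.
move=> mf; apply: (@measurability _ _ _ (vec R) _ _ (vcoord R)) => //.
move=> _ [_ [t [B mB ->]] <-].
by have := mf t measurableT B mB; rewrite !setTI.
Qed.

End vec.

(** * Mecke's formula for compound Poisson sums *)

Section nat_index.
Context {d : measure_display} {Om : measurableType d}.
Variable N : Om -> nat.
Hypothesis mN : forall n, measurable (N @^-1` [set n]).

Lemma measurable_natP : measurable_fun setT N.
Proof.
move=> _ B _; rewrite setTI (_ : N @^-1` B = \bigcup_(n in B) (N @^-1` [set n])).
  by apply: bigcup_measurable => n _; exact: mN.
by apply/seteqP; split => [w Bw|w [n Bn /= ->]]//; exists (N w).
Qed.

Lemma measurable_random_index {d'} {T' : measurableType d'} (f : nat -> Om -> T') :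
  (forall n, measurable_fun setT (f n)) -> measurable_fun setT (fun w => f (N w) w).
Proof.
move=> mf _ B mB; rewrite setTI.
rewrite (_ : _ @^-1` B = \bigcup_n (N @^-1` [set n] `&` f n @^-1` B)).
  apply: bigcup_measurable => n _; apply: measurableI => //.
  by rewrite -[X in measurable X]setTI; exact: mf.
by apply/seteqP; split => [w Bw|w [n _ [/= ->]]]//; exists (N w).
Qed.

End nat_index.

Section xsum.
Context {R : realType} {d : measure_display} {Om : measurableType d}.
Variable x : nat -> Om -> vec R.

(** Sums run over lists of indices and not over initial segments because Mecke's formula needs the
    sum with one claim deleted. *)
Definition xsum (s : seq nat) (w : Om) : vec R := fun t => \sum_(l <- s) x l w t.

Lemma xsum_cons a s w : xsum (a :: s) w = fun t => x a w t + xsum s w t.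
Proof. by apply/funext => t; rewrite /xsum big_cons. Qed.

Lemma xsum_rem a s w : a \in s ->
  xsum s w = fun t => x a w t + xsum (rem a s) w t.
Proof. by move=> sa; apply/funext => t; rewrite /xsum (big_rem a). Qed.

Hypothesis mx : forall n, measurable_fun setT (x n).

Lemma measurable_xcoord n t : measurable_fun setT (fun w => x n w t).
Proof. exact: (measurableT_comp (measurable_vcoord t)). Qed.

Lemma measurable_xsum s : measurable_fun setT (xsum s).
Proof.
apply: measurable_vecP => t.
by apply: measurable_sum => l; exact: measurable_xcoord.
Qed.

Variable N : Om -> nat.
Hypothesis mN : forall n, measurable (N @^-1` [set n]).

Definition csum (w : Om) : vec R := xsum (iota 0 (N w)) w.

Lemma measurable_csum : measurable_fun setT csum.
Proof.
by apply: (measurable_random_index N mN (fun n => xsum (iota 0 n))) => n; exact: measurable_xsum.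
Qed.

End xsum.

Section mecke.
Context {R : realType} {d : measure_display} {Om : measurableType d}.
Variable P : probability Om R.
Variables (x : nat -> Om -> vec R) (N : Om -> nat) (mu : R).
Variable nu : probability (vec R) R.
Hypothesis mu0 : 0 <= mu.
Hypothesis mx : forall n, measurable_fun setT (x n).
Hypothesis mN : forall n, measurable (N @^-1` [set n]).
Hypothesis xlaw : forall n A, measurable A -> P (x n @^-1` A) = nu A.
Hypothesis xind : forall n s, n \notin s -> forall A B : set (vec R),
  measurable A -> measurable B ->
  (P (x n @^-1` A `&` xsum x s @^-1` B) = P (x n @^-1` A) * P (xsum x s @^-1` B))%E.
Hypothesis Nind : forall (C : set nat) n s (A : set (vec R * vec R)), measurable A ->
  (P (N @^-1` C `&` [set w | A (x n w, xsum x s w)]) =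
   P (N @^-1` C) * P [set w | A (x n w, xsum x s w)])%E.
Hypothesis Npois : forall m,
  P (N @^-1` [set m]) = (expR (- mu) * mu ^+ m / m`!%:R)%:E.

Let msum s : measurable_fun setT (xsum x s) := measurable_xsum x mx s.
Let mcs : measurable_fun setT (csum x N) := measurable_csum x mx N mN.
Let kap s := law P (xsum x s) (msum s).
Let kappa := law P (csum x N) mcs.

Let xind' n s A B : n \notin s -> measurable A -> measurable B ->
  (P (x n @^-1` A `&` xsum x s @^-1` B) = nu A * kap s B)%E.
Proof. by move=> ns mA mB; rewrite xind// xlaw. Qed.

(** By induction, since the first term has law [nu] and is independent of the others. Thus the sum
    of m claims with one deleted has the law of the first m - 1 claims, whichever one is deleted. *)
Lemma xsum_law_size s t B : uniq s -> uniq t -> size s = size t ->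
  measurable B -> kap s B = kap t B.
Proof.
elim: s t B => [|a s IH] [|b t] B //=.
move=> /andP[as_ us] /andP[bt ut] [st] mB.
have madd : measurable_fun setT
    (fun z : vec R * vec R => (fun j => z.1 j + z.2 j) : vec R).
  apply: measurable_vecP => j; apply: measurable_funD.
    exact: (measurableT_comp (measurable_vcoord j) measurable_fst).
  exact: (measurableT_comp (measurable_vcoord j) measurable_snd).
have mA : measurable [set z : vec R * vec R | B (fun j => z.1 j + z.2 j)].
  by have := madd measurableT B mB; rewrite setTI.
have E (c : nat) (r : seq nat) : xsum x (c :: r) @^-1` B =
    [set w | [set z : vec R * vec R | B (fun j => z.1 j + z.2 j)] (x c w, xsum x r w)].
  by apply/seteqP; split=> w /=; rewrite xsum_cons.
change (P (xsum x (a :: s) @^-1` B) = P (xsum x (b :: t) @^-1` B)); rewrite !E.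
rewrite (indep_pair_preimage P nu (kap s) _ _ (mx a) (msum s) _ _ mA); last first.
  by move=> A B' mA' mB'; exact: xind'.
rewrite (indep_pair_preimage P nu (kap s) _ _ (mx b) (msum t) _ _ mA)//.
move=> A B' mA' mB'; rewrite xind'//; congr (_ * _)%E.
by apply/esym/IH.
Qed.

Lemma ge0_integral_xpair n s t (G : vec R * vec R -> \bar R) :
  n \notin s -> uniq s -> uniq t -> size s = size t ->
  measurable_fun setT G -> (forall z, 0 <= G z)%E ->
  (\int[P]_w G (x n w, xsum x s w) = \int[nu \x kap t]_z G z)%E.
Proof.
move=> ns us ut st mG G0.
apply: (ge0_integral_indep_pair P nu (kap t) (x n) (xsum x s)) => //.
by move=> A B mA mB; rewrite xind'// (xsum_law_size s t).
Qed.

Lemma ge0_integral_Nind m n s (G : vec R * vec R -> \bar R) :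
  measurable_fun setT G -> (forall z, 0 <= G z)%E ->
  (\int[P]_(w in N @^-1` [set m]) G (x n w, xsum x s w) =
   P (N @^-1` [set m]) * \int[P]_w G (x n w, xsum x s w))%E.
Proof.
move=> mG G0.
have mp : measurable_fun setT (fun w => (x n w, xsum x s w)).
  exact: measurable_fun_pair.
have mN' := measurable_natP N mN.
have mH : measurable_fun setT
    (fun z : nat * (vec R * vec R) => (\1_[set m] z.1)%:E * G z.2)%E.
  apply: emeasurable_funM; last exact: (measurableT_comp mG measurable_snd).
  apply/measurable_EFinP.
  have m1 : measurable_fun setT (\1_[set m] : nat -> R) by exact: measurable_indic.
  exact: (measurableT_comp m1 measurable_fst).
rewrite integral_mkcond.
transitivity (\int[P]_w ((\1_[set m] (N w))%:E * G (x n w, xsum x s w)))%E.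
  apply: eq_integral => w _; rewrite /patch indicE.
  have -> : (w \in N @^-1` [set m]) = (N w \in [set m]).
    by apply/idP/idP; rewrite !inE.
  by case: (N w \in [set m]); rewrite ?mul1e ?mul0e.
rewrite (ge0_integral_indep_pair P (law P N mN') (law P _ mp) _ _ mN' mp _
  (fun z => (\1_[set m] z.1)%:E * G z.2)%E) //; last 2 first.
- by move=> A B mA mB; exact: Nind.
- by move=> z; rewrite mule_ge0.
rewrite fubini_tonelli1//=; last by move=> z; rewrite mule_ge0.
rewrite /fubini_F /=.
under eq_integral do rewrite ge0_integralZl//.
rewrite ge0_integralZr//; last exact: integral_ge0.
congr (_ * _)%E; last exact: (ge0_integral_law P _ mp).
by rewrite integral_indic// setIT.
Qed.

(** This decomposition along the value of N holds for any counting variable; the Poisson weights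
    enter only in [ge0_mecke]. *)
Lemma poisson_mixture (Phi : nat -> Om -> \bar R) :
  (forall m, measurable_fun setT (Phi m)) -> (forall m w, 0 <= Phi m w)%E ->
  (forall m, \int[P]_(w in N @^-1` [set m]) Phi m w =
             P (N @^-1` [set m]) * \int[P]_w Phi m w)%E ->
  (\int[P]_w Phi (N w) w =
   \sum_(m <oo) P (N @^-1` [set m]) * \int[P]_w Phi m w)%E.
Proof.
move=> mPhi Phi0 ind.
have e : \bigcup_n (N @^-1` [set n]) = setT.
  by apply/seteqP; split=> // w _; exists (N w).
rewrite -[in LHS]e ge0_integral_bigcup//.
- apply: eq_eseriesr => m _; rewrite -ind.
  by apply: eq_integral => w; rewrite inE /= => ->.
- rewrite e; exact: (measurable_random_index N mN Phi).
- by apply/trivIsetP => i j _ _ ij; apply/seteqP; split=> // w [/= -> /eqP]; rewrite (negbTE ij).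
Qed.

(* Mecke's formula: summing over the claims of a compound Poisson sum amounts to adding to an
   independent copy (law [kappa]) one extra claim (law [nu]), with weight the Poisson mean. *)
Lemma ge0_mecke (G : vec R * vec R -> \bar R) :
  measurable_fun setT G -> (forall z, 0 <= G z)%E ->
  (\int[P]_w \sum_(n <- iota 0 (N w)) G (x n w, xsum x (rem n (iota 0 (N w))) w) =
   mu%:E * \int[nu \x kappa]_z G z)%E.
Proof.
move=> mG G0.
pose I m := (\int[nu \x kap (iota 0 m)]_z G z)%E.
have mGx n s : measurable_fun setT (fun w => G (x n w, xsum x s w)).
  by apply: (measurableT_comp mG); exact: measurable_fun_pair.
rewrite (poisson_mixture (fun m w => \sum_(n <- iota 0 m)
    G (x n w, xsum x (rem n (iota 0 m)) w))%E); last 3 first.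
- by move=> m; exact: emeasurable_sum.
- by move=> m w; exact: sume_ge0.
- move=> m; rewrite !ge0_integral_sum//; last by move=> n; exact: measurable_funTS.
  rewrite ge0_sume_distrr; last by move=> n _; exact: integral_ge0.
  by apply: eq_bigr => n _; exact: ge0_integral_Nind.
have E1 m : (\int[P]_w \sum_(n <- iota 0 m) G (x n w, xsum x (rem n (iota 0 m)) w) =
             m%:R%:E * I m.-1)%E.
  rewrite ge0_integral_sum//.
  rewrite (eq_big_seq (fun=> I m.-1)); last first.
    move=> n nm; apply: ge0_integral_xpair => //.
    - by rewrite mem_rem_uniqF// iota_uniq.
    - by rewrite rem_uniq// iota_uniq.
    - exact: iota_uniq.
    - by rewrite size_rem// !size_iota.
  rewrite -[X in (X%:R%:E * _)%E](size_iota 0 m).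
  have I0 : (0 <= I m.-1)%E by exact: integral_ge0.
  move: (I m.-1) I0 => c c0; elim: (iota 0 m) => [|a s IH].
    by rewrite big_nil mul0e.
  rewrite big_cons IH [size _]/= -nat1r EFinD ge0_muleDl//; first by rewrite mul1e.
  by rewrite lee_fin.
have -> : (\int[nu \x kappa]_z G z = \sum_(m <oo) P (N @^-1` [set m]) * I m)%E.
  rewrite fubini_tonelli2//.
  pose Gy (y : vec R) := (\int[nu]_v G (v, y))%E.
  have mGy : measurable_fun setT Gy by exact: measurable_fun_fubini_tonelli_G.
  have Gy0 y : (0 <= Gy y)%E by exact: integral_ge0.
  rewrite (ge0_integral_law P _ mcs)//.
  rewrite (poisson_mixture (fun m w => Gy (xsum x (iota 0 m) w))); last 3 first.
  - by move=> m; exact: (measurableT_comp mGy).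
  - by [].
  - move=> m; apply: (ge0_integral_Nind m 0 (iota 0 m) (fun z => Gy z.2)) => //.
    exact: (measurableT_comp mGy).
  apply: eq_eseriesr => m _; congr (_ * _)%E.
  rewrite /I fubini_tonelli2//.
  exact/esym/(ge0_integral_law P _ (msum _) Gy mGy Gy0).
rewrite -nneseriesZl; last by move=> m _; rewrite mule_ge0// integral_ge0.
have T0 m : (0 <= P (N @^-1` [set m]) * \int[P]_w \sum_(n <- iota 0 m)
    G (x n w, xsum x (rem n (iota 0 m)) w))%E.
  by rewrite mule_ge0// integral_ge0// => w _; exact: sume_ge0.
(* The term m = 0 vanishes, and after a shift of the index the claim is the identity (m + 1) p(m +
   1) = mu p(m) between Poisson weights. *)
rewrite nneseries_recl// E1 mul0e mule0 add0e -nneseries_addn//.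
apply: eq_eseriesr => m _; rewrite addn1 E1 /= !Npois !muleA -!EFinM.
congr (_%:E * _)%E.
rewrite factS natrM exprS; field.
by rewrite nat1r !pnatr_eq0 -lt0n fact_gt0.
Qed.

(** The nonnegative case, applied to the positive and negative parts of G, gives two finite sums
    whose difference is the sum for G. *)
Lemma integrable_mecke (G : vec R * vec R -> R) :
  L1 (nu \x kappa)%E G ->
  L1 P (fun w => \sum_(n <- iota 0 (N w)) G (x n w, xsum x (rem n (iota 0 (N w))) w)) /\
  (Ex P (fun w => \sum_(n <- iota 0 (N w)) G (x n w, xsum x (rem n (iota 0 (N w))) w)) =
   mu * Ex (nu \x kappa)%E G).
Proof.
move=> iG; have mG := L1_meas iG.
pose S (g : vec R * vec R -> R) w :=
  \sum_(n <- iota 0 (N w)) g (x n w, xsum x (rem n (iota 0 (N w))) w).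
have key (g : vec R * vec R -> R) : measurable_fun setT g -> (forall z, 0 <= g z) ->
    L1 (nu \x kappa)%E g -> L1 P (S g) /\ Ex P (S g) = mu * Ex (nu \x kappa)%E g.
  move=> mg g0 ig.
  have S0 w : 0 <= S g w by exact: sumr_ge0.
  have mS : measurable_fun setT (S g).
    apply: (measurable_random_index N mN (fun m w =>
      \sum_(n <- iota 0 m) g (x n w, xsum x (rem n (iota 0 m)) w))) => m.
    apply: measurable_sum => n; apply: (measurableT_comp mg).
    exact: measurable_fun_pair.
  have E : (\int[P]_w (S g w)%:E = mu%:E * \int[nu \x kappa]_z (g z)%:E)%E.
    rewrite -ge0_mecke//; last exact/measurable_EFinP.
    by apply: eq_integral => w _; rewrite /S sumEFin.
  have fin : (\int[nu \x kappa]_z (g z)%:E)%E \is a fin_num by exact: integrable_fin_num.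
  split.
    apply/integrableP; split; first exact/measurable_EFinP.
    under eq_integral do rewrite /= ger0_norm//.
    by rewrite E ltey_eq fin_numM.
  by rewrite /Ex E fineM.
have [ip Ep] := key G^\+ (measurable_funrpos mG) (@funrpos_ge0 _ _ G)
  (integrable_funrpos measurableT iG).
have [im Em] := key G^\- (measurable_funrneg mG) (@funrneg_ge0 _ _ G)
  (integrable_funrneg measurableT iG).
have SE : S G = fun w => S G^\+ w - S G^\- w.
  apply/funext => w; rewrite /S -sumrB; apply: eq_bigr => n _.
  by rewrite -[in LHS](funrposBneg G).
rewrite -/(S G) SE; split; first exact: L1B.
rewrite ExB// Ep Em -mulrBr -ExB.
- by congr (_ * _); apply: eq_Ex => z; rewrite -[in RHS](funrposBneg G).
- exact: integrable_funrpos.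
- exact: integrable_funrneg.
Qed.

Lemma mecke_prod (u v : vec R -> R) :
  L1 nu u -> L1 P (fun w => v (csum x N w)) -> measurable_fun setT v ->
  L1 P (fun w => \sum_(n <- iota 0 (N w)) u (x n w) * v (xsum x (rem n (iota 0 (N w))) w)) /\
  (Ex P (fun w => \sum_(n <- iota 0 (N w)) u (x n w) * v (xsum x (rem n (iota 0 (N w))) w)) =
   mu * Ex nu u * Ex P (fun w => v (csum x N w))).
Proof.
move=> iu iv mv.
have ivk : L1 kappa v by exact/L1_law.
have [? E] := integrable_mecke (fun z => u z.1 * v z.2) (integrable_prodM nu kappa u v iu ivk).
split => //; rewrite E -mulrA; congr (_ * _).
by rewrite -(Ex_law P _ mcs)// Ex_prodM.
Qed.

End mecke.

Section sigma_gen.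
Context {d : measure_display} {Om : measurableType d}.
Implicit Types G H : set_system Om.

Lemma sigma_gen_setI G : setI_closed (sigma_gen G).
Proof. by move=> A B; exact: (@measurableI _ (g_sigma_algebraType G) A B). Qed.

Lemma sigma_gen_setT G : sigma_gen G setT.
Proof. exact: (@measurableT _ (g_sigma_algebraType G)). Qed.

Lemma sigma_gen_measurable G : G `<=` measurable -> sigma_gen G `<=` measurable.
Proof. by move=> Gm; apply: smallest_sub => //; exact: sigma_algebra_measurable. Qed.

Lemma sigma_genS G H : G `<=` sigma_gen H -> sigma_gen G `<=` sigma_gen H.
Proof. by move=> GH; apply: smallest_sub => //; exact: smallest_sigma_algebra. Qed.

Lemma sub_sigma_gen G : G `<=` sigma_gen G.
Proof. exact: sub_sigma_algebra. Qed.

Lemma indep_bool {R : realType} (P : probability Om R) (F : bool -> set_system Om)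
    A B : indep P F -> F true A -> F false B -> (P (A `&` B) = P A * P B)%E.
Proof.
move=> /(_ [:: true; false] isT (fun b => if b then A else B)) + FA FB.
rewrite !big_cons big_nil mule1 => <-; last by move=> [].
congr (P _); apply/seteqP; split => w /=; first by move=> [? ?] [].
by move=> h; split; [exact: (h true)|exact: (h false)].
Qed.

End sigma_gen.

(** * Moments in the special model *)

Section claim_vector.
Context {R : realType} {d : measure_display} {Om : measurableType d}.

(** The contribution of a claim to the cumulative amounts of all development years at once; the
    compound sum of these paths has the [Cl] of its row as coordinates. *)
Definition claim (D : Om -> nat) (Z : Om -> R) (w : Om) : vec R :=
  fun t => Z w * (D w <= t)%N%:R.

Lemma measurable_claim D Z : (forall B : set nat, measurable (D @^-1` B)) ->
  measurable_fun setT Z -> measurable_fun setT (claim D Z).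
Proof.
move=> mD mZ; apply: measurable_vecP => t; apply: measurable_funM => //.
have -> : (fun w => (D w <= t)%N%:R) = \1_(D @^-1` [set n | (n <= t)%N]) :> (Om -> R).
  apply/funext => w; rewrite indicE; congr (_%:R); congr nat_of_bool.
  by apply/idP/idP; rewrite inE.
exact: measurable_indic.
Qed.

(** An event about the path splits, along the countably many values n of D, into events {D = n, Z in
    B}, which is where the two pairs are known to agree. *)
Lemma claim_law (P : probability Om R) D D' Z Z' :
  (forall B : set nat, measurable (D @^-1` B)) -> measurable_fun setT Z ->
  (forall B : set nat, measurable (D' @^-1` B)) -> measurable_fun setT Z' ->
  (forall (n : nat) (B : set R), measurable B ->
     P (D @^-1` [set n] `&` Z @^-1` B) = P (D' @^-1` [set n] `&` Z' @^-1` B)) ->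
  forall A, measurable A -> P (claim D Z @^-1` A) = P (claim D' Z' @^-1` A).
Proof.
move=> mD mZ mD' mZ' DZ A mA.
pose B n : set R := [set z | A (fun t => z * (n <= t)%N%:R)].
have mB n : measurable (B n).
  have : measurable_fun setT ((fun z t => z * (n <= t)%N%:R) : R -> vec R).
    by apply: measurable_vecP => t; exact: measurable_funM.
  by move=> /(_ measurableT A mA); rewrite setTI.
have E (D0 : Om -> nat) (Z0 : Om -> R) : claim D0 Z0 @^-1` A =
    \bigcup_n (D0 @^-1` [set n] `&` Z0 @^-1` B n).
  apply/seteqP; split => w /=; first by move=> Aw; exists (D0 w).
  by move=> [n _ [/= e]]; rewrite /claim e.
have tr (D0 : Om -> nat) (Z0 : Om -> R) :
    trivIset setT (fun n => D0 @^-1` [set n] `&` Z0 @^-1` B n).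
  apply/trivIsetP => i j _ _ ij; apply/seteqP; split => // w [[/= -> _] [/= ji _]].
  by move/eqP : ij; rewrite ji.
have mDZ (D0 : Om -> nat) (Z0 : Om -> R) n :
    (forall B : set nat, measurable (D0 @^-1` B)) -> measurable_fun setT Z0 ->
    measurable (D0 @^-1` [set n] `&` Z0 @^-1` B n).
  move=> mD0 mZ0; apply: measurableI => //.
  by rewrite -[X in measurable X]setTI; exact: mZ0.
rewrite !E !measure_bigcup//; last 2 first.
- by move=> n _; exact: mDZ.
- by move=> n _; exact: mDZ.
by apply: eq_eseriesr => n _; exact: DZ.
Qed.

End claim_vector.

Section model.
Context {R : realType} {d : measure_display} {Om : measurableType d}.
Variables (P : probability Om R) (T : nat) (lam : nat -> R)
  (M : nat -> R -> Om -> nat) (Dk : nat -> nat -> Om -> nat)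
  (Zk : nat -> nat -> Om -> R) (D : Om -> nat) (Z : Om -> R).
Hypothesis SM : special_model P T lam M Dk Zk D Z.
Variable i : nat.
Hypothesis iT : (1 <= i <= T)%N.

Let x n : Om -> vec R := claim (Dk i n) (Zk i n).

Lemma measurable_claim0 : measurable_fun setT (claim D Z).
Proof. by apply: measurable_claim; [exact: (sm_D_meas SM)|exact: (sm_Z_meas SM)]. Qed.

Lemma measurable_claimk n : measurable_fun setT (x n).
Proof.
by apply: measurable_claim; [exact: (sm_Dk_meas SM)|exact: (sm_Zk_meas SM)].
Qed.

Definition nu := law P (claim D Z) measurable_claim0.

Lemma claimk_law n A : measurable A -> P (x n @^-1` A) = nu A.
Proof.
apply: claim_law.
- exact: (sm_Dk_meas SM).
- exact: (sm_Zk_meas SM).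
- exact: (sm_D_meas SM).
- exact: (sm_Z_meas SM).
- exact: (sm_ident SM).
Qed.

Lemma sigDZk_measurable n : sigDZk Dk Zk i n `<=` measurable.
Proof.
apply: sigma_gen_measurable => _ [[u [_ [B ->]]]|[u [_ [B mB ->]]]].
  exact: (sm_Dk_meas SM).
by rewrite -[X in measurable X]setTI; exact: (sm_Zk_meas SM).
Qed.

(** Measurability with respect to a sub-sigma-algebra is expressed by retyping the domain as
    [g_sigma_algebraType G], so that the general measurability lemmas apply unchanged. *)
Lemma measurable_claimk_gen n (G : set_system Om) : sigDZk Dk Zk i n `<=` sigma_gen G ->
  measurable_fun setT (x n : g_sigma_algebraType G -> vec R).
Proof.
move=> GG; apply: measurable_claim.
  move=> B; apply: GG; apply: sub_sigma_gen; left.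
  by exists tt; split => //; exists B.
move=> _ B mB; rewrite setTI; apply: GG; apply: sub_sigma_gen; right.
by exists tt; split => //; exists B.
Qed.

Lemma claimk_indep n s : n \notin s -> forall A B : set (vec R),
  measurable A -> measurable B ->
  (P (x n @^-1` A `&` xsum x s @^-1` B) = P (x n @^-1` A) * P (xsum x s @^-1` B))%E.
Proof.
move=> ns A B mA mB.
apply: (@indep_grouping _ _ _ P nat (sigDZk Dk Zk i) n [set l | l \in s]).
- exact: sigDZk_measurable.
- by move=> j; exact: sigma_gen_setT.
- by move=> j; exact: sigma_gen_setI.
- exact: (sm_iid SM).
- by move/negP : ns.
- have := @measurable_claimk_gen n
    (preN setT (fun _ : unit => Dk i n) `|` preR setT (fun _ : unit => Zk i n)).
  by move=> /(_ (fun _ h => h)) /(_ measurableT A mA); rewrite setTI.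
- pose G := \bigcup_(l in [set l | l \in s]) sigDZk Dk Zk i l.
  have : measurable_fun setT (xsum x s : g_sigma_algebraType G -> vec R).
    apply: measurable_vecP => t.
    (* [measurable_sum] asks every term to be measurable, but [x l] is measurable for this
       sigma-algebra only when l is in s; the other terms are replaced by 0. *)
    rewrite [X in measurable_fun _ X](_ : _ = fun w =>
        \sum_(l <- s) (if l \in s then x l w t else 0)); last first.
      by apply/funext => w; apply: eq_big_seq => l ->.
    apply: measurable_sum => l; have [ls|ls] := boolP (l \in s); last first.
      exact: measurable_cst.
    apply: (measurableT_comp (measurable_vcoord t)).
    apply: measurable_claimk_gen => A' A'l; apply: sub_sigma_gen.
    by exists l.
  by move=> /(_ measurableT B mB); rewrite setTI.
Qed.

Lemma sigM_DZ_indep A B : sigM M i A -> sigDZ Dk Zk i B ->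
  (P (A `&` B) = P A * P B)%E.
Proof. exact: (indep_bool _ _ _ _ (sm_M_DZ SM iT)). Qed.

Lemma claimk_sigDZ n : sigDZk Dk Zk i n `<=` sigDZ Dk Zk i.
Proof.
apply: sigma_genS => _ [[u [_ [B ->]]]|[u [_ [B mB ->]]]]; apply: sub_sigma_gen.
  by left; exists n; split => //; exists B.
by right; exists n; split => //; exists B.
Qed.

Variable a : R.
Hypothesis a0 : 0 <= a.
Let N := M i a.

Lemma count_claims_indep (C : set nat) n s (A : set (vec R * vec R)) : measurable A ->
  (P (N @^-1` C `&` [set w | A (x n w, xsum x s w)]) =
   P (N @^-1` C) * P [set w | A (x n w, xsum x s w)])%E.
Proof.
move=> mA; apply: sigM_DZ_indep.
  by apply: sub_sigma_gen; exists a; split => //; exists C.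
pose G := preN setT (Dk i) `|` preR setT (Zk i).
have mx l : measurable_fun setT (x l : g_sigma_algebraType G -> vec R).
  by apply: measurable_claimk_gen; exact: claimk_sigDZ.
have : measurable_fun setT (fun w : g_sigma_algebraType G => (x n w, xsum x s w)).
  by apply: measurable_fun_pair => //; exact: measurable_xsum.
by move=> /(_ measurableT A mA); rewrite setTI.
Qed.

Lemma measurable_count (B : set nat) : measurable (N @^-1` B).
Proof. by apply: (pp_meas (sm_poisson SM iT)). Qed.

Lemma count_poisson m :
  P (N @^-1` [set m]) = (expR (- (lam i * a)) * (lam i * a) ^+ m / m`!%:R)%:E.
Proof.
have := pp_incr_law (sm_poisson SM iT) (a := 0) (b := a).
rewrite lexx a0 => /(_ isT m); rewrite subr0 => <-.
congr (P _); apply/seteqP; split => w /=; rewrite (pp_zero (sm_poisson SM iT)) subn0//.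
Qed.

Lemma csum_Cl w t : csum x N w t = Cl M Dk Zk a i t w.
Proof.
rewrite /csum /xsum /Cl -[iota 0 _]/(iota 0 (N w)).
by rewrite -(big_mkord xpredT (fun k => Zk i k w * (Dk i k w <= t)%N%:R)) /index_iota subn0.
Qed.

Lemma model_mecke (u v : vec R -> R) :
  L1 P (fun w => u (claim D Z w)) -> measurable_fun setT u ->
  L1 P (fun w => v (csum x N w)) -> measurable_fun setT v ->
  let S w := \sum_(n <- iota 0 (N w)) u (x n w) * v (xsum x (rem n (iota 0 (N w))) w) in
  L1 P S /\
  Ex P S = lam i * a * Ex P (fun w => u (claim D Z w)) * Ex P (fun w => v (csum x N w)).
Proof.
move=> iu mu iv mv.
have := @mecke_prod _ _ _ P x N (lam i * a) nu measurable_claimk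
  (fun n => measurable_count [set n]) claimk_law claimk_indep count_claims_indep
  count_poisson u v.
rewrite /nu Ex_law//; apply => //; exact/L1_law.
Qed.

Let C t w := Cl M Dk Zk a i t w.
Let Y t w := Z w * (D w <= t)%N%:R.

Lemma measurable_Cl t : measurable_fun setT (C t).
Proof.
have h : measurable_fun setT (csum x N).
  apply: measurable_csum => [n|n]; [exact: measurable_claimk|exact: measurable_count].
rewrite (_ : C t = fun w => csum x N w t); last by apply/funext => w; rewrite csum_Cl.
exact: (measurableT_comp (measurable_vcoord t) h).
Qed.

(** In C h(C) each claim multiplies h of itself plus the remaining sum, so Mecke's formula replaces
    the remaining sum by an independent copy of C. The independence is rendered by an iterated
    expectation: w carries the extra claim, w' the sum. This identity is the source of the Stein
    argument. *)
Lemma model_size_bias t (h : R -> R) (b : R) : L1 P (Y t) ->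
  measurable_fun setT h -> (forall r, `|h r| <= b) ->
  [/\ L1 P (fun w => C t w * h (C t w)),
      L1 P (fun w => Y t w * Ex P (fun w' => h (C t w' + Y t w))) &
      Ex P (fun w => C t w * h (C t w)) =
      lam i * a * Ex P (fun w => Y t w * Ex P (fun w' => h (C t w' + Y t w)))].
Proof.
move=> iY mh hb.
pose mcs := measurable_csum x measurable_claimk N (fun n => measurable_count [set n]).
pose G (z : vec R * vec R) := z.1 t * h (z.2 t + z.1 t).
have m1 : measurable_fun setT (fun z : vec R * vec R => z.1 t).
  exact: (measurableT_comp (measurable_vcoord t) measurable_fst).
have m2 : measurable_fun setT (fun z : vec R * vec R => z.2 t).
  exact: (measurableT_comp (measurable_vcoord t) measurable_snd).
have mG : measurable_fun setT G.
  apply: measurable_funM => //; apply: (measurableT_comp mh).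
  exact: measurable_funD.
pose kap := law P (csum x N) mcs.
have mv := measurable_vcoord t.
have inu : L1 nu (fun y => y t) by exact/L1_law.
have iG : L1 (nu \x kap)%E G.
  have i1 := integrable_prodM nu kap _ _ inu (L1_cst kap b).
  apply: (L1_dom mG i1) => z.
  by rewrite !normrM ler_wpM2l// (le_trans (hb _))// ler_norm.
have [iS ES] := integrable_mecke P x N (lam i * a) nu measurable_claimk
  (fun n => measurable_count [set n]) claimk_law claimk_indep count_claims_indep
  count_poisson G iG.
have SE : (fun w => \sum_(n <- iota 0 (N w)) G (x n w, xsum x (rem n (iota 0 (N w))) w)) =
    (fun w => C t w * h (C t w)).
  apply/funext => w; rewrite /C -csum_Cl [in RHS]/csum {1}/xsum mulr_suml.
  apply: eq_big_seq => n nN; rewrite /G /=; congr (_ * h _).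
  by rewrite (xsum_rem x n)// addrC.
rewrite SE in iS, ES.
have iGy y : L1 kap (fun s => G (y, s)).
  apply: (@L1_bounded _ _ _ _ _ (`|y t| * b)).
    exact: (measurableT_comp mG (pair1_measurable y)).
  by move=> s; rewrite normrM ler_wpM2l.
have GE y : Ex kap (fun s => G (y, s)) = y t * Ex P (fun w' => h (C t w' + y t)).
  have e : (fun w' => h (C t w' + y t)) = (fun w' => h (csum x N w' t + y t)).
    by apply/funext => w'; rewrite csum_Cl.
  have mhy : measurable_fun setT (fun s : vec R => h (s t + y t)).
    by apply: (measurableT_comp mh); exact: measurable_funD.
  rewrite e /kap -(Ex_law P _ mcs (fun s : vec R => h (s t + y t)))//; last first.
    apply: (@L1_bounded _ _ _ _ _ (b)) => //.
    exact: (measurableT_comp mhy mcs).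
  by rewrite ExZ//; apply: (@L1_bounded _ _ _ _ _ (b)).
have [iF EF] := Ex_fubini nu kap G iG iGy.
have FE : (fun y => Ex kap (fun s => G (y, s))) =
          (fun y => y t * Ex P (fun w' => h (C t w' + y t))).
  by apply/funext => y; exact: GE.
rewrite FE in iF, EF.
have iF' := (L1_law P _ measurable_claim0 _ (L1_meas iF)).1 iF.
split => //.
rewrite ES; congr (_ * _).
by rewrite EF /nu Ex_law//; exact: L1_meas iF.
Qed.

End model.

Section generic_pair.
Context {R : realType} {d : measure_display} {Om : measurableType d}.
Variables (P : probability Om R) (T : nat) (lam : nat -> R)
  (M : nat -> R -> Om -> nat) (Dk : nat -> nat -> Om -> nat)
  (Zk : nat -> nat -> Om -> R) (D : Om -> nat) (Z : Om -> R).
Hypothesis SM : special_model P T lam M Dk Zk D Z.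

Let mZ : measurable_fun setT Z := sm_Z_meas SM.

Lemma L1_sqrZ : L1 P (fun w => Z w ^+ 2).
Proof. exact: (sm_Z2 SM). Qed.

Lemma L1_Z : L1 P Z.
Proof.
apply: (L1_dom mZ (L1D (L1_cst P 1) L1_sqrZ)) => w.
rewrite (ger0_norm (x := 1 + _)) ?addr_ge0 ?sqr_ge0//.
by rewrite -(real_normK (num_real (Z w))); have := sqr_ge0 (`|Z w| - 2^-1); nra.
Qed.

Implicit Types p q : nat -> bool.

Definition prD (p : nat -> bool) := Pr P [set w | p (D w)].

Lemma Ex_DZ (p : nat -> bool) (u : R -> R) : measurable_fun setT u ->
  L1 P (fun w => u (Z w)) ->
  L1 P (fun w => u (Z w) * (p (D w))%:R) /\
  Ex P (fun w => u (Z w) * (p (D w))%:R) = Ex P (fun w => u (Z w)) * prD p.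
Proof.
move=> mu iu.
pose v n : R := (p n)%:R.
have mD : measurable_fun setT D.
  by apply: measurable_natP => n; exact: (sm_D_meas SM).
have vE : (fun w => v (D w)) = \1_[set w | p (D w)].
  apply/funext => w; rewrite /v indicE; congr (_%:R); congr nat_of_bool.
  by apply/idP/idP; rewrite inE.
have mpD : measurable [set w | p (D w)] by exact: (sm_D_meas SM [set n | p n]).
have [||||h1 h2] := @Ex_indep_pair _ _ _ _ _ _ _ P Z D mZ mD _ u v mu.
- move=> A B mA mB; rewrite setIC muleC; apply: (indep_bool _ _ _ _ (sm_DZ_indep SM)).
  + by apply: sub_sigma_gen; exists tt; split => //; exists B.
  + by apply: sub_sigma_gen; exists tt; split => //; exists A.
- by [].
- by [].
- by rewrite vE; exact: L1_indic.
- split => //; rewrite h2; congr (_ * _).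
  by rewrite vE Ex_indic.
Qed.

Lemma Ex_ZD (p : nat -> bool) :
  L1 P (fun w => Z w * (p (D w))%:R) /\
  Ex P (fun w => Z w * (p (D w))%:R) = Ex P Z * prD p.
Proof. by apply: (Ex_DZ p id) => //; exact: L1_Z. Qed.

Lemma Ex_Z2D (p : nat -> bool) :
  L1 P (fun w => Z w ^+ 2 * (p (D w))%:R) /\
  Ex P (fun w => Z w ^+ 2 * (p (D w))%:R) = Ex P (fun w => Z w ^+ 2) * prD p.
Proof.
by apply: (Ex_DZ p (fun x => x ^+ 2)) => //; exact: L1_sqrZ.
Qed.

Let mpD (p : nat -> bool) : measurable [set w | p (D w)].
Proof. exact: (sm_D_meas SM [set n | p n]). Qed.

Lemma prD_ge0 p : 0 <= prD p.
Proof. by rewrite /prD /Pr fine_ge0. Qed.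

Lemma prDE p : (prD p)%:E = P [set w | p (D w)].
Proof. by rewrite /prD /Pr fineK// fin_num_measure. Qed.

Lemma prD_disjoint (p q : nat -> bool) : (forall n, ~~ (p n && q n)) ->
  prD (fun n => p n || q n) = prD p + prD q.
Proof.
move=> pq; apply: EFin_inj; rewrite EFinD !prDE.
rewrite -measureU//; last first.
  by apply/seteqP; split => // w /= [pw qw]; have := pq (D w); rewrite pw qw.
by congr (P _); apply/seteqP; split => w /=; [move/orP|move=> /orP].
Qed.

Lemma prD_true (p : nat -> bool) : (forall n, (1 <= n <= T)%N -> p n) -> prD p = 1.
Proof.
move=> h; apply: EFin_inj; rewrite prDE -(probability_setT P); congr (P _).
by apply/seteqP; split => // w _ /=; apply: h; exact: (sm_D_range SM).
Qed.

Lemma eq_prD p q : p =1 q -> prD p = prD q.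
Proof. by move=> pq; rewrite /prD; congr Pr; apply/seteqP; split => w /=; rewrite pq. Qed.

Lemma prD_le_gt t : prD (fun n => (n <= t)%N) + prD (fun n => (t < n)%N) = 1.
Proof.
rewrite -prD_disjoint; last by move=> n; rewrite ltnNge; case: leqP.
by apply: prD_true => n _; case: leqP.
Qed.

Lemma prD_leS t : prD (fun n => (n <= t.+1)%N) =
  prD (fun n => (n <= t)%N) + prD (fun n => n == t.+1).
Proof.
rewrite -prD_disjoint; last by move=> n; case: eqP => [->|]; rewrite ?ltnn ?andbF.
by apply: eq_prD => n; rewrite leq_eqVlt orbC ltnS.
Qed.

Hypothesis T0 : (0 < T)%N.

Lemma EZ_prD_gt0 t : (1 <= t <= T)%N -> 0 < Ex P Z * prD (fun n => n == t).
Proof. by move=> h; rewrite -(Ex_ZD (fun n => n == t)).2; exact: (sm_ZD_pos SM). Qed.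

(** The model gives the sign of the product E[Z] P(D = 1) only; since a probability is nonnegative,
    the sign passes to E[Z]. *)
Lemma EZ_gt0 : 0 < Ex P Z.
Proof.
have := @EZ_prD_gt0 1 _; rewrite T0 => /(_ isT).
by have := prD_ge0 (fun n => n == 1); nra.
Qed.

Lemma prD_eq_gt0 t : (1 <= t <= T)%N -> 0 < prD (fun n => n == t).
Proof. by move=> /EZ_prD_gt0; rewrite pmulr_rgt0 ?EZ_gt0. Qed.

Lemma prD_le_gt0 t : (1 <= t)%N -> 0 < prD (fun n => (n <= t)%N).
Proof.
case: t => // t _; elim: t => [|t IH].
  by rewrite prD_leS ltr_wpDl ?prD_ge0// prD_eq_gt0.
by rewrite prD_leS ltr_pwDl ?prD_ge0.
Qed.

(** E[Z^2] >= E[Z]^2, from the nonnegativity of (Z - E[Z])^2. *)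
Lemma EZ2_gt0 : 0 < Ex P (fun w => Z w ^+ 2).
Proof.
have iZ := L1_Z; have i2 := L1_sqrZ; have z0 := EZ_gt0.
have := @le_Ex _ _ _ P (fun w => 2 * Ex P Z * Z w) (fun w => Z w ^+ 2 + Ex P Z ^+ 2).
move=> /(_ (L1Z _ iZ) (L1D i2 (L1_cst P _))).
rewrite ExZ// ExD// ?Ex_cst; last exact: L1_cst.
have h w : 2 * Ex P Z * Z w <= Z w ^+ 2 + Ex P Z ^+ 2.
  by have := sqr_ge0 (Z w - Ex P Z); nra.
by move=> /(_ h); nra.
Qed.

End generic_pair.

Section row_moments.
Context {R : realType} {d : measure_display} {Om : measurableType d}.
Variables (P : probability Om R) (T : nat) (lam : nat -> R)
  (M : nat -> R -> Om -> nat) (Dk : nat -> nat -> Om -> nat)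
  (Zk : nat -> nat -> Om -> R) (D : Om -> nat) (Z : Om -> R).
Hypothesis SM : special_model P T lam M Dk Zk D Z.
Variable i : nat.
Hypothesis iT : (1 <= i <= T)%N.
Variable a : R.
Hypothesis a0 : 0 <= a.
Let N := M i a.
Let x n : Om -> vec R := claim (Dk i n) (Zk i n).
Let S := csum x N.
Let mu := lam i * a.
Let EZ := Ex P Z.
Let EZ2 := Ex P (fun w => Z w ^+ 2).

Let mecke := model_mecke P T lam M Dk Zk D Z SM i iT a a0.

(** Mecke's formula with constant test functions, whose sum over the claims counts them. *)
Lemma Ex_count : Ex P (fun w => (N w)%:R) = mu.
Proof.
have [_] := mecke (fun=> 1) (fun=> 1) (L1_cst P 1) (measurable_cst _)
  (L1_cst P 1) (measurable_cst _).
rewrite !Ex_cst !mulr1 => e; rewrite /mu -e; apply: eq_Ex => w.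
by rewrite -(size_iota 0 (N w)) -sum1_size natr_sum.
Qed.

Let c t (s : vec R) := s t.
Let mc t : measurable_fun setT (c t) := measurable_vcoord t.

(** In the square of the sum, the diagonal terms contribute mu E[y^2] for a generic claim y, and
    each claim times the remaining sum contributes, by Mecke's formula, the square of the mean. *)
Lemma Ex_Cl_moments t : let m := prD P D (fun n => (n <= t)%N) in
  [/\ L1 P (fun w => S w t), Ex P (fun w => S w t) = mu * (EZ * m),
      L1 P (fun w => S w t ^+ 2) &
      Ex P (fun w => S w t ^+ 2) = mu * (EZ2 * m) + (mu * (EZ * m)) ^+ 2].
Proof.
move=> m.
have [i1 e1] := Ex_ZD P T lam M Dk Zk D Z SM (fun n => (n <= t)%N).
have [i2 e2] := Ex_Z2D P T lam M Dk Zk D Z SM (fun n => (n <= t)%N).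
have i2' : L1 P (fun w => c t (claim D Z w) ^+ 2).
  rewrite (_ : (fun w => _) = (fun w => Z w ^+ 2 * (D w <= t)%N%:R))//.
  by apply/funext => w; rewrite /c /claim exprMn; case: (_ <= _)%N; rewrite ?expr1n ?expr0n.
have e2' : Ex P (fun w => c t (claim D Z w) ^+ 2) = EZ2 * m.
  rewrite -e2; apply: eq_Ex => w.
  by rewrite /c /claim exprMn; case: (_ <= _)%N; rewrite ?expr1n ?expr0n.
have [iS eS] := mecke (c t) (fun=> 1) i1 (mc t) (L1_cst P 1) (measurable_cst _).
have SE : (fun w => \sum_(n <- iota 0 (N w)) c t (x n w) * 1) = (fun w => S w t).
  by apply/funext => w; apply: eq_bigr => n _; rewrite mulr1.
rewrite SE in iS eS; rewrite Ex_cst mulr1 e1 in eS.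
have m2 : measurable_fun setT (fun s => c t s ^+ 2) by exact: measurable_funX.
have [iA eA] := mecke (c t) (c t) i1 (mc t) iS (mc t).
have [iB eB] := mecke (fun s => c t s ^+ 2) (fun=> 1) i2' m2 (L1_cst P 1) (measurable_cst _).
have E w : S w t ^+ 2 =
    \sum_(n <- iota 0 (N w)) c t (x n w) * c t (xsum x (rem n (iota 0 (N w))) w) +
    \sum_(n <- iota 0 (N w)) c t (x n w) ^+ 2 * 1.
  rewrite -big_split /= expr2 {1}/S /csum {1}/xsum mulr_suml.
  apply: eq_big_seq => n nN; rewrite mulr1 /c.
  have -> : S w t = x n w t + xsum x (rem n (iota 0 (N w))) w t.
    by rewrite /S /csum (xsum_rem x n _ w nN).
  by rewrite mulrDr -expr2 addrC.
split => //.
- by rewrite (funext E); exact: L1D.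
- rewrite (eq_Ex P E) ExD// eA eB e1 e2' Ex_cst.
  rewrite -/(S) [Ex P (fun w => c t (csum x N w))]eS /mu -/EZ -/m; ring.
Qed.

Variable k : nat.
Hypothesis kT : (k <= T)%N.
Let u (s : vec R) := s T - s k.
Let mu_ : measurable_fun setT u.
Proof. by apply: measurable_funB; exact: measurable_vcoord. Qed.
Let q := prD P D (fun n => (k < n)%N).

Let u_claim w : u (claim D Z w) = Z w * (k < D w)%N%:R.
Proof.
rewrite /u /claim; have /andP[_ ->] := sm_D_range SM w.
by case: leqP; rewrite ?mulr0 ?mulr1 ?subr0 ?subrr.
Qed.

(* A claim reported after [k] does not contribute to the coordinates up to [k], so removing it
   from the sum leaves [v] unchanged and Mecke's formula applies to [u * v]. *)
Lemma run_off_moments (v : vec R -> R) : measurable_fun setT v ->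
  (forall s s' : vec R, (forall t, (t <= k)%N -> s t = s' t) -> v s = v s') ->
  L1 P (fun w => v (S w)) ->
  [/\ L1 P (fun w => u (S w) * v (S w)),
      Ex P (fun w => u (S w) * v (S w)) = mu * (EZ * q) * Ex P (fun w => v (S w)),
      L1 P (fun w => u (S w) ^+ 2 * v (S w)) &
      Ex P (fun w => u (S w) ^+ 2 * v (S w)) =
        (mu * (EZ2 * q) + (mu * (EZ * q)) ^+ 2) * Ex P (fun w => v (S w))].
Proof.
move=> mv vk iv.
have [i1 e1] := Ex_ZD P T lam M Dk Zk D Z SM (fun n => (k < n)%N).
have [i2 e2] := Ex_Z2D P T lam M Dk Zk D Z SM (fun n => (k < n)%N).
have uS w : u (S w) = \sum_(n <- iota 0 (N w)) u (x n w).
  by rewrite /u /S /csum /xsum -sumrB.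
have urem w n : n \in iota 0 (N w) ->
    u (S w) = u (x n w) + u (xsum x (rem n (iota 0 (N w))) w).
  by move=> nN; rewrite /u /S /csum (xsum_rem x n _ w nN); ring.
have vrem w n : n \in iota 0 (N w) ->
    u (x n w) * v (xsum x (rem n (iota 0 (N w))) w) = u (x n w) * v (S w).
  move=> nN; have [->|un0] := eqVneq (u (x n w)) 0; first by rewrite !mul0r.
  congr (_ * _); apply: vk => t tk; rewrite /S /csum (xsum_rem x n _ w nN).
  suff -> : x n w t = 0 by rewrite add0r.
  rewrite /x /claim; case: leqP => Dt; last by rewrite mulr0.
  move: un0; rewrite /u /x /claim (leq_trans Dt tk).
  by rewrite (leq_trans (leq_trans Dt tk) kT) subrr eqxx.
have iu1 : L1 P (fun w => u (claim D Z w)) by rewrite (funext u_claim).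
have eu1 : Ex P (fun w => u (claim D Z w)) = EZ * q.
  by rewrite (eq_Ex P u_claim) e1.
have u2_claim w : u (claim D Z w) ^+ 2 = Z w ^+ 2 * (k < D w)%N%:R.
  by rewrite u_claim exprMn; case: (_ < _)%N; rewrite ?expr1n ?expr0n.
have iu2 : L1 P (fun w => u (claim D Z w) ^+ 2) by rewrite (funext u2_claim).
have eu2 : Ex P (fun w => u (claim D Z w) ^+ 2) = EZ2 * q.
  by rewrite (eq_Ex P u2_claim) e2.
have mu2 : measurable_fun setT (fun s => u s ^+ 2) by exact: measurable_funX.
have [iA eA] := mecke u v iu1 mu_ iv mv.
have EA w : \sum_(n <- iota 0 (N w)) u (x n w) * v (xsum x (rem n (iota 0 (N w))) w) =
    u (S w) * v (S w).
  by rewrite (eq_big_seq _ (vrem w)) -mulr_suml -uS.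
rewrite (funext EA) in iA; rewrite (eq_Ex P EA) eu1 in eA.
(* Second use of Mecke's formula, with [u * v] as the function of the remaining sum; [u * v] depends
   on coordinate T, so here the deleted claim cannot be put back as it was for [v]. *)
have [iB eB] := mecke u (fun s => u s * v s) iu1 mu_ iA (measurable_funM mu_ mv).
have [iC eC] := mecke (fun s => u s ^+ 2) v iu2 mu2 iv mv.
have EBC w : u (S w) ^+ 2 * v (S w) =
    \sum_(n <- iota 0 (N w)) u (x n w) *
       (u (xsum x (rem n (iota 0 (N w))) w) * v (xsum x (rem n (iota 0 (N w))) w)) +
    \sum_(n <- iota 0 (N w)) u (x n w) ^+ 2 * v (xsum x (rem n (iota 0 (N w))) w).
  rewrite -big_split /= expr2 -mulrA {1}uS mulr_suml.
  apply: eq_big_seq => n nN.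
  have h := vrem w n nN.
  transitivity (u (S w) * (u (x n w) * v (S w))); first by ring.
  by rewrite -h (urem w n nN); ring.
split => //.
- by rewrite (funext EBC); exact: L1D.
- have eB' : Ex P (fun w => \sum_(n <- iota 0 (N w)) u (x n w) *
       (u (xsum x (rem n (iota 0 (N w))) w) * v (xsum x (rem n (iota 0 (N w))) w))) =
     mu * (EZ * q) * Ex P (fun w => u (S w) * v (S w)) by rewrite -eu1; exact: eB.
  have eC' : Ex P (fun w => \sum_(n <- iota 0 (N w)) u (x n w) ^+ 2 *
       v (xsum x (rem n (iota 0 (N w))) w)) =
     mu * (EZ2 * q) * Ex P (fun w => v (S w)) by rewrite -eu2; exact: eC.
  have eA' : Ex P (fun w => u (S w) * v (S w)) = mu * (EZ * q) * Ex P (fun w => v (S w)).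
    exact: eA.
  by rewrite (eq_Ex P EBC) ExD// eB' eC' eA'; ring.
Qed.

End row_moments.

(** * Conditional expectation given the triangle *)

(** Inversion is continuous only away from 0, where it has the default value 0, so the line is cut
    at that point. *)
Lemma measurable_invr (R : realType) : measurable_fun [set: R] (@GRing.inv R).
Proof.
rewrite (_ : [set: R] = [set 0] `|` ~` [set 0]); last by rewrite setUCr.
apply/measurable_funU => //; first exact: measurableC.
split; first exact: measurable_fun_set1.
apply: open_continuous_measurable_fun.
  by apply: closed_openC; exact: closed_eq.
by move=> r; rewrite inE /= => r0; apply: inv_continuous; exact/eqP.
Qed.

Section conditional_expectation.
Context {R : realType} {d : measure_display} {Om : measurableType d}.
Variables (P : probability Om R) (T : nat) (lam : nat -> R)
  (M : nat -> R -> Om -> nat) (Dk : nat -> nat -> Om -> nat)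
  (Zk : nat -> nat -> Om -> R) (D : Om -> nat) (Z : Om -> R).
Hypothesis SM : special_model P T lam M Dk Zk D Z.
Variable a : R.
Hypothesis a0 : 0 <= a.

Let row_gen j := preN [set a : R | 0 <= a] (M j) `|` preN setT (Dk j) `|` preR setT (Zk j).
Let S j := csum (fun n => claim (Dk j n) (Zk j n)) (M j a).

Lemma measurable_csum_row j :
  measurable_fun setT (S j : g_sigma_algebraType (row_gen j) -> vec R).
Proof.
apply: measurable_csum => [n|n].
  apply: measurable_claim => [B|].
    by apply: sub_sigma_gen; left; right; exists n; split => //; exists B.
  move=> _ B mB; rewrite setTI; apply: sub_sigma_gen; right.
  by exists n; split => //; exists B.
by apply: sub_sigma_gen; left; left; exists a; split => //; exists [set n].
Qed.

Lemma csum_row_preimage j (A : set (vec R)) : measurable A ->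
  sigRow M Dk Zk j (S j @^-1` A).
Proof. by move=> mA; have := measurable_csum_row j measurableT A mA; rewrite setTI. Qed.

Lemma sigRow_measurable j : (1 <= j <= T)%N -> sigRow M Dk Zk j `<=` measurable.
Proof.
move=> jT; apply: sigma_gen_measurable => A [[|]|].
- by move=> [b [/= b0 [B ->]]]; exact: (pp_meas (sm_poisson SM jT)).
- by move=> [n [_ [B ->]]]; exact: (sm_Dk_meas SM).
- move=> [n [_ [B mB ->]]]; rewrite -[X in measurable X]setTI.
  exact: (sm_Zk_meas SM).
Qed.

Variable i : nat.
Hypothesis iT : (2 <= i <= T)%N.
Let k := (T - i + 1)%N.
Let i1T : (1 <= i <= T)%N.
Proof. by case/andP: iT => /ltnW -> ->. Qed.

(** Rows are numbered from 1 in the model but by ordinals from 0 in [sm_rows]; this is the ordinal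
    of row i, kept transparent so that its successor computes. *)
Let i0 : 'I_T.
Proof. by exists i.-1; case: (i) iT => // j /andP[]. Defined.

Let i0E : i0.+1 = i.
Proof. by rewrite /=; case: (i) iT. Qed.

(** All information on the other rows, including their unobserved part: it is larger than what the
    triangle reveals, yet still independent of row i. *)
Let Go := <<s \bigcup_(j in [set j : 'I_T | j != i0]) sigRow M Dk Zk j.+1 >>.

Lemma row_indep_others A B : sigRow M Dk Zk i A -> Go B ->
  (P (A `&` B) = P A * P B)%E.
Proof.
move=> FA GB.
apply: (indep_grouping P _ (fun j : 'I_T => sigRow M Dk Zk j.+1) i0
  [set j : 'I_T | j != i0]) => //.
- by move=> j; apply: sigRow_measurable; rewrite /= ltn_ord.
- by move=> j; exact: sigma_gen_setT.
- by move=> j; exact: sigma_gen_setI.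
- exact: (sm_rows SM).
- by rewrite /= eqxx.
- by rewrite i0E.
Qed.

Lemma Go_measurable : Go `<=` measurable.
Proof.
apply: sigma_gen_measurable => A [j _]; apply: sigRow_measurable.
by rewrite /= ltn_ord.
Qed.

(* Events of a row that only depend on the claims reported up to [k]. *)
Let prefix_det (A : set (vec R)) :=
  forall s s' : vec R, (forall t, (t <= k)%N -> s t = s' t) -> A s = A s'.

(** Rectangles made of an event of row i up to year k and an event of the other rows. They form a
    pi-system on which the other rows factor out, and they generate a sigma-algebra containing that
    of the triangle. *)
Let Pi : set_system Om := [set B | exists (A : set (vec R)) (B' : set Om),
  [/\ measurable A, prefix_det A, Go B' & B = S i @^-1` A `&` B']].

Let Pi_setI : setI_closed Pi.
Proof.
move=> _ _ [A1 [B1 [mA1 kA1 GB1 ->]]] [A2 [B2 [mA2 kA2 GB2 ->]]].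
exists (A1 `&` A2), (B1 `&` B2); split.
- exact: measurableI.
- by move=> s s' ss; rewrite /setI /mkset (kA1 s s' ss) (kA2 s s' ss).
- exact: sigma_gen_setI.
- by rewrite preimage_setI setIACA.
Qed.

Let mS : measurable_fun setT (S i).
Proof.
apply: measurable_csum => [n|n].
  exact: (measurable_claimk P T lam M Dk Zk D Z SM i i1T n).
exact: (measurable_count P T lam M Dk Zk D Z SM i i1T a a0 [set n]).
Qed.

Let Pi_measurable B : Pi B -> measurable B.
Proof.
move=> [A [B' [mA _ GB' ->]]]; apply: measurableI; last exact: Go_measurable.
by rewrite -[X in measurable X]setTI; exact: mS.
Qed.

Let S_Cl j w t : S j w t = Cl M Dk Zk a j t w := csum_Cl M Dk Zk j a w t.

(** The condition j + t <= T + 1 becomes t <= k when j = i, so the triangle sees row i exactly up to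
    year k; every other generator belongs to [Go]. *)
Lemma Dsig_sub_Pi : Dsig T M Dk Zk a `<=` <<s Pi >>.
Proof.
apply: sigma_genS => _ [[j t] [/= [j1T t1T jt] [B mB ->]]]; apply: sub_sigma_gen.
have E : Cl M Dk Zk a j t = fun w => S j w t by apply/funext => w; rewrite S_Cl.
rewrite E; have mB' : measurable [set s : vec R | B (s t)].
  by have := measurable_vcoord t measurableT B mB; rewrite setTI.
have [ji|ji] := eqVneq j i.
  exists [set s : vec R | B (s t)], setT; split => //.
  - move=> s s' ss; rewrite /= /mkset ss//.
    by move: jt iT; rewrite ji /k => h1 /andP[_ h2]; lia.
  - exact: sigma_gen_setT.
  - by rewrite setIT ji.
exists setT, (S j @^-1` [set s : vec R | B (s t)]); split => //.
- have jlt : (j.-1 < T)%N by case: (j) j1T.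
  have jE : (Ordinal jlt).+1 = j by rewrite /=; case: (j) j1T.
  apply: sub_sigma_gen; exists (Ordinal jlt).
    apply/eqP => /(congr1 (fun o : 'I_T => (o : nat).+1)); rewrite jE i0E.
    exact/eqP.
  by rewrite jE; exact: csum_row_preimage.
- by rewrite preimage_setT setTI.
Qed.

Lemma integral_others (h : vec R -> R) B : measurable_fun setT h ->
  L1 P (fun w => h (S i w)) -> Go B ->
  (\int[P]_(w in B) (h (S i w))%:E = (Ex P (fun w => h (S i w)) * fine (P B))%:E)%E.
Proof.
move=> mh ih GB; have mB := Go_measurable _ GB.
rewrite integral_indicM//.
have m1 : measurable_fun setT (\1_B : Om -> R) by exact: measurable_indic.
have ind A C0 : measurable A -> measurable C0 ->
    (P (S i @^-1` A `&` (\1_B : Om -> R) @^-1` C0) =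
     P (S i @^-1` A) * P ((\1_B : Om -> R) @^-1` C0))%E.
  move=> mA mC; apply: row_indep_others; first exact: csum_row_preimage.
  rewrite preimage_indic; case: ifPn => _; case: ifPn => _.
  - exact: sigma_gen_setT.
  - exact: GB.
  - exact: (sigma_algebraC GB).
  - exact: sigma_algebra0.
have [h1 h2] := Ex_indep_pair P (S i) (\1_B : Om -> R) mS m1 ind h id mh
  (@measurable_id _ _ setT) ih (L1_indic P mB).
transitivity (\int[P]_w (h (S i w) * \1_B w)%:E)%E.
  by apply: eq_integral => w _; rewrite mulrC.
by rewrite ExE// h2 Ex_indic.
Qed.

Let g := \prod_(k <= s < T) fdev P D Z s.
Let C w := Cl M Dk Zk a i k w.
Let EZ := Ex P Z.
Let EZ2 := Ex P (fun w => Z w ^+ 2).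
Let p_gt := Pr P [set w | (k < D w)%N].
Let p_le := Pr P [set w | (D w <= k)%N].
Let X w := (Cl M Dk Zk a i T w - C w * g) ^+ 2 / C w.
Hypothesis agt0 : 0 < a.
Hypothesis gE : g = p_le^-1.
Hypothesis ple0 : 0 < p_le.
Hypothesis psum : p_le + p_gt = 1.
Let V w := a / C w * (Ex P (fun w => (M i a w)%:R) / a * EZ2 * p_gt
                 + (C w - Ex P C) ^+ 2 / a * (g - 1) ^+ 2).

(* [X] need not be integrable, as [C] may be close to 0: the localizing sets of the conditional
   expectation are [C @^-1` win n], on which 1/C is the bounded function [rho n]; the point 0
   belongs to [win n] because there 1/0 = 0 makes both sides vanish. *)
Let rho (n : nat) (r : R) := if (n.+1%:R^-1 <= `|r| <= n.+1%:R) then r^-1 else 0.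
Let win (n : nat) : set R := [set r | r = 0 \/ n.+1%:R^-1 <= `|r| <= n.+1%:R].

Let mrho n : measurable_fun setT (rho n).
Proof.
apply: measurable_fun_ifT => //.
  by apply: measurable_and; apply: measurable_fun_ler.
exact: (measurableT_comp (measurable_invr R)).
Qed.

(** Expanding the squares in [XA] and [VA] produces powers of C up to 2 against the truncated
    inverse. The products are 1/r, 1 and r, all at most n + 1 in absolute value on the window. *)
Let rho_bound n r j : (j <= 2)%N -> `|r ^+ j * rho n r| <= n.+1%:R.
Proof.
have n1 : 1 <= n.+1%:R :> R by rewrite ler1n.
rewrite /rho; case: ifPn => [/andP[r1 r2] j2|_ _]; last by rewrite mulr0 normr0.
have r0 : 0 < `|r| by rewrite (lt_le_trans _ r1)// invr_gt0.
have rn0 : r != 0 by rewrite -normr_gt0.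
case: j j2 => [_|[_|[_|//]]].
- by rewrite expr0 mul1r normfV -[leRHS]invrK lef_pV2// posrE// invr_gt0.
- by rewrite expr1 mulfV// normr1.
- by rewrite expr2 mulfK.
Qed.

Let XA n (s : vec R) := (s T - s k * g) ^+ 2 * rho n (s k).
Let VA n (s : vec R) :=
  (EZ2 * p_gt * (lam i * a) + (s k - Ex P C) ^+ 2 * (g - 1) ^+ 2) * rho n (s k).

(** With U the part of the row reported after k, C_T - g C = U - (g - 1) C. Expanding the square,
    [run_off_moments] replaces U and U^2 by their means. The result is a variance plus (g - 1)^2 (C
    - E[C])^2 because g = 1 / P(D <= k) makes E[U] equal to (g - 1) E[C]. *)
Lemma XA_VA n (A : set (vec R)) : measurable A -> prefix_det A ->
  [/\ L1 P (fun w => \1_A (S i w) * XA n (S i w)),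
      L1 P (fun w => \1_A (S i w) * VA n (S i w)) &
      Ex P (fun w => \1_A (S i w) * XA n (S i w)) = Ex P (fun w => \1_A (S i w) * VA n (S i w))].
Proof.
move=> mA kA.
have ck := measurable_vcoord (R := R) k.
pose v j (s : vec R) := \1_A s * (s k ^+ j * rho n (s k)).
have mv j : measurable_fun setT (v j).
  apply: measurable_funM; first exact: measurable_indic.
  by apply: measurable_funM; [exact: measurable_funX|exact: (measurableT_comp (mrho n))].
have vk j s s' : (forall t, (t <= k)%N -> s t = s' t) -> v j s = v j s'.
  by move=> ss; rewrite /v !indicE /in_mem /= /in_set /= (kA s s' ss) ss.
have iv j : (j <= 2)%N -> L1 P (fun w => v j (S i w)).
  move=> j2; apply: (@L1_bounded _ _ _ P _ n.+1%:R).
    exact: (measurableT_comp (mv j)).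
  move=> w; rewrite /v indicE; case: (_ \in A); rewrite ?mul1r ?mul0r ?normr0//.
  exact: rho_bound.
have kT : (k <= T)%N by rewrite /k; case/andP: iT => h1 h2; lia.
have mom j (j2 : (j <= 2)%N) :=
  run_off_moments P T lam M Dk Zk D Z SM i i1T a a0 k kT (v j) (mv j) (vk j) (iv j j2).
have [_ _ i20 e20] := mom 0 isT.
have [i11 e11 _ _] := mom 1 isT.
have i02 := iv 2 isT.
have EC : Ex P C = lam i * a * (EZ * p_le).
  have [_ <- _ _] := Ex_Cl_moments P T lam M Dk Zk D Z SM i i1T a a0 k.
  by apply: eq_Ex => w; exact/esym/S_Cl.
have XE w : \1_A (S i w) * XA n (S i w) =
   (S i w T - S i w k) ^+ 2 * v 0 (S i w) +
   (- (2 * (g - 1))) * ((S i w T - S i w k) * v 1 (S i w)) +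
   (g - 1) ^+ 2 * v 2 (S i w).
  by rewrite /v /XA expr0 expr1; ring.
have VE w : \1_A (S i w) * VA n (S i w) =
   (EZ2 * p_gt * (lam i * a) + (Ex P C) ^+ 2 * (g - 1) ^+ 2) * v 0 (S i w) +
   (- (2 * (g - 1) ^+ 2 * Ex P C)) * v 1 (S i w) +
   (g - 1) ^+ 2 * v 2 (S i w).
  by rewrite /v /VA expr0 expr1; ring.
have i0' := iv 0 isT; have i1' := iv 1 isT.
split.
- rewrite (funext XE); apply: L1D; last exact: L1Z.
  by apply: L1D => //; exact: L1Z.
- rewrite (funext VE); apply: L1D; last exact: L1Z.
  by apply: L1D; exact: L1Z.
- rewrite (eq_Ex P XE) (eq_Ex P VE) !ExD//; try exact: L1Z; try (apply: L1D => //; exact: L1Z).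
  have e20' : Ex P (fun w => (S i w T - S i w k) ^+ 2 * v 0 (S i w)) =
     (lam i * a * (EZ2 * p_gt) + (lam i * a * (EZ * p_gt)) ^+ 2) *
     Ex P (fun w => v 0 (S i w)) by exact: e20.
  have e11' : Ex P (fun w => (S i w T - S i w k) * v 1 (S i w)) =
     lam i * a * (EZ * p_gt) * Ex P (fun w => v 1 (S i w)) by exact: e11.
  rewrite !ExZ// e20' e11' EC gE.
  have -> : p_gt = 1 - p_le by rewrite -psum; ring.
  have pn0 : p_le != 0 by rewrite gt_eqF.
  by field.
Qed.

Lemma cond_exp_V : is_cond_exp P (Dsig T M Dk Zk a) X V.
Proof.
have XAE n w : win n (C w) -> X w = XA n (S i w).
  move=> Cw; rewrite /X /XA !S_Cl -/(C w); congr (_ * _).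
  rewrite /rho; case: ifPn => // /negP h; case: Cw => [->|//].
  by rewrite invr0.
have VAE n w : win n (C w) -> V w = VA n (S i w).
  move=> Cw; rewrite /V /VA !S_Cl -/(C w).
  rewrite (Ex_count P T lam M Dk Zk D Z SM i i1T a a0).
  have -> : rho n (C w) = (C w)^-1.
    rewrite /rho; case: ifPn => // /negP h; case: Cw => [->|//].
    by rewrite invr0.
  have an0 : a != 0 by rewrite gt_eqF.
  by move: (C w)^-1 => c; field.
have kin : [set jt : nat * nat | [/\ (1 <= jt.1 <= T)%N, (1 <= jt.2 <= T)%N &
     (jt.1 + jt.2 <= T.+1)%N]] (i, k).
  by split => //=; rewrite /k; case/andP: iT => h1 h2; lia.
have mwin n : measurable (win n).
  have mb : measurable_fun setT (fun r : R => n.+1%:R^-1 <= `|r| <= n.+1%:R).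
    by apply: measurable_and; apply: measurable_fun_ler.
  have := mb measurableT [set true] I; rewrite setTI => mb'.
  rewrite (_ : win n = [set 0] `|` (fun r : R => n.+1%:R^-1 <= `|r| <= n.+1%:R) @^-1` [set true]).
    exact: measurableU.
  by apply/seteqP; split => r /=.
have GC B : measurable B -> Dsig T M Dk Zk a (C @^-1` B).
  by move=> mB; apply: sub_sigma_gen; exists (i, k); split => //; exists B.
have Dm : Dsig T M Dk Zk a `<=` measurable.
  apply: subset_trans Dsig_sub_Pi _; apply: sigma_gen_measurable.
  exact: Pi_measurable.
have [iX iV _] : [/\ forall n, L1 P (fun w => XA n (S i w)),
    forall n, L1 P (fun w => VA n (S i w)) & True].
  have h n := XA_VA n setT measurableT (fun _ _ _ => erefl).
  have e (f : vec R -> R) : (fun w => \1_setT (S i w) * f (S i w)) = (fun w => f (S i w)).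
    by apply/funext => w; rewrite indicT mul1r.
  split => // n; have [] := h n; rewrite !e//.
have mXA n : measurable_fun setT (XA n).
  apply: measurable_funM; last exact: (measurableT_comp (mrho n) (measurable_vcoord k)).
  apply: measurable_funX; apply: measurable_funB; first exact: measurable_vcoord.
  by apply: measurable_funM => //; exact: measurable_vcoord.
have mVA n : measurable_fun setT (VA n).
  apply: measurable_funM; last exact: (measurableT_comp (mrho n) (measurable_vcoord k)).
  apply: measurable_funD => //; apply: measurable_funM => //.
  by apply: measurable_funX; apply: measurable_funB => //; exact: measurable_vcoord.
split.
  move=> B mB.
  pose hV (r : R) := a / r * (Ex P (fun w => (M i a w)%:R) / a * EZ2 * p_gt
                 + (r - Ex P C) ^+ 2 / a * (g - 1) ^+ 2).
  have mhV : measurable_fun setT hV.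
    apply: measurable_funM.
      by apply: measurable_funM => //; exact: (measurableT_comp (measurable_invr R)).
    apply: measurable_funD => //; apply: measurable_funM => //.
    apply: measurable_funM => //; apply: measurable_funX.
    exact: measurable_funB.
  apply: (GC (hV @^-1` B)).
  by have := mhV measurableT B mB; rewrite setTI.
exists (fun n => C @^-1` (win n)); split.
- by move=> n; exact: GC.
- move=> n w /= [->|/andP[h1 h2]]; [by left|right; apply/andP; split].
    by rewrite (le_trans _ h1)// lef_pV2 ?posrE ?ltr0n// ler_nat.
  by rewrite (le_trans h2)// ler_nat.
- apply/seteqP; split => // w _.
  have [C0|C0] := eqVneq (C w) 0; first by exists 0%N => //; left.
  have c0 : 0 < `|C w| by rewrite normr_gt0.
  have ci : 0 < `|C w|^-1 by rewrite invr_gt0.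
  (* An integer above both |C w| and its inverse, so that both bounds of the window hold. *)
  pose n := Num.bound (`|C w| + `|C w|^-1).
  have hn : `|C w| + `|C w|^-1 < n.+1%:R.
    have h : 0 <= `|C w| + `|C w|^-1 by rewrite addr_ge0// ltW.
    by rewrite (lt_le_trans (archi_boundP h))// ler_nat.
  exists n => //; right; apply/andP; split; last by lra.
  rewrite -[leRHS]invrK lef_pV2 ?posrE//; by lra.
- move=> n.
  have mA : measurable (C @^-1` win n) by apply: Dm; exact: GC.
  split.
  + apply: (eq_integrable mA (EFin \o (fun w => XA n (S i w)))).
      by move=> w; rewrite inE /= => Cw; rewrite -XAE.
    exact: (integrableS measurableT mA (subsetT _) (iX n)).
  + apply: (eq_integrable mA (EFin \o (fun w => VA n (S i w)))).
      by move=> w; rewrite inE /= => Cw; rewrite -VAE.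
    exact: (integrableS measurableT mA (subsetT _) (iV n)).
  + move=> B GB.
    transitivity (\int[P]_(w in B `&` C @^-1` win n) (XA n (S i w))%:E)%E.
      by apply: eq_integral => w; rewrite inE /= => -[_ Cw]; rewrite -XAE.
    transitivity (\int[P]_(w in B `&` C @^-1` win n) (VA n (S i w))%:E)%E; last first.
      by apply: eq_integral => w; rewrite inE /= => -[_ Cw]; rewrite -VAE.
    (* The window is itself an event of the triangle, so the localized set remains in the
       sigma-algebra generated by [Pi], while [XA] and [VA] are integrable on the whole space. *)
    apply: (integral_pi_lambda P _ _ Pi (iX n) (iV n) Pi_setI Pi_measurable).
    * exists setT, setT; split => //; first exact: sigma_gen_setT.
      by rewrite preimage_setT setIT.
    * move=> _ [A [B' [mA' kA' GB' ->]]].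
      have mB' := Go_measurable _ GB'.
      have [j1 j2 j3] := XA_VA n A mA' kA'.
      have mSA : measurable (S i @^-1` A).
        by rewrite -[X in measurable X]setTI; exact: mS.
      have e (f : vec R -> R) : measurable_fun setT f ->
          (\int[P]_(w in S i @^-1` A `&` B') (f (S i w))%:E =
           \int[P]_(w in B') (\1_A (S i w) * f (S i w))%:E)%E.
        move=> mf; rewrite integral_indicM; last exact: measurableI.
        rewrite [RHS]integral_indicM//; apply: eq_integral => w _.
        by rewrite indicI /= mulrCA mulrA [X in (X * _)%:E]mulrC !indicE.
      rewrite !e// (integral_others (fun s => \1_A s * XA n s))//; last first.
        by apply: measurable_funM => //; exact: measurable_indic.
      rewrite (integral_others (fun s => \1_A s * VA n s)) ?j3//.
      by apply: measurable_funM => //; exact: measurable_indic.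
    * by apply: Dsig_sub_Pi; apply: sigma_gen_setI => //; exact: GC.
Unshelve. all: exact: 0%N.
Qed.

End conditional_expectation.

(** * From Laplace transforms to weak convergence *)

Section stein_function.
Context {R : realType}.
Implicit Types (s x y : R).

Definition gk s x : R := expR (- (s * x ^+ 2)).
(** Chosen so that Stein's identity closes up: both x times [sk s x], which is x^2 exp(- s x^2), and
    its derivative (1 - 2 s x^2) exp(- s x^2) are expressed by exp(- s x^2) and its derivative in s.
    For x = H their expectations are therefore combinations of the Laplace transform of H^2 and its
    derivative. *)
Definition sk s x : R := x * gk s x.
Definition dsk s x : R := (1 - 2 * s * x ^+ 2) * gk s x.
Definition ddsk s x : R := (- 6 * s * x + 4 * s ^+ 2 * x ^+ 3) * gk s x.

Lemma is_derive_gk s x : is_derive x 1 (gk s) (- (2 * s * x) * gk s x).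
Proof.
have h : is_derive x (1 : R) (fun x : R => - (s * x ^+ 2)) (- (s * (2 * x))).
  apply: is_derive_eq.
  by rewrite /GRing.scale /=; ring.
apply: (is_derive_eq (is_derive1_comp (is_derive_expR _) h)).
by rewrite /GRing.scale /= /gk; ring.
Qed.

Lemma is_derive_sk s x : is_derive x 1 (sk s) (dsk s x).
Proof.
have h := is_derive_gk s x.
have := is_deriveM (is_derive_id x 1) h.
move=> /is_derive_eq; apply.
by rewrite /GRing.scale /= /dsk; ring.
Qed.

Lemma is_derive_dsk s x : is_derive x 1 (dsk s) (ddsk s x).
Proof.
have h := is_derive_gk s x.
have h1 : is_derive x (1 : R) (fun x : R => 1 - 2 * s * x ^+ 2) (- (4 * s * x)).
  apply: is_derive_eq.
  by rewrite /GRing.scale /=; ring.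
have := is_deriveM h1 h.
move=> /is_derive_eq; apply.
by rewrite /GRing.scale /= /ddsk; ring.
Qed.

Lemma MVT_line (f df : R -> R) x y : (forall z : R, is_derive z (1 : R) f (df z)) ->
  exists z, `|z - x| <= `|y - x| /\ f y - f x = df z * (y - x).
Proof.
move=> fd.
have cf : continuous f.
  by move=> z; apply: differentiable_continuous; apply/derivable1_diffP; case: (fd z).
have [xy|yx|<-] := ltgtP x y; last by exists x; rewrite !subrr mulr0.
- have [z + ->] := MVT xy (fun z _ => fd z) (continuous_subspaceT cf).
  rewrite in_itv /= => /andP[xz zy]; exists z; split=> //.
  by rewrite !ger0_norm; lra.
- have [z + e] := MVT yx (fun z _ => fd z) (continuous_subspaceT cf).
  rewrite in_itv /= => /andP[xz zy]; exists z; split; last by lra.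
  by rewrite !ler0_norm; lra.
Qed.

Lemma gk_gt0 s x : 0 < gk s x. Proof. exact: expR_gt0. Qed.

Lemma gk_le1 s x : 0 <= s -> gk s x <= 1.
Proof. by move=> s0; rewrite /gk -[leRHS]expR0 ler_expR oppr_le0 mulr_ge0 ?sqr_ge0. Qed.

Lemma mul_gk_le1 s x : 0 <= s -> s * x ^+ 2 * gk s x <= 1.
Proof.
move=> s0; set v := s * x ^+ 2.
have v0 : 0 <= v by rewrite mulr_ge0 ?sqr_ge0.
rewrite /gk -/v expRN ler_pdivrMr ?expR_gt0// mul1r.
by have := expR_ge1Dx v; lra.
Qed.

(** With v = s x^2, squaring 1 + v/2 <= exp(v/2) gives v^2 / 4 <= exp v. *)
Lemma sqr_mul_gk_le4 s x : 0 <= s -> (s * x ^+ 2) ^+ 2 * gk s x <= 4.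
Proof.
move=> s0; set v := s * x ^+ 2.
have v0 : 0 <= v by rewrite mulr_ge0 ?sqr_ge0.
rewrite /gk -/v expRN ler_pdivrMr ?expR_gt0//.
have := expR_ge1Dx (v / 2).
rewrite [in X in _ -> X](_ : expR v = expR (v / 2) * expR (v / 2)); last first.
  by rewrite -expRD; congr expR; field.
set e := expR (v / 2) => h.
have : (1 + v / 2) * (1 + v / 2) <= e * e by apply: ler_pM; lra.
nra.
Qed.

Lemma dsk_bound s x : 0 <= s -> `|dsk s x| <= 2.
Proof.
move=> s0; have -> : dsk s x = gk s x - 2 * (s * x ^+ 2 * gk s x).
  by rewrite /dsk; ring.
have h1 := mul_gk_le1 _ x s0; have h2 := gk_le1 _ x s0; have h3 := gk_gt0 s x.
have h4 : 0 <= s * x ^+ 2 * gk s x by rewrite mulr_ge0 ?(ltW h3)// mulr_ge0 ?sqr_ge0.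
by rewrite ler_norml; apply/andP; split; lra.
Qed.

(** The estimate |x| <= (1 + x^2) / 2 removes the odd powers. With v = s x^2 and g = exp(- v), what
    remains is 3 s g + 3 v g + 2 s v g + 2 v^2 g, and the bounds 1, 1, 4 for g, v g, v^2 g give 3 s
    + 3 + 2 s + 8. *)
Lemma ddsk_bound s x : 0 <= s -> `|ddsk s x| <= 5 * s + 11.
Proof.
move=> s0; rewrite /ddsk normrM (ger0_norm (ltW (gk_gt0 _ _))).
have h1 := mul_gk_le1 _ x s0; have h2 := gk_le1 _ x s0; have h0 := gk_gt0 s x.
have h3 := sqr_mul_gk_le4 _ x s0.
have x1 : `|x| <= (1 + x ^+ 2) / 2.
  by rewrite -(real_normK (num_real x)); have := sqr_ge0 (`|x| - 1); nra.
have : `|- 6 * s * x + 4 * s ^+ 2 * x ^+ 3| <= 3 * (s + s * x ^+ 2) +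
    2 * (s * (s * x ^+ 2) + (s * x ^+ 2) ^+ 2).
  rewrite (le_trans (ler_normD _ _))// lerD//.
    have -> : `|-6 * s * x| = 6 * s * `|x|.
      by rewrite !normrM normrN (ger0_norm s0) normr_nat.
    by have := ler_wpM2l s0 x1; lra.
  have -> : 4 * s ^+ 2 * x ^+ 3 = 4 * s * (s * x ^+ 2) * x by ring.
  have v0 : 0 <= 4 * s * (s * x ^+ 2).
    by apply: mulr_ge0; [exact: mulr_ge0|apply: mulr_ge0 => //; exact: sqr_ge0].
  rewrite normrM (ger0_norm v0).
  apply: (le_trans (ler_wpM2l v0 x1)).
  by rewrite le_eqVlt; apply/orP; left; apply/eqP; field.
move=> h; apply: (le_trans (ler_wpM2r (ltW h0) h)).
set g := gk s x in h0 h1 h2 h3 *; set v := s * x ^+ 2 in h1 h3 *.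
have -> : (3 * (s + v) + 2 * (s * v + v ^+ 2)) * g =
  3 * s * g + 3 * (v * g) + 2 * s * (v * g) + 2 * (v ^+ 2 * g) by ring.
have : s * g <= s by rewrite ler_piMr.
have : s * (v * g) <= s by rewrite ler_piMr.
lra.
Qed.

(** The remainder is y times a difference of two values of [dsk], bounded either by twice the bound
    2 or through the second derivative. Keeping the minimum leaves an error that a second moment of
    y controls, even after multiplication by a further factor y. *)
Lemma sk_taylor s x y : 0 <= s ->
  `|sk s (x + y) - sk s x - y * dsk s x| <= `|y| * Num.min 4 ((5 * s + 11) * `|y|).
Proof.
move=> s0.
have [z [zx]] := MVT_line _ _ x (x + y) (is_derive_sk s).
rewrite (_ : x + y - x = y) in zx *; last by ring.
move=> ->; rewrite mulrC -mulrBr normrM ler_wpM2l// le_min; apply/andP; split.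
  rewrite (le_trans (ler_normB _ _))//.
  by have := dsk_bound _ z s0; have := dsk_bound _ x s0; lra.
have [t [_ ->]] := MVT_line _ _ x z (is_derive_dsk s).
rewrite normrM; apply: ler_pM => //; exact: ddsk_bound.
Qed.

Lemma sk_bound s x : 0 < s -> `|sk s x| <= 1 + s^-1.
Proof.
move=> s0; rewrite /sk normrM (ger0_norm (ltW (gk_gt0 _ _))).
have h1 := mul_gk_le1 _ x (ltW s0); have h2 := gk_le1 _ x (ltW s0); have h0 := gk_gt0 s x.
have x1 : `|x| <= (1 + x ^+ 2) / 2.
  by rewrite -(real_normK (num_real x)); have := sqr_ge0 (`|x| - 1); nra.
have h3 : x ^+ 2 * gk s x <= s^-1.
  by rewrite -[leRHS]mulr1 ler_pdivlMl// mulrA.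
have h4 : 0 <= x ^+ 2 * gk s x by rewrite mulr_ge0 ?sqr_ge0 ?ltW.
have := ler_wpM2r (ltW h0) x1; lra.
Qed.

End stein_function.

(** * Bernstein polynomials and uniform continuity on segments *)

Section bernstein.
Context {R : realType}.
Implicit Types (u c e : R) (a b : nat -> R).

(* The expectation of [a] at a binomial variable with parameters n and u, i.e. the Bernstein
   polynomial of [a], by conditioning on the first trial. *)
Fixpoint bern u n a : R :=
  if n is n'.+1 then (1 - u) * bern u n' a + u * bern u n' (fun j => a j.+1) else a 0.

Fixpoint bernp n a : {poly R} :=
  if n is n'.+1 then (1 - 'X) * bernp n' a + 'X * bernp n' (fun j => a j.+1) else (a 0)%:P.

Lemma bernp_eval n a u : (bernp n a).[u] = bern u n a.
Proof.
elim: n a => [|n IH] a /=; first by rewrite hornerC.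
by rewrite !hornerE !IH.
Qed.

Lemma bern_le u n a b : 0 <= u <= 1 -> (forall j, (j <= n)%N -> a j <= b j) ->
  bern u n a <= bern u n b.
Proof.
move=> /andP[u0 u1]; elim: n a b => [|n IH] a b ab /=; first exact: ab.
rewrite lerD// ler_wpM2l ?subr_ge0//; apply: IH => j jn; apply: ab => //.
exact: leqW.
Qed.

Lemma bern_cst u n c : bern u n (fun=> c) = c.
Proof. by elim: n => [//|n /= ->]; ring. Qed.

Lemma bernD u n a b : bern u n (fun j => a j + b j) = bern u n a + bern u n b.
Proof. by elim: n a b => [//|n IH] a b /=; rewrite !IH; ring. Qed.

Lemma bernZ u n c a : bern u n (fun j => c * a j) = c * bern u n a.
Proof. by elim: n a => [//|n IH] a /=; rewrite !IH; ring. Qed.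

(** Variance plus squared bias of a binomial variable; in the induction, a success in the first
    trial moves the centre from c to c - 1. *)
Lemma bern_sqr u n c :
  bern u n (fun j => (j%:R - c) ^+ 2) = n%:R * u * (1 - u) + (n%:R * u - c) ^+ 2.
Proof.
elim: n c => [|n IH] c /=; first by ring.
have E : (fun j => (j.+1%:R - c) ^+ 2) = (fun j => (j%:R - (c - 1)) ^+ 2) :> (nat -> R).
  by apply/funext => j; rewrite -natr1; ring.
by rewrite E !IH -natr1; ring.
Qed.

Lemma bern_norm u n a (B : R) : 0 <= u <= 1 -> (forall j, `|a j| <= B) -> `|bern u n a| <= B.
Proof.
move=> u01 aB; rewrite ler_norml -[X in X <= _ <= _](bern_cst u n).
rewrite -[X in _ <= _ <= X](bern_cst u n).
by apply/andP; split; apply: bern_le => // j _; have := aB j; rewrite ler_norml => /andP[].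
Qed.

(* Chebyshev's inequality for the binomial law with parameters n and u. *)
Lemma bern_approx (q : R -> R) u n (B e del : R) : 0 <= u <= 1 ->
  0 < del -> (forall v, `|q v| <= B) ->
  (forall v, 0 <= v <= 1 -> `|v - u| < del -> `|q v - q u| <= e) -> 0 <= e ->
  `|bern u n.+1 (fun j => q (j%:R / n.+1%:R)) - q u| <= e + 2 * B / (n.+1%:R * del ^+ 2).
Proof.
move=> /[dup] u01 /andP[u0 u1] d0 qB qe e0.
set N : R := n.+1%:R; have N0 : 0 < N by rewrite ltr0n.
have B0 : 0 <= B := le_trans (normr_ge0 _) (qB 0).
(* With this weight, K (j - N u)^2 is at least 2 B as soon as j / N is at distance del or more from
   u. *)
pose K := 2 * B / (N ^+ 2 * del ^+ 2).
have K0 : 0 <= K.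
  by apply: divr_ge0; [exact: mulr_ge0|apply: mulr_ge0; exact: sqr_ge0].
have key j : (j <= n.+1)%N -> `|q (j%:R / N) - q u| <= e + K * (j%:R - N * u) ^+ 2.
  move=> jn.
  have [close|far] := ltP `|j%:R / N - u| del.
    apply: (le_trans (qe _ _ close)); last by rewrite lerDl mulr_ge0 ?sqr_ge0.
    apply/andP; split; first by apply: divr_ge0; rewrite ?ler0n ?ltW.
    by rewrite ler_pdivrMr// mul1r ler_nat.
  apply: (le_trans (ler_normB _ _)).
  have h : 2 * B <= K * (j%:R - N * u) ^+ 2.
    have -> : j%:R - N * u = N * (j%:R / N - u) by field; rewrite gt_eqF.
    rewrite /K exprMn.
    have -> : 2 * B / (N ^+ 2 * del ^+ 2) * (N ^+ 2 * (j%:R / N - u) ^+ 2) =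
       2 * B * ((j%:R / N - u) ^+ 2 / del ^+ 2) by field; rewrite !gt_eqF.
    rewrite ler_peMr ?mulr_ge0// ler_pdivlMr ?exprn_gt0// mul1r.
    by rewrite -(real_normK (num_real (_ - u))) lerXn2r// ?nnegrE// ltW.
  by have := qB (j%:R / N); have := qB u; lra.
have up : bern u n.+1 (fun j => e + K * (j%:R - N * u) ^+ 2) <= e + 2 * B / (N * del ^+ 2).
  rewrite (bernD u n.+1 (fun=> e)) bern_cst bernZ bern_sqr subrr expr0n addr0 lerD2l.
  have -> : K * (N * u * (1 - u)) = 2 * B / (N * del ^+ 2) * (u * (1 - u)).
    by rewrite /K; field; rewrite !gt_eqF.
  rewrite ler_piMr ?divr_ge0 ?mulr_ge0 ?sqr_ge0 ?(ltW N0)//; nra.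
rewrite ler_norml; apply/andP; split.
- rewrite lerBrDl.
  apply: le_trans (_ : bern u n.+1 (fun j => q u - (e + K * (j%:R - N * u) ^+ 2)) <= _).
    rewrite (_ : (fun j => _) = (fun j => q u + (-1) * (e + K * (j%:R - N * u) ^+ 2))); last first.
      by apply/funext => j; ring.
    rewrite (bernD u n.+1 (fun=> q u)) bern_cst bernZ.
    by move: up; set X := _ / _; set b := bern _ _ _; move: X b => X b; lra.
  apply: bern_le => // j /key; rewrite ler_norml => /andP[]; lra.
- rewrite lerBlDl.
  apply: le_trans (_ : bern u n.+1 (fun j => q u + (e + K * (j%:R - N * u) ^+ 2)) <= _).
    apply: bern_le => // j /key; rewrite ler_norml => /andP[]; lra.
  by rewrite (bernD u n.+1 (fun=> q u)) bern_cst lerD2l.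
Qed.

(** By contradiction: bad pairs at distance below 1 / (n + 1) have a subsequence whose first members
    converge, hence whose second members have the same limit, against continuity there. The second
    point may leave the segment, as happens in [poly_exp_approx]. *)
Lemma unif_cont_segment (f : R -> R) (B e : R) : continuous f -> 0 < e ->
  exists2 eta : R, 0 < eta & forall x y, 0 <= x <= B -> `|x - y| < eta -> `|f x - f y| <= e.
Proof.
move=> cf e0; apply: contrapT => noeta.
have ch n : exists xy : R * R, [/\ 0 <= xy.1 <= B, `|xy.1 - xy.2| < n.+1%:R^-1 &
    e < `|f xy.1 - f xy.2|].
  apply: contrapT => no; apply: noeta; exists n.+1%:R^-1; first by rewrite invr_gt0.
  move=> x y xB xy; rewrite leNgt; apply/negP => h.
  by apply: no; exists (x, y).
have [xy xyP] := choice ch.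
have bx : bounded_fun (fun n => (xy n).1).
  exists B; split; first exact: num_real.
  move=> r Br n _ /=; have [/andP[x0 xB] _ _] := xyP n.
  by rewrite ger0_norm// (le_trans xB)// ltW.
have [h hinc /cvg_ex[/= l hl]] := bolzano_weierstrass bx.
have fl := cf l; move/cvgrPdist_lt : (fl) => /(_ (e / 2)).
rewrite divr_gt0// => /(_ isT) [/= r r0 rf].
move/cvgrPdist_lt : hl => /(_ (r / 2)); rewrite divr_gt0// => /(_ isT) hl.
have [N _ hN] := hl.
have hmono n : (n <= h n)%N by elim: n => // n IH; rewrite (leq_ltn_trans IH)// ltnNge;
    have := hinc n.+1 n; rewrite !leEnat ltnn => ->.
pose m := maxn N (Num.bound (2 / r)).
have := hN m (leq_maxl _ _); rewrite /= => d1.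
have [_ d2 d3] := xyP (h m).
have d4 : (h m).+1%:R^-1 < r / 2.
  rewrite -[ltRHS]invrK ltf_pV2 ?posrE ?invr_gt0 ?divr_gt0//.
  rewrite invf_div; apply: lt_le_trans (archi_boundP _) _; first by rewrite divr_ge0// ltW.
  by rewrite ler_nat (leq_trans (leq_maxr N _))// (leq_trans (hmono m)).
have a1 : `|l - (xy (h m)).1| < r by lra.
have a2 : `|l - (xy (h m)).2| < r.
  by have := ler_distD (xy (h m)).1 l (xy (h m)).2; move: d2 d4; set X := _^-1; lra.
have b1 := rf _ a1; have b2 := rf _ a2; rewrite /= in b1 b2.
have := ler_distD (f l) (f (xy (h m)).1) (f (xy (h m)).2).
by rewrite [X in _ <= X + _]distrC; lra.
Qed.

End bernstein.

Section laplace_to_weak.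
Context {R : realType} {d d' : measure_display} {Om : measurableType d} {Om' : measurableType d'}.
Variables (P : probability Om R) (Q : probability Om' R).
Variables (Y : R -> Om -> R) (Y0 : Om' -> R) (kap : R).
Hypothesis kap0 : 0 < kap.
Hypothesis Yge0 : forall a w, 0 < a -> 0 <= Y a w.
Hypothesis Y0ge0 : forall w, 0 <= Y0 w.
Hypothesis L1Y : forall a, 0 < a -> L1 P (Y a).
Hypothesis L1Y0 : L1 Q Y0.
Hypothesis EY : forall a, 0 < a -> Ex P (Y a) <= kap.
Hypothesis EY0 : Ex Q Y0 <= kap.
Hypothesis laplace : forall m : nat,
  Ex P (fun w => expR (- (m%:R * Y a w))) @[a --> +oo] --> Ex Q (fun w => expR (- (m%:R * Y0 w))).

Let L1exp {d1} {O1 : measurableType d1} (P1 : probability O1 R) (y : O1 -> R) m :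
  L1 P1 y -> (forall w, 0 <= y w) -> L1 P1 (fun w => expR (- y w) ^+ m).
Proof.
move=> iy y0; apply: (@L1_bounded _ _ _ P1 _ 1).
  apply: measurable_funX; apply: (measurableT_comp (@measurable_expR R)).
  exact: measurable_funN (L1_meas iy).
move=> w; rewrite ger0_norm ?exprn_ge0 ?expR_ge0//.
by rewrite exprn_ile1 ?expR_ge0// -[leRHS]expR0 ler_expR oppr_le0.
Qed.

Lemma Ex_poly_exp {d1} {O1 : measurableType d1} (P1 : probability O1 R) (y : O1 -> R)
    (p : {poly R}) :
  L1 P1 y -> (forall w, 0 <= y w) ->
  L1 P1 (fun w => p.[expR (- y w)]) /\
  Ex P1 (fun w => p.[expR (- y w)]) =
  \sum_(m < size p) p`_m * Ex P1 (fun w => expR (- (m%:R * y w))).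
Proof.
move=> iy y0.
have E w : p.[expR (- y w)] = \sum_(m < size p) p`_m * expR (- y w) ^+ m by rewrite horner_coef.
rewrite (funext E); elim: (size p) => [|n [IH1 IH2]].
  rewrite big_ord0; under eq_fun do rewrite big_ord0.
  by split; [exact: L1_cst|rewrite Ex_cst].
under eq_fun do rewrite big_ord_recr /=.
have h := L1Z (p`_n) (L1exp P1 y n iy y0).
split; first exact: L1D.
rewrite big_ord_recr /= ExD// IH2 ExZ; last exact: L1exp.
by congr (_ + _ * _); apply: eq_Ex => w; rewrite -mulrN expRM_natl.
Qed.

(** Substituting u = exp(- y), a Bernstein polynomial in u approximates f(- ln u) as long as y <= K.
    For larger y the crude bound 2 B is absorbed by 2 B y / K, a linear term that can be
    integrated. *)
Lemma poly_exp_approx (f : R -> R) (B e K : R) : continuous f ->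
  (forall x, `|f x| <= B) -> 0 < e -> 0 < K ->
  exists p : {poly R}, forall y, 0 <= y -> `|p.[expR (- y)] - f y| <= e + 2 * B * (y / K).
Proof.
move=> cf fB e0 K0.
have B0 : 0 <= B := le_trans (normr_ge0 _) (fB 0).
have e20 : 0 < e / 2 by rewrite divr_gt0.
have [eta eta0 etaP] := unif_cont_segment f K (e / 2) cf e20.
(* f may have no limit at infinity, so q need not extend continuously to 0; the value 0 there only
   preserves the bound B. *)
pose q v := if 0 < v then f (- ln v) else 0.
have qB v : `|q v| <= B by rewrite /q; case: ifP => _; rewrite ?normr0.
(* For y <= K the point u = exp(- y) is at least 2 z. Points within z of u exceed z, where - ln has
   slope at most 1 / z, so a distance below eta z moves - ln by less than eta. *)
pose z := expR (- K) / 2.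
have z0 : 0 < z by rewrite divr_gt0// expR_gt0.
pose del := Num.min z (eta * z).
have d0 : 0 < del by rewrite lt_min z0 mulr_gt0.
pose n := Num.bound (2 * B / (del ^+ 2 * (e / 2))).
have hn : 2 * B / (n.+1%:R * del ^+ 2) <= e / 2.
  have dd : 0 < del ^+ 2 by rewrite exprn_gt0.
  have nn : 0 < n.+1%:R :> R by rewrite ltr0n.
  rewrite ler_pdivrMr; last exact: mulr_gt0.
  have h0 : 0 <= 2 * B / (del ^+ 2 * (e / 2)).
    by apply: divr_ge0; [exact: mulr_ge0|apply: ltW; exact: mulr_gt0].
  have := archi_boundP h0; rewrite -/n ltr_pdivrMr; last exact: mulr_gt0.
  move=> h; apply: (le_trans (ltW h)).
  have : n%:R <= n.+1%:R :> R by rewrite ler_nat.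
  have : 0 < del ^+ 2 * (e / 2) by exact: mulr_gt0.
  set X := del ^+ 2; nra.
exists (bernp n.+1 (fun j => q (j%:R / n.+1%:R))) => y y0.
rewrite bernp_eval.
set u := expR (- y).
have u01 : 0 <= u <= 1 by rewrite expR_ge0/= -[leRHS]expR0 ler_expR oppr_le0.
have qu : q u = f y by rewrite /q expR_gt0 /u expRK opprK.
have [yK|Ky] := leP y K; last first.
  have : `|bern u n.+1 (fun j => q (j%:R / n.+1%:R))| <= B by exact: bern_norm.
  have := ler_normB (bern u n.+1 (fun j => q (j%:R / n.+1%:R))) (f y).
  have := fB y.
  have : 1 <= y / K by rewrite ler_pdivlMr// mul1r ltW.
  move: (y / K) => r r1; have : B <= B * r by rewrite ler_peMr.
  lra.
have y1 : 0 <= 2 * B * (y / K) by rewrite mulr_ge0 ?divr_ge0 ?mulr_ge0// ltW.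
have zu : z * 2 <= u by rewrite /z divfK// ler_expR lerN2.
have h := @bern_approx R q u n B (e / 2) del u01 d0 qB.
rewrite -qu.
have fin : e / 2 + 2 * B / (n.+1%:R * del ^+ 2) <= e + 2 * B * (y / K).
  apply: (le_trans (lerD (lexx (e / 2)) hn)).
  by move: y1; set t := 2 * B * (y / K); lra.
apply: le_trans (h _ (ltW e20)) fin.
move=> v /andP[v0 v1]; rewrite lt_min => /andP[vz vez].
have vz' : z < v by move: vz; rewrite ltr_norml => /andP[]; lra.
have v00 : 0 < v := lt_trans z0 vz'.
rewrite qu /q v00 distrC.
apply: etaP; first by rewrite y0.
have lnr (r t : R) : 0 < r -> 0 < t -> ln r - ln t <= (r - t) / t.
  move=> r0 t0; rewrite -ln_div ?posrE//.
  have -> : r / t = 1 + (r - t) / t by field; rewrite gt_eqF.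
  apply: le_ln1Dx; have : 0 < r / t by exact: divr_gt0.
  have -> : r / t = 1 + (r - t) / t by field; rewrite gt_eqF.
  lra.
have uu : 0 < u by exact: expR_gt0.
have ly : y = - ln u by rewrite /u expRK opprK.
rewrite ly opprK addrC ltr_norml.
have l1 := lnr v u v00 uu; have l2 := lnr u v uu v00.
have m1 : (v - u) / u < eta.
  rewrite ltr_pdivrMr//; have := ler_norm (v - u).
  have : eta * z <= eta * u by rewrite ler_wpM2l ?ltW//; lra.
  lra.
have m2 : (u - v) / v < eta.
  rewrite ltr_pdivrMr//; have := ler_norm (u - v); rewrite distrC.
  have : eta * z <= eta * v by rewrite ler_wpM2l ?ltW//; lra.
  lra.
by apply/andP; split; lra.
Qed.

Lemma L1_comp_bounded {d1} {O1 : measurableType d1} (P1 : probability O1 R) (y : O1 -> R)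
  (f : R -> R) (B : R) : continuous f -> (forall x, `|f x| <= B) ->
  measurable_fun setT y -> L1 P1 (fun w => f (y w)).
Proof.
move=> cf fB my; apply: (@L1_bounded _ _ _ P1 _ B) => //.
by apply: (measurableT_comp _ my); exact: continuous_measurable_fun.
Qed.

Lemma Ex_approx {d1} {O1 : measurableType d1} (P1 : probability O1 R) (u v y : O1 -> R) (e c : R) :
  L1 P1 u -> L1 P1 v -> L1 P1 y ->
  (forall w, `|u w - v w| <= e + c * y w) -> `|Ex P1 u - Ex P1 v| <= e + c * Ex P1 y.
Proof.
move=> iu iv iy uv; rewrite -ExB//.
apply: (le_trans (normr_Ex (L1B iu iv))).
have h := L1D (L1_cst P1 e) (L1Z c iy).
apply: (le_trans (le_Ex (L1_norm (L1B iu iv)) h uv)).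
by rewrite ExD ?Ex_cst ?ExZ//; [exact: L1_cst|exact: L1Z].
Qed.

(* A bounded continuous [f y] is close, for y in a compact set, to a polynomial in [expR (- y)], so
   Laplace transforms at the integers suffice; Markov's inequality controls the tails. *)
Lemma laplace_cvg_distr : cvg_distr P Y (fun f => Ex Q (f \o Y0)).
Proof.
move=> f cf [B0 fB0].
pose B := B0 + 1.
have fB x : `|f x| <= B by have := fB0 x; rewrite /B; lra.
have Bgt0 : 0 < B by have := le_trans (normr_ge0 _) (fB0 0); rewrite /B; lra.
apply/cvgrPdist_le => e e0.
(* Makes the tail term 2 B kap / K equal to e / 8; together with the approximation error e / 8, each
   passage from f to the polynomial costs e / 4. *)
pose K := 16 * B * kap / e.
have K0 : 0 < K by rewrite divr_gt0// !mulr_gt0.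
have [|p pP] := poly_exp_approx f B (e / 8) K cf fB _ K0; first by rewrite divr_gt0.
have small : 2 * B / K * kap = e / 8.
  by rewrite /K; field; rewrite !gt_eqF.
have c0 : 0 <= 2 * B / K.
  by apply: divr_ge0; [apply: mulr_ge0 => //|]; exact: ltW.
have apx d1 (O1 : measurableType d1) (P1 : probability O1 R) (y : O1 -> R) :
    L1 P1 y -> (forall w, 0 <= y w) -> Ex P1 y <= kap ->
    `|Ex P1 (fun w => p.[expR (- y w)]) - Ex P1 (f \o y)| <= e / 4.
  move=> iy y0 yk; have [ip _] := Ex_poly_exp P1 y p iy y0.
  have i2 : L1 P1 (f \o y) by exact: (L1_comp_bounded P1 y f B cf fB (L1_meas iy)).
  apply: (le_trans (@Ex_approx _ _ P1 _ _ y (e / 8) (2 * B / K) ip i2 iy _)).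
    by move=> w; rewrite /= -mulrA mulrA mulrAC -mulrA; have := pP (y w) (y0 w); rewrite mulrA.
  have := ler_wpM2l c0 yk; lra.
have polycvg : Ex P (fun w => p.[expR (- Y a w)]) @[a --> +oo] -->
    Ex Q (fun w => p.[expR (- Y0 w)]).
  rewrite (Ex_poly_exp Q Y0 p L1Y0 Y0ge0).2.
  have h : \sum_(m < size p) p`_m * Ex P (fun w => expR (- (m%:R * Y a w))) @[a --> +oo] -->
      \sum_(m < size p) p`_m * Ex Q (fun w => expR (- (m%:R * Y0 w))).
    elim: (size p) => [|n IH].
      by rewrite big_ord0; under eq_fun do rewrite big_ord0; exact: cvg_cst.
    rewrite big_ord_recr /=; under eq_fun do rewrite big_ord_recr /=.
    apply: cvgD; first exact: IH.
    by apply: cvgM; [exact: cvg_cst|exact: laplace].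
  apply: cvg_trans h; apply: near_eq_cvg.
  near=> a; rewrite (Ex_poly_exp P (Y a) p _ _).2//.
    by apply: L1Y; near: a; exact: nbhs_pinfty_gt.
  by move=> w; apply: Yge0; near: a; exact: nbhs_pinfty_gt.
move/cvgrPdist_le : polycvg => /(_ (e / 4)); rewrite divr_gt0// => /(_ isT) pc.
near=> a.
have a0 : 0 < a by near: a; exact: nbhs_pinfty_gt.
have h1 := apx _ _ Q Y0 L1Y0 Y0ge0 EY0.
have h2 := apx _ _ P (Y a) (L1Y a a0) (fun w => Yge0 a w a0) (EY a a0).
have h3 : `|Ex Q (fun w => p.[expR (- Y0 w)]) - Ex P (fun w => p.[expR (- Y a w)])| <= e / 4.
  by near: a.
move: h1 h2 h3; rewrite !ler_norml => /andP[? ?] /andP[? ?] /andP[? ?].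
by apply/andP; split; lra.
Unshelve. all: by end_near. Qed.

End laplace_to_weak.

(** * Laplace transforms of nonnegative variables and their derivative *)

Section laplace_derivative.
Context {R : realType} {d : measure_display} {Om : measurableType d}.
Variables (P : probability Om R) (Y : Om -> R).
Hypothesis mY : measurable_fun setT Y.
Hypothesis Y0 : forall w, 0 <= Y w.

Definition lap (s : R) := Ex P (fun w => expR (- (s * Y w))).

Lemma lap_mfun s : measurable_fun setT (fun w => expR (- (s * Y w))).
Proof.
apply: (measurableT_comp (@measurable_expR R)).
by apply: measurable_funN; exact: measurable_funM.
Qed.

Lemma expRN_le1 (y : R) : 0 <= y -> expR (- y) <= 1.
Proof. by move=> y0; rewrite -[leRHS]expR0 ler_expR oppr_le0. Qed.

Lemma mul_expRN_le1 (y : R) : 0 <= y -> y * expR (- y) <= 1.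
Proof.
move=> y0; rewrite expRN ler_pdivrMr ?expR_gt0// mul1r.
by have := expR_ge1Dx y; lra.
Qed.

Lemma L1_lap (s : R) : 0 <= s -> L1 P (fun w => expR (- (s * Y w))).
Proof.
move=> s0; apply: (@L1_bounded _ _ _ P _ 1); first exact: lap_mfun.
by move=> w; rewrite ger0_norm ?expR_ge0// expRN_le1// mulr_ge0.
Qed.

Lemma lap_ge0 s : 0 <= lap s.
Proof. by apply: Ex_ge0 => w; exact: expR_ge0. Qed.

Lemma lap_le1 (s : R) : 0 <= s -> lap s <= 1.
Proof.
move=> s0; rewrite -(Ex_cst P 1); apply: le_Ex; [exact: L1_lap|exact: L1_cst|].
by move=> w; rewrite expRN_le1// mulr_ge0.
Qed.

Lemma L1_Ylap (s : R) : 0 < s -> L1 P (fun w => Y w * expR (- (s * Y w))).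
Proof.
move=> s0; apply: (@L1_bounded _ _ _ P _ s^-1).
  by apply: measurable_funM => //; exact: lap_mfun.
move=> w; rewrite ger0_norm ?mulr_ge0 ?expR_ge0//.
by rewrite -[leRHS]mulr1 ler_pdivlMl// mulrA mul_expRN_le1// mulr_ge0// ltW.
Qed.

(** Differentiation under the integral on the interval from s / 2 to 2 s: there t > s / 2, and t y
    exp(- t y) <= 1 bounds the derivative by the constant 2 / s. *)
Lemma is_derive_lap (s : R) : 0 < s ->
  is_derive s (1 : R) lap (- Ex P (fun w => Y w * expR (- (s * Y w)))).
Proof.
move=> s0.
pose f (t : R) w := expR (- (t * Y w)).
have df t w : is_derive t (1 : R) (f ^~ w) (- (Y w * f t w)).
  have h : is_derive t (1 : R) (fun t : R => - (t * Y w)) (- Y w).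
    apply: is_derive_eq.
    by rewrite /GRing.scale /=; ring.
  apply: (is_derive_eq (is_derive1_comp (is_derive_expR _) h)).
  by rewrite /GRing.scale /= /f; ring.
have Is : `]s / 2, (2 * s)[%classic s by rewrite /= in_itv /=; apply/andP; split; lra.
have I0 t : `]s / 2, (2 * s)[%classic t -> s / 2 < t by rewrite /= in_itv /= => /andP[].
have dE t w : partial1of2 f t w = - (Y w * f t w).
  by rewrite partial1of2E; case: (df t w).
have h1 t : `]s / 2, (2 * s)[%classic t -> P.-integrable setT (EFin \o f t).
  by move=> /I0 ht; apply: L1_lap; lra.
have h2 t w : `]s / 2, (2 * s)[%classic t -> setT w -> derivable (f ^~ w) t 1.
  by move=> _ _; case: (df t w).
have h3 t w : `]s / 2, (2 * s)[%classic t -> setT w -> `|partial1of2 f t w| <= 2 / s.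
  move=> /I0 ht _; rewrite dE normrN ger0_norm ?mulr_ge0 ?expR_ge0//.
  have t0 : 0 < t by lra.
  have : t * (Y w * f t w) <= 1 by rewrite mulrA mul_expRN_le1// mulr_ge0// ltW.
  have : 0 <= Y w * f t w by rewrite mulr_ge0// expR_ge0.
  set X := Y w * f t w => X0 tX.
  rewrite ler_pdivlMr//; nra.
have G0 (w : Om) : 0 <= (fun=> 2 / s) w by rewrite divr_ge0// ltW.
have dv := derivable_under_integral measurableT Is h1 h2 G0 (L1_cst P (2 / s)) h3.
have de := differentiation_under_integral measurableT Is h1 h2 G0 (L1_cst P (2 / s)) h3.
apply: DeriveDef; first exact: dv.
rewrite -derive1E; apply: (etrans de).
rewrite -(mulN1r (Ex P _)) -ExZ; last exact: L1_Ylap.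
by apply: eq_Ex => w; rewrite dE mulN1r.
Qed.

End laplace_derivative.

(** * Laplace transform and mean of the chi-squared law *)

Section normal_laplace.
Context {R : realType}.
Let Nn := normal_prob (0 : R) 1.
Let leb := @lebesgue_measure R.

(** The change of variables is stated with the Radon-Nikodym derivative, which agrees almost
    everywhere with the normal density since both have the same integral over every measurable
    set. *)
Lemma integral_normal_density (f : R -> R) (B : R) : measurable_fun setT f ->
  (forall x, `|f x| <= B) ->
  (\int[Nn]_x (f x)%:E = \int[leb]_x ((f x)%:E * (normal_pdf 0 1 x)%:E))%E.
Proof.
move=> mf fB.
have dom : Nn `<< leb by exact: normal_prob_dominates.
have fi : Nn.-integrable setT (EFin \o f) by exact: (L1_bounded Nn mf fB).
rewrite -(Radon_Nikodym_change_of_variables dom measurableT fi).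
apply: ae_eq_integral => //.
- apply: emeasurable_funM; first exact/measurable_EFinP.
  by apply: (measurable_int leb); exact: Radon_Nikodym_integrable.
- by apply: emeasurable_funM; apply/measurable_EFinP => //; exact: measurable_normal_pdf.
- apply: ae_eqe_mul2l.
  apply: integral_ae_eq => //.
  + exact: Radon_Nikodym_integrable.
  + by apply/measurable_EFinP; exact: measurable_normal_pdf.
  + by move=> E _ mE; rewrite -Radon_Nikodym_integral.
Qed.

Let sq (x : R) := x ^+ 2.
Let msq : measurable_fun setT sq.
Proof. exact: measurable_funX. Qed.
Let sq0 x : 0 <= sq x. Proof. exact: sqr_ge0. Qed.

(* Tilting the normal density by [expR (- (s * x ^+ 2))] gives a normal density of variance
   1 / (1 + 2 s), up to a constant. *)
Lemma lap_normal (s : R) : 0 <= s -> lap Nn sq s ^+ 2 * (1 + 2 * s) = 1.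
Proof.
move=> s0; have s1 : 0 < 1 + 2 * s by lra.
pose tau := (Num.sqrt (1 + 2 * s))^-1.
have tau0 : 0 < tau by rewrite invr_gt0 sqrtr_gt0.
have tau2 : tau ^+ 2 = (1 + 2 * s)^-1 by rewrite exprVn sqr_sqrtr// ltW.
have E x : expR (- (s * sq x)) * normal_pdf 0 1 x =
    (normal_peak 1 / normal_peak tau) * normal_pdf 0 tau x.
  rewrite !normal_pdfE ?oner_eq0 ?gt_eqF// mulrCA [RHS]mulrA divfK; last first.
    by rewrite gt_eqF// normal_peak_gt0// gt_eqF.
  congr (_ * _); rewrite /normal_fun -expRD; congr expR.
  by rewrite tau2 /sq; field; rewrite gt_eqF.
have i1 : (\int[Nn]_x (expR (- (s * sq x)))%:E = (normal_peak 1 / normal_peak tau)%:E)%E.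
  rewrite (@integral_normal_density _ 1); last 2 first.
  - exact: lap_mfun.
  - by move=> x; rewrite ger0_norm ?expR_ge0// expRN_le1// mulr_ge0.
  under eq_integral do rewrite -EFinM E EFinM.
  rewrite integralZl//; last exact: integrable_normal_pdf.
  by rewrite integral_normal_pdf mule1.
rewrite /lap /Ex i1 /=; clearbody tau.
rewrite exprMn /normal_peak !exprVn !sqr_sqrtr; last 2 first.
- by rewrite mulrn_wge0// mulr_ge0 ?pi_ge0// sqr_ge0.
- by rewrite mulrn_wge0// mulr_ge0 ?pi_ge0// sqr_ge0.
rewrite tau2 expr1n; have := @pi_gt0 R; move: (pi : R) => p p0; field.
by rewrite !gt_eqF.
Qed.

(** Differentiate the identity L(s)^2 (1 + 2 s) = 1 of [lap_normal] and divide by 2 L(s), which is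
    nonzero by the same identity. *)
Lemma Ex_sq_lap (s : R) : 0 < s ->
  Ex Nn (fun x => sq x * expR (- (s * sq x))) * (1 + 2 * s) = lap Nn sq s.
Proof.
move=> s0.
have dL := is_derive_lap Nn sq msq sq0 s s0.
set L := lap Nn sq; set D := Ex Nn _ in dL *.
have d2 : is_derive s (1 : R) (fun t : R => 1 + 2 * t) 2.
  apply: is_derive_eq.
  by rewrite /GRing.scale /=; ring.
have dphi := is_deriveM (is_deriveM dL dL) d2.
have d0 : is_derive s (1 : R) (cst (1 : R)) 0 by exact: is_derive_cst.
have e : \forall t \near s, cst 1 t = (L * L * (fun t : R => 1 + 2 * t)) t.
  near=> t.
  have t0 : 0 <= t by apply: ltW; near: t; exact: lt_nbhsr.
  by apply/esym; rewrite -[RHS](lap_normal t t0) expr2.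
have [_ h1] := dphi; have [_ h2] := near_eq_is_derive e d0.
have h : 0 = (L * L) s *: 2 + (1 + 2 * s) *: (L s *: - D + L s *: - D).
  exact: (etrans (esym h2) h1).
have L1p : L s != 0.
  apply/negP => /eqP L0; have := lap_normal s (ltW s0).
  by rewrite -/L L0 expr0n mul0r => /eqP; rewrite eq_sym oner_eq0.
have : 2 * L s * (L s - D * (1 + 2 * s)) = 0.
  transitivity (L s * L s * 2 + (1 + 2 * s) * (L s * - D + L s * - D)); first by ring.
  exact/esym/h.
move/eqP; rewrite !mulf_eq0 (negbTE L1p) orbF pnatr_eq0 /= subr_eq0 => /eqP ->//.
Unshelve. all: by end_near. Qed.

(** Let s decrease to 0 in E[x^2 exp(- s x^2)] = L(s) / (1 + 2 s): the left side increases to the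
    second moment by monotone convergence. *)
Lemma normal_second_moment : L1 Nn sq /\ Ex Nn sq = 1.
Proof.
pose s n : R := n.+1%:R^-1.
have s0 n : 0 < s n by rewrite invr_gt0.
pose fn n x := (sq x * expR (- (s n * sq x)))%:E.
have mfn n : measurable_fun setT (fn n).
  by apply/measurable_EFinP; apply: measurable_funM => //; exact: lap_mfun.
have s_cvg : s n @[n --> \oo] --> (0 : R).
  exact: cvg_harmonic.
have pc x : fn n x @[n --> \oo] --> (sq x)%:E.
  apply/cvg_EFin; first by near=> n.
  rewrite -[X in _ --> X]mulr1; apply: cvgM; first exact: cvg_cst.
  rewrite -expR0; apply: (cvg_comp _ expR); last exact: continuous_expR.
  rewrite -oppr0; apply: cvgN; rewrite -(mul0r (sq x)).
  by apply: cvgM; [exact: s_cvg|exact: cvg_cst].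
have ncvg : (\int[Nn]_x (fn n x))%E @[n --> \oo] --> (\int[Nn]_x (sq x)%:E)%E.
  rewrite [X in _ --> X](_ : _ = (\int[Nn]_x limn (fn ^~ x))%E); last first.
    by apply: eq_integral => x _; apply/esym/cvg_lim => //; exact: pc.
  apply: cvg_monotone_convergence => //.
  - by move=> n x _; rewrite lee_fin mulr_ge0 ?expR_ge0.
  - move=> x _ m n mn; rewrite lee_fin ler_wpM2l// ler_expR lerN2 ler_wpM2r//.
    by rewrite lef_pV2 ?posrE ?ltr0n// ler_nat.
have En n : (\int[Nn]_x (fn n x) = (lap Nn sq (s n) / (1 + 2 * s n))%:E)%E.
  have s1 : 1 + 2 * s n != 0 by rewrite gt_eqF//; have := s0 n; lra.
  rewrite -(Ex_sq_lap _ (s0 n)) mulfK//.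
  by rewrite ExE//; exact: L1_Ylap.
have c1 : (lap Nn sq (s n) / (1 + 2 * s n)) @[n --> \oo] --> (1 : R).
  (* The quotient is (1 + 2 s)^(-3/2), which lies between 1 - 4 s and 1. *)
  have u : (1 - 4 * s n) @[n --> \oo] --> (1 : R).
    rewrite -[X in _ --> X]subr0 -(mulr0 4); apply: cvgB; first exact: cvg_cst.
    by apply: cvgM; [exact: cvg_cst|exact: s_cvg].
  apply: (@squeeze_cvgr _ _ _ _ (fun n => 1 - 4 * s n) (cst 1)) => //; last exact: cvg_cst.
  near=> n; have sn := s0 n; have l1 := lap_le1 Nn sq msq sq0 _ (ltW sn).
  have l0 := lap_ge0 Nn sq (s n); have l2 := lap_normal _ (ltW sn).
  rewrite [cst 1 n]/=.
  move: (s n) sn l1 l0 l2 => t t0; move: (lap Nn sq t) => l l1 l0 l2.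
  have p1 : 0 < 1 + 2 * t by lra.
  rewrite ler_pdivrMr// ler_pdivlMr//; apply/andP; split; nra.
have e1 : (\int[Nn]_x (sq x)%:E)%E = 1%E.
  have : (\int[Nn]_x (fn n x))%E @[n --> \oo] --> 1%E.
    under eq_fun do rewrite En; apply/cvg_EFin => //; by near=> n.
  by move/cvg_lim => <- //; move/cvg_lim : ncvg => <-.
split; last by rewrite /Ex e1.
apply/integrableP; split; first exact/measurable_EFinP.
by under eq_integral do rewrite /= ger0_norm//; rewrite e1 ltry.
Unshelve. all: by end_near. Qed.

End normal_laplace.

(** * Convergence in distribution *)

Section clt.
Context {R : realType} {d : measure_display} {Om : measurableType d}.
Variables (P : probability Om R) (T : nat) (lam : nat -> R)
  (M : nat -> R -> Om -> nat) (Dk : nat -> nat -> Om -> nat)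
  (Zk : nat -> nat -> Om -> R) (D : Om -> nat) (Z : Om -> R).
Hypothesis SM : special_model P T lam M Dk Zk D Z.
Variable i : nat.
Hypothesis iT : (1 <= i <= T)%N.
Variable k : nat.
Hypothesis k0 : (1 <= k)%N.
Let EZ := Ex P Z.
Let EZ2 := Ex P (fun w => Z w ^+ 2).
Let p_le := prD P D (fun n => (n <= k)%N).
Let C a w := Cl M Dk Zk a i k w.
Let H2 a w := (C a w - Ex P (C a)) ^+ 2 / a.
Let sig2 := lam i * EZ2 * p_le.
Let y w := Z w * (D w <= k)%N%:R.

Let T0 : (0 < T)%N.
Proof. by case/andP: iT => h1; exact: leq_trans. Qed.

Let lam0 : 0 < lam i := sm_lam SM iT.
Let ple0 : 0 < p_le := prD_le_gt0 P T lam M Dk Zk D Z SM T0 k k0.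
Let EZ0 : 0 < EZ := EZ_gt0 P T lam M Dk Zk D Z SM T0.
Let EZ20 : 0 < EZ2 := EZ2_gt0 P T lam M Dk Zk D Z SM T0.

Lemma sig2_gt0 : 0 < sig2.
Proof. by rewrite /sig2 !mulr_gt0. Qed.

Let iy : L1 P y := (Ex_ZD P T lam M Dk Zk D Z SM (fun n => (n <= k)%N)).1.
Let ey : Ex P y = EZ * p_le := (Ex_ZD P T lam M Dk Zk D Z SM (fun n => (n <= k)%N)).2.

Let y2E : (fun w => y w ^+ 2) = (fun w => Z w ^+ 2 * (D w <= k)%N%:R).
Proof.
by apply/funext => w; rewrite /y exprMn; case: (_ <= _)%N; rewrite ?expr1n ?expr0n.
Qed.

Let iy2 : L1 P (fun w => y w ^+ 2).
Proof. by rewrite y2E; exact: (Ex_Z2D P T lam M Dk Zk D Z SM (fun n => (n <= k)%N)).1. Qed.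
Let ey2 : Ex P (fun w => y w ^+ 2) = EZ2 * p_le.
Proof. by rewrite y2E; exact: (Ex_Z2D P T lam M Dk Zk D Z SM (fun n => (n <= k)%N)).2. Qed.

Let mC a : 0 <= a -> measurable_fun setT (C a).
Proof. by move=> a0; exact: (measurable_Cl P T lam M Dk Zk D Z SM i iT a a0 k). Qed.

Let moments a (a0 : 0 <= a) := Ex_Cl_moments P T lam M Dk Zk D Z SM i iT a a0 k.

Let CE a : (fun w => csum (fun n => claim (Dk i n) (Zk i n)) (M i a) w k) = C a.
Proof. by apply/funext => w; exact: csum_Cl. Qed.

Lemma Ex_C a : 0 <= a -> Ex P (C a) = lam i * EZ * p_le * a.
Proof.
by move=> a0; have [_ + _ _] := moments a a0; rewrite CE => ->; rewrite -/EZ -/p_le; ring.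
Qed.

Let iC a : 0 <= a -> L1 P (C a).
Proof. by move=> a0; have [+ _ _ _] := moments a a0; rewrite CE. Qed.

Let mH2 a : 0 <= a -> measurable_fun setT (H2 a).
Proof.
move=> a0; apply: measurable_funM => //; apply: measurable_funX.
by apply: measurable_funB => //; exact: mC.
Qed.

(** The mean does not depend on a: this bounds the tails of H^2 uniformly and fixes the behaviour of
    its Laplace transform near 0. *)
Lemma Ex_H2 a : 0 < a -> L1 P (H2 a) /\ Ex P (H2 a) = sig2.
Proof.
move=> a0; have a0' := ltW a0; have [_ _ i2 e2] := moments a a0'.
have CE2 : (fun w => csum (fun n => claim (Dk i n) (Zk i n)) (M i a) w k ^+ 2) =
           (fun w => C a w ^+ 2).
  by apply/funext => w; rewrite /C -csum_Cl.
rewrite CE2 in i2 e2.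
have E w : H2 a w = a^-1 * (C a w ^+ 2 + (- 2 * Ex P (C a)) * C a w + Ex P (C a) ^+ 2).
  by rewrite /H2; ring.
have iC' := iC a a0'.
have iA : L1 P (fun w => C a w ^+ 2 + (- 2 * Ex P (C a)) * C a w).
  by apply: L1D => //; exact: L1Z.
rewrite (funext E); split.
  by apply: L1Z; apply: L1D => //; exact: L1_cst.
rewrite ExZ; last by apply: L1D => //; exact: L1_cst.
rewrite ExD ?Ex_cst//; last exact: L1_cst.
rewrite ExD//; last exact: L1Z.
rewrite ExZ// e2 Ex_C// -/EZ2 -/EZ -/p_le /sig2.
by field; rewrite gt_eqF.
Qed.

Let H2_ge0 a w : 0 < a -> 0 <= H2 a w.
Proof. by move=> a0; rewrite divr_ge0 ?sqr_ge0 ?ltW. Qed.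

(** Error term of the Stein identity: one factor y comes from the size bias, the other from the
    increment y / sqrt a of H, and the minimum from the Taylor remainder of [sk]. *)
Let rem a s := Ex P (fun w => y w ^+ 2 * Num.min 4 ((5 * s + 11) * (`|y w| / Num.sqrt a))).

Let my : measurable_fun setT y := L1_meas iy.

Let iremf a s : 0 < a -> 0 <= s ->
  L1 P (fun w => y w ^+ 2 * Num.min 4 ((5 * s + 11) * (`|y w| / Num.sqrt a))).
Proof.
move=> a0 s0; apply: (L1_dom _ (L1Z 4 iy2)).
  apply: measurable_funM; first exact: measurable_funX.
  apply: measurable_minr => //; apply: measurable_funM => //.
  by apply: measurable_funM => //; exact: measurableT_comp.
move=> w; rewrite !normrM mulrC ler_wpM2r//.
rewrite ger0_norm; last first.
  rewrite le_min; apply/andP; split => //.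
  apply: mulr_ge0; first lra.
  by apply: divr_ge0 => //; exact: sqrtr_ge0.
by rewrite (ger0_norm (x := 4))// ge_min lexx.
Qed.

(* Mecke's formula for [C a * sk s (H)], with the increment of [sk s] Taylor-expanded. *)
Lemma stein_error a s : 0 < a -> 0 < s ->
  `|Ex P (fun w => H2 a w * expR (- (s * H2 a w))) -
    sig2 * Ex P (fun w => (1 - 2 * s * H2 a w) * expR (- (s * H2 a w)))| <= lam i * rem a s.
Proof.
move=> a0 s0; have a0' := ltW a0; have s0' := ltW s0.
pose b := Num.sqrt a.
have b0 : 0 < b by rewrite sqrtr_gt0.
have b2 : b ^+ 2 = a by rewrite sqr_sqrtr.
pose c0 := Ex P (C a).
pose H w := (C a w - c0) / b.
have HH w : H w ^+ 2 = H2 a w by rewrite /H exprMn exprVn b2.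
pose h (r : R) := sk s ((r - c0) / b).
have mgk : measurable_fun setT (gk s).
  apply: (measurableT_comp (@measurable_expR R)); apply: measurable_funN.
  by apply: measurable_funM => //; exact: measurable_funX.
have msk : measurable_fun setT (sk s) by exact: measurable_funM.
have mdsk : measurable_fun setT (dsk s).
  apply: measurable_funM => //; apply: measurable_funB => //.
  by apply: measurable_funM => //; exact: measurable_funX.
have mh : measurable_fun setT h.
  apply: (measurableT_comp msk); apply: measurable_funM => //.
  exact: measurable_funB.
have hb r : `|h r| <= 1 + s^-1 by exact: sk_bound.
have [i1 i2 e1] := model_size_bias P T lam M Dk Zk D Z SM i iT a a0' k h _ iy mh hb.
rewrite -/(C a) -/y in i1 i2 e1.
have mH : measurable_fun setT H.
  by apply: measurable_funM => //; apply: measurable_funB => //; exact: mC.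
have ihC : L1 P (fun w => h (C a w)).
  by apply: (L1_bounded P (measurableT_comp mh (mC a a0')) (fun w => hb _)).
have idH : L1 P (fun w => dsk s (H w)).
  by apply: (L1_bounded P (measurableT_comp mdsk mH) (fun w => dsk_bound s _ s0')).
pose hy w := Ex P (fun w' => h (C a w' + y w)).
have E1 : Ex P (fun w => H2 a w * expR (- (s * H2 a w))) =
    b^-1 * (Ex P (fun w => C a w * h (C a w)) - c0 * Ex P (fun w => h (C a w))).
  rewrite -ExZ// -ExB//; last exact: L1Z.
  rewrite -ExZ; last by apply: L1B => //; exact: L1Z.
  apply: eq_Ex => w; rewrite -!HH /h /sk /gk -/(H w) -mulrBl.
  have -> : C a w - c0 = b * H w by rewrite /H; field; rewrite gt_eqF.
  by move: (expR _) => g; field; rewrite gt_eqF.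
have E2 : Ex P (fun w => (1 - 2 * s * H2 a w) * expR (- (s * H2 a w))) =
    Ex P (fun w => dsk s (H w)).
  by apply: eq_Ex => w; rewrite /dsk /gk HH.
have c0E : c0 = lam i * a * Ex P y by rewrite /c0 Ex_C// ey; ring.
set h0 := Ex P (fun w => h (C a w)) in E1 *.
set d0 := Ex P (fun w => dsk s (H w)) in E2 *.
have inner w : `|hy w - h0 - y w / b * d0| <= `|y w| / b * Num.min 4 ((5 * s + 11) * (`|y w| / b)).
  have j1 : L1 P (fun w' => h (C a w' + y w)).
    apply: (L1_bounded P _ (fun w' => hb _)); apply: (measurableT_comp mh).
    by apply: measurable_funD => //; exact: mC.
  have -> : hy w - h0 - y w / b * d0 =
    Ex P (fun w' => h (C a w' + y w) - h (C a w') - y w / b * dsk s (H w')).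
    by rewrite /hy /h0 /d0 ExB ?ExB ?ExZ//; [exact: L1B|exact: L1Z].
  have j2 : L1 P (fun w' => h (C a w' + y w) - h (C a w') - y w / b * dsk s (H w')).
    by apply: L1B; [exact: L1B|exact: L1Z].
  apply: (le_trans (normr_Ex j2)).
  rewrite -[leRHS](Ex_cst P); apply: le_Ex; [exact: L1_norm|exact: L1_cst|] => w'.
  have -> : h (C a w' + y w) = sk s (H w' + y w / b).
    by rewrite /h /H; congr sk; ring.
  have nb : `|y w / b| = `|y w| / b by rewrite normrM normfV (ger0_norm (ltW b0)).
  have := sk_taylor s (H w') (y w / b) s0'.
  by rewrite nb /h -/(H w').
have k1 : L1 P (fun w => y w * h0) by exact: L1Zr.
have k2 : L1 P (fun w => y w ^+ 2 * (d0 / b)) by exact: L1Zr.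
(* Both leading terms cancel exactly: c0 = lam a E[y] accounts for the constant term of the
   expansion and sig2 = lam E[y^2] for the linear one. *)
have main : Ex P (fun w => H2 a w * expR (- (s * H2 a w))) - sig2 * d0 =
    lam i * b * Ex P (fun w => y w * hy w - y w * h0 - y w ^+ 2 * (d0 / b)).
  have e1' : Ex P (fun w => C a w * h (C a w)) = lam i * a * Ex P (fun w => y w * hy w) := e1.
  have i2' : L1 P (fun w => y w * hy w) := i2.
  have -> : Ex P (fun w => y w * hy w - y w * h0 - y w ^+ 2 * (d0 / b)) =
      Ex P (fun w => y w * hy w) - Ex P y * h0 - Ex P (fun w => y w ^+ 2) * (d0 / b).
    rewrite (ExB (L1B i2' k1) k2) (ExB i2' k1).
    by rewrite (ExZr h0 iy) (ExZr (d0 / b) iy2).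
  rewrite E1 e1' c0E ey2 /sig2.
  have -> : lam i * a = lam i * b * b by rewrite -b2 expr2 mulrA.
  clear E1 E2 e1 e1' inner i2 i2' k1 k2; clearbody h0 d0 b.
  move: (Ex P (fun w => y w * hy w)) (Ex P y) h0 d0 EZ2 p_le (lam i) => A B h1 d1 q p l.
  by field; rewrite gt_eqF.
rewrite E2 main normrM ger0_norm; last by rewrite mulr_ge0 ?ltW.
rewrite -mulrA ler_wpM2l ?(ltW lam0)//.
have j3 : L1 P (fun w => y w * hy w - y w * h0 - y w ^+ 2 * (d0 / b)).
  by apply: L1B => //; exact: L1B.
apply: (le_trans (ler_wpM2l (ltW b0) (normr_Ex j3))).
rewrite -ExZ; last exact: L1_norm.
apply: le_Ex; [by apply: L1Z; exact: L1_norm|exact: iremf|] => w.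
have -> : y w * hy w - y w * h0 - y w ^+ 2 * (d0 / b) = y w * (hy w - h0 - y w / b * d0).
  by ring.
rewrite normrM.
apply: (le_trans (ler_wpM2l (ltW b0) (ler_wpM2l (normr_ge0 _) (inner w)))).
rewrite -/b -(real_normK (num_real (y w))) le_eqVlt; apply/orP; left; apply/eqP.
by move: (Num.min _ _) => mm; field; rewrite gt_eqF.
Qed.

Let mtail (n : nat) : measurable_fun setT (fun w => (n%:R < `|y w|)%R%:R : R).
Proof.
have mb : measurable_fun setT (fun w => (n%:R < `|y w|)%R).
  by apply: measurable_fun_ltr => //; exact: measurableT_comp.
rewrite (_ : (fun w => _) = \1_[set w | (n%:R < `|y w|)%R]).
  apply: measurable_indic.
  by have := mb measurableT [set true] Logic.I; rewrite setTI.
apply/funext => w; rewrite indicE; congr (_%:R); congr nat_of_bool.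
by apply/idP/idP; rewrite inE.
Qed.

Lemma tail_second_moment : Ex P (fun w => y w ^+ 2 * (n%:R < `|y w|)%R%:R) @[n --> \oo] --> (0 : R).
Proof.
have mf n : measurable_fun setT (fun w => (y w ^+ 2 * (n%:R < `|y w|)%R%:R)%:E).
  apply/measurable_EFinP; apply: measurable_funM => //.
  exact: measurable_funX.
have hc : {ae P, forall w, setT w ->
    (fun n => (y w ^+ 2 * (n%:R < `|y w|)%R%:R)%:E) @ \oo --> (0%R)%:E}.
  apply: aeW => w _; apply/cvg_EFin; first by near=> n.
  apply: cvg_near_cst; near=> n.
  rewrite /= ltNge (_ : `|y w| <= n%:R) ?mulr0//.
  by apply: ltW; near: n; exact: nbhs_infty_gtr.
have hb : {ae P, forall w n, setT w ->
    (`|(y w ^+ 2 * (n%:R < `|y w|)%R%:R)%:E| <= (y w ^+ 2)%:E)%E}.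
  apply: aeW => w n _; rewrite lee_fin normrM ger0_norm ?sqr_ge0//.
  by case: (_ < _)%R; rewrite ?normr1 ?normr0 ?mulr1 ?mulr0 ?sqr_ge0.
have [_ _] := dominated_convergence measurableT mf (measurable_cst (0%R%:E)) hc iy2 hb.
rewrite integral0 => h.
exact: (fine_cvg h).
Unshelve. all: by end_near. Qed.

(** Claims larger than n in absolute value meet the bound 4 and a small tail of the second moment;
    for the others the linear bound is at most (5 s + 11) n / sqrt a. The level n is fixed before a
    grows. *)
Lemma rem_cvg0 s e : 0 < s -> 0 < e -> \forall a \near +oo, lam i * rem a s <= e.
Proof.
move=> s0 e0.
have l4 : 0 < e / (8 * lam i) by rewrite divr_gt0// mulr_gt0.
have /cvgrPdist_le /(_ _ l4) [n _ hn] := tail_second_moment.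
have {}hn := hn n (leqnn n); rewrite /= sub0r normrN in hn.
set tl := Ex P (fun w => y w ^+ 2 * (n%:R < `|y w|)%R%:R) in hn.
pose K := 5 * s + 11.
have K0 : 0 < K by rewrite /K; lra.
pose q := EZ2 * p_le.
have q0 : 0 < q by exact: mulr_gt0.
have big : \forall a \near +oo, (K * n%:R * q * lam i * 2 / e) ^+ 2 <= a.
  exact: nbhs_pinfty_ge (num_real _).
near=> a.
have a0 : 0 < a by near: a; exact: nbhs_pinfty_gt.
have b0 : 0 < Num.sqrt a by rewrite sqrtr_gt0.
have ba : K * n%:R * q * lam i * 2 / e <= Num.sqrt a.
  have x0 : 0 <= K * n%:R * q * lam i * 2 / e.
    by apply: divr_ge0; [do 4 ?apply: mulr_ge0 => //; exact: ltW|exact: ltW].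
  rewrite -(ger0_norm x0) -sqrtr_sqr ler_wsqrtr//.
have mtl : L1 P (fun w => y w ^+ 2 * (n%:R < `|y w|)%R%:R).
  apply: (L1_dom _ iy2).
    by apply: measurable_funM; first exact: measurable_funX.
  move=> w; rewrite normrM.
  by case: (_ < _)%R; rewrite ?normr1 ?normr0 ?mulr1 ?mulr0.
have bd : rem a s <= 4 * tl + (K * n%:R / Num.sqrt a) * q.
  rewrite /q -ey2 /tl -!ExZ// -ExD; [|exact: L1Z|exact: L1Z].
  apply: le_Ex; [by apply: iremf => //; exact: ltW|by apply: L1D; exact: L1Z|] => w.
  have y20 : 0 <= y w ^+ 2 by exact: sqr_ge0.
  case: ltP => yn.
    rewrite mulr1 [4 * _]mulrC; apply: le_trans (_ : y w ^+ 2 * 4 <= _).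
      by rewrite ler_wpM2l// ge_min lexx.
    rewrite lerDl; apply: mulr_ge0 => //.
    by apply: divr_ge0; [apply: mulr_ge0 => //|]; exact: ltW.
  rewrite mulr0 mulr0 add0r mulrC ler_wpM2r// ge_min; apply/orP; right.
  by rewrite -mulrA ler_wpM2l ?(ltW K0)// ler_wpM2r// invr_ge0 ltW.
have h1 : lam i * (4 * tl) <= e / 2.
  have : tl <= e / (8 * lam i) by rewrite (le_trans (ler_norm _)).
  rewrite ler_pdivlMr ?mulr_gt0//; lra.
have h2 : lam i * (K * n%:R / Num.sqrt a * q) <= e / 2.
  have -> : lam i * (K * n%:R / Num.sqrt a * q) = (K * n%:R * q * lam i) / Num.sqrt a.
    by field; rewrite gt_eqF.
  rewrite ler_pdivrMr//; move: ba; rewrite ler_pdivrMr//; lra.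
have := ler_wpM2l (ltW lam0) bd; rewrite mulrDr; lra.
Unshelve. all: by end_near. Qed.

Let phi a s := (1 + 2 * s * sig2) * (lap P (H2 a) s * lap P (H2 a) s).

(* Stein's identity says that L(s), the Laplace transform of [H2 a], nearly solves the equation
   (1 + 2 s sig2) L' = - sig2 L; hence (1 + 2 s sig2) L(s) ^+ 2 is nearly constant. *)
Lemma laplace_H2 s : 0 < s -> phi a s @[a --> +oo] --> (1 : R).
Proof.
move=> s0; apply/cvgrPdist_le => e e0.
have sg := sig2_gt0.
pose e' := e / (4 * s).
have e'0 : 0 < e' by rewrite divr_gt0// mulr_gt0.
(* The derivative is available at positive arguments only, so the mean value theorem is used from
   del to s. The cutoff makes [phi a del] within e / 2 of 1 for every a, through del sig2 <= e /
   4. *)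
pose del := Num.min (s / 2) (e / (4 * sig2)).
have d0 : 0 < del by rewrite lt_min !divr_gt0// mulr_gt0.
have ds : del < s by rewrite gt_min; apply/orP; left; lra.
near=> a.
have a0 : 0 < a by near: a; exact: nbhs_pinfty_gt.
have hr : lam i * rem a s <= e' by near: a; exact: rem_cvg0.
have mY := mH2 a (ltW a0); have Y0 w := H2_ge0 a w a0.
have [iY eY] := Ex_H2 a a0.
pose L := lap P (H2 a).
pose DL t := - Ex P (fun w => H2 a w * expR (- (t * H2 a w))).
pose dphi t := 2 * sig2 * (L t * L t) + (1 + 2 * t * sig2) * (2 * L t * DL t).
have dL (t : R) : 0 < t -> is_derive t (1 : R) (phi a) (dphi t).
  move=> t0; have h := is_derive_lap P (H2 a) mY Y0 t t0.
  have h2 : is_derive t (1 : R) (fun t : R => 1 + 2 * t * sig2) (2 * sig2).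
    apply: is_derive_eq.
    by rewrite /GRing.scale /=; ring.
  have := is_deriveM h2 (is_deriveM h h).
  move=> /is_derive_eq; apply.
  transitivity ((1 + 2 * t * sig2) * (L t * DL t + L t * DL t) + L t * L t * (2 * sig2)).
    by [].
  by rewrite /dphi; ring.
have der (t : R) : t \in `]del, s[%R -> is_derive t (1 : R) (phi a) (dphi t).
  by rewrite in_itv /= => /andP[dt _]; exact: dL (lt_trans d0 dt).
have cont : {within `[del, s], continuous (phi a)}.
  apply: derivable_within_continuous => t; rewrite in_itv /= => /andP[dt _].
  by case: (dL t (lt_le_trans d0 dt)).
have [c] := @MVT R (phi a) dphi del s ds der cont.
rewrite in_itv /= => /andP[dc cs] mvt.
have c0 : 0 < c := lt_trans d0 dc.
have L01 t : 0 <= t -> 0 <= L t <= 1.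
  by move=> t0; rewrite lap_ge0 lap_le1.
have dphi_le : `|dphi c| <= 2 * e'.
  have i1 := L1_lap P (H2 a) mY Y0 c (ltW c0).
  have i2 := L1_Ylap P (H2 a) mY Y0 c c0.
  have E : Ex P (fun w => (1 - 2 * c * H2 a w) * expR (- (c * H2 a w))) = L c + 2 * c * DL c.
    have -> : L c + 2 * c * DL c = L c - 2 * c * Ex P (fun w => H2 a w * expR (- (c * H2 a w))).
      by rewrite /DL; ring.
    rewrite /L /lap -ExZ// -ExB//; last exact: L1Z.
    by apply: eq_Ex => w; ring.
  have st := stein_error a c a0 c0; rewrite E in st.
  (* The intermediate point c depends on a; since [rem] increases with its second argument, the
     threshold on a obtained at s serves for every c below s. *)
  have mono : lam i * rem a c <= lam i * rem a s.
    rewrite ler_wpM2l ?(ltW lam0)//.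
    apply: le_Ex; [by apply: iremf => //; exact: ltW|by apply: iremf => //; exact: ltW|] => w.
    rewrite ler_wpM2l ?sqr_ge0// le_min ge_min lexx /= ge_min; apply/orP; right.
    by rewrite ler_wpM2r//; lra.
  (* The derivative of [phi] is, up to sign, 2 L times the defect in the Stein identity. *)
  have -> : dphi c = 2 * L c * - (- DL c - sig2 * (L c + 2 * c * DL c)).
    by rewrite /dphi; ring.
  rewrite normrM normrN normrM (ger0_norm (x := 2))//.
  have /andP[l0 l1] := L01 c (ltW c0).
  rewrite (ger0_norm l0).
  have st' : `|- DL c - sig2 * (L c + 2 * c * DL c)| <= e'.
    rewrite /DL opprK; apply: le_trans st _; exact: le_trans mono hr.
  have := normr_ge0 (- DL c - sig2 * (L c + 2 * c * DL c)).
  move: st'; set X := `|_| => X1 X0; nra.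
have phid : `|phi a del - 1| <= e / 2.
  have /andP[l0 l1] := L01 del (ltW d0).
  have [x xE] : exists x : R, x = del * sig2 by exists (del * sig2).
  (* Integrate 1 - del H^2 <= exp(- del H^2), with E[H^2] = sig2. *)
  have l2 : 1 - x <= L del.
    rewrite xE -eY -ExZ// -[X in X - _](Ex_cst P) -ExB; [|exact: L1_cst|exact: L1Z].
    apply: le_Ex; [|by apply: L1_lap => //; exact: ltW|] => [|w].
      by apply: L1B; [exact: L1_cst|exact: L1Z].
    by have := expR_ge1Dx (- (del * H2 a w)).
  have xe : x <= e / 4.
    rewrite xE.
    have : del <= e / (4 * sig2) by rewrite ge_min lexx orbT.
    by rewrite ler_pdivlMr ?mulr_gt0//; lra.
  have x0 : 0 < x by rewrite xE; exact: mulr_gt0.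
  have -> : phi a del = (1 + 2 * x) * (L del * L del).
    by rewrite /phi xE (mulrA 2 del sig2).
  move: (L del) l0 l1 l2 => l l0 l1 l2.
  have ll1 : l * l <= 1 by nra.
  have ll2 : 1 - 2 * x <= l * l by nra.
  have ll0 : 0 <= l * l by nra.
  move: (l * l) ll1 ll2 ll0 => l' ? ? ?.
  by rewrite ler_norml; apply/andP; split; nra.
have mv : `|phi a s - phi a del| <= e / 2.
  rewrite mvt normrM (ger0_norm (x := s - del)); last lra.
  apply: le_trans (_ : 2 * e' * s <= _); last first.
    rewrite /e' le_eqVlt; apply/orP; left; apply/eqP; field; by rewrite gt_eqF.
  by apply: ler_pM => //; lra.
rewrite distrC.
apply: (le_trans (ler_distD (phi a del) _ _)).
by rewrite [e]splitr; exact: lerD.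
Unshelve. all: by end_near. Qed.

Let Nn := normal_prob (0 : R) 1.
Let sq (x : R) := x ^+ 2.

Lemma H2_cvg_distr : cvg_distr P H2 (fun f => Ex Nn (fun x => f (sig2 * sq x))).
Proof.
have sg := sig2_gt0.
have [isq esq] := @normal_second_moment R.
have sq0 x : 0 <= sq x by exact: sqr_ge0.
have msq : measurable_fun setT sq by exact: measurable_funX.
apply: (@laplace_cvg_distr _ _ _ _ _ P Nn H2 (fun x => sig2 * sq x) sig2 sg).
- by move=> a w; exact: H2_ge0.
- by move=> x; rewrite mulr_ge0 ?(ltW sg).
- by move=> a /Ex_H2[].
- exact: L1Z.
- by move=> a /Ex_H2[_ ->].
- by rewrite ExZ// esq mulr1.
(* Exponent 0 is treated apart because [laplace_H2] requires s > 0; there both sides are 1. *)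
move=> [|m].
  under eq_fun do under eq_Ex do rewrite mul0r oppr0 expR0.
  rewrite (_ : Ex Nn _ = 1); last first.
    by under eq_Ex do rewrite mul0r oppr0 expR0; rewrite Ex_cst.
  by under eq_fun do rewrite Ex_cst; exact: cvg_cst.
pose s : R := m.+1%:R.
have s0 : 0 < s by rewrite ltr0n.
have ss0 : 0 <= s * sig2 by rewrite mulr_ge0 ?ltW.
pose l := lap Nn sq (s * sig2).
have lE : Ex Nn (fun x => expR (- (m.+1%:R * (sig2 * sq x)))) = l.
  by apply: eq_Ex => x; rewrite mulrA.
have l2 := lap_normal _ ss0; rewrite -/sq -/l in l2.
have lge : 0 <= l by exact: lap_ge0.
have lgt : 0 < l.
  by rewrite lt_neqAle lge andbT; apply/negP => /eqP l0; move: l2; rewrite -l0 expr0n mul0r; lra.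
rewrite lE; apply/cvgrPdist_le => e e0.
have /cvgrPdist_le /(_ (e * l)) := laplace_H2 s s0; rewrite mulr_gt0// => /(_ isT) hphi.
near=> a.
have h : `|1 - phi a s| <= e * l by near: a.
have Lge : 0 <= lap P (H2 a) s by exact: lap_ge0.
move: h; rewrite /phi -/(lap P (H2 a) s); set L := lap P (H2 a) s in Lge *.
(* Factoring l^2 - L^2 recovers the transform from its square: l + L is at least l > 0, so L must
   approach l. *)
have -> : 1 - (1 + 2 * s * sig2) * (L * L) = (1 + 2 * (s * sig2)) * (l + L) * (l - L).
  transitivity (l ^+ 2 * (1 + 2 * (s * sig2)) - (1 + 2 * s * sig2) * (L * L)).
    by rewrite l2.
  by ring.
rewrite normrM ger0_norm; last by rewrite mulr_ge0 ?addr_ge0// mulr_ge0.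
move=> h; have : l * `|l - L| <= l * e.
  rewrite [l * e]mulrC; apply: le_trans h; rewrite ler_wpM2r//.
  by move: (s * sig2) ss0 => x x0; nra.
by rewrite ler_pM2l.
Unshelve. all: by end_near. Qed.

(** No separate law of large numbers is required: H^2 = a (C / a - c)^2, so where H^2 <= K the ratio
    C / a is within sqrt(K / a) of c, and Markov's inequality for H^2 handles the remaining
    event. *)
Lemma slutsky_cvg_distr (b0 b1 : R) : 0 <= b0 -> 0 <= b1 ->
  cvg_distr P (fun a w => a / C a w * (b0 + H2 a w * b1))
    (fun f => Ex Nn (fun x => f ((b0 + sig2 * sq x * b1) / (lam i * EZ * p_le)))).
Proof.
move=> b00 b10 f cf [B fB].
have sg := sig2_gt0.
have [c cE] : exists c : R, c = lam i * EZ * p_le by exists (lam i * EZ * p_le).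
have c0 : 0 < c by rewrite cE !mulr_gt0.
rewrite -cE.
have B0 : 0 <= B := le_trans (normr_ge0 _) (fB 0).
pose h y := f ((b0 + y * b1) / c).
have ch : continuous h.
  move=> x; apply: continuous_comp; last exact: cf.
  apply: cvgM; last exact: cvg_cst.
  apply: cvgD; first exact: cvg_cst.
  by apply: cvgM; [exact: cvg_id|exact: cvg_cst].
have hB x : `|h x| <= B by exact: fB.
have := H2_cvg_distr h ch (ex_intro _ B hB) => /cvgrPdist_le hcvg.
apply/cvgrPdist_le => e e0.
(* Makes 2 B sig2 / K at most e / 4; the added 1 keeps K positive when B = 0. *)
pose K := 8 * B * sig2 / e + 1.
have K0 : 0 < K.
  rewrite ltr_wpDl//; apply: divr_ge0; last exact: ltW.
  by apply: mulr_ge0; [exact: mulr_ge0|exact: ltW].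
have BK : 2 * B / K * sig2 <= e / 4.
  have eK : e * K = 8 * B * sig2 + e by rewrite /K; field; rewrite gt_eqF.
  have -> : 2 * B / K * sig2 = (2 * B * sig2) / K by ring.
  rewrite ler_pdivrMr//.
  have -> : e / 4 * K = e * K / 4 by ring.
  by rewrite eK; lra.
pose S := b0 + b1 * K.
have S0 : 0 <= S by apply: addr_ge0 => //; apply: mulr_ge0 => //; exact: ltW.
have e40 : 0 < e / 4 by rewrite divr_gt0.
have [eta eta0 etaP] := unif_cont_segment f (S / c) (e / 4) cf e40.
(* With r = C / a within del of c, the first bound gives r c >= c^2 / 2. The second then keeps the
   two arguments of f, which differ by at most S del / (r c), closer than eta; S + 1 in place of S
   makes the inequality strict. *)
pose del := Num.min (c / 2) (eta * c ^+ 2 / (2 * (S + 1))).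
have S1 : 0 < 2 * (S + 1) by rewrite mulr_gt0// ltr_wpDl.
have d0 : 0 < del.
  rewrite lt_min divr_gt0//=; apply: divr_gt0 => //.
  by apply: mulr_gt0 => //; exact: exprn_gt0.
have dc : del <= c / 2 by rewrite ge_min lexx.
have de : del * (2 * (S + 1)) <= eta * c ^+ 2.
  by rewrite -ler_pdivlMr// ge_min lexx orbT.
have e20 : 0 < e / 2 by rewrite divr_gt0.
have {}hcvg := hcvg _ e20.
have big : \forall a \near +oo, K / del ^+ 2 <= a by exact: nbhs_pinfty_ge (num_real _).
near=> a.
have a0 : 0 < a by near: a; exact: nbhs_pinfty_gt.
have aK : K / del ^+ 2 <= a by near: a.
have hc : `|Ex Nn (fun x => h (sig2 * sq x)) - Ex P (h \o H2 a)| <= e / 2 by near: a.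
have mV : measurable_fun setT (fun w => a / C a w * (b0 + H2 a w * b1)).
  have mC' := mC a (ltW a0); have mH' := mH2 a (ltW a0).
  apply: measurable_funM.
    by apply: measurable_funM => //; apply: (measurableT_comp (@measurable_invr R)).
  by apply: measurable_funD => //; exact: measurable_funM.
have iV := L1_comp_bounded P _ f B cf fB mV.
have iV' := L1_comp_bounded P _ h B ch hB (mH2 a (ltW a0)).
have [iH eH] := Ex_H2 a a0.
have pt w : `|f (a / C a w * (b0 + H2 a w * b1)) - h (H2 a w)| <= e / 4 + 2 * B / K * H2 a w.
  have W0 := H2_ge0 a w a0.
  have [WK|KW] := leP (H2 a w) K; last first.
    have b : `|f (a / C a w * (b0 + H2 a w * b1)) - h (H2 a w)| <= 2 * B.
      by have := fB (a / C a w * (b0 + H2 a w * b1)); have := hB (H2 a w);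
         have := ler_normB (f (a / C a w * (b0 + H2 a w * b1))) (h (H2 a w)); lra.
    apply: (le_trans b).
    have : 1 <= K^-1 * H2 a w by rewrite mulrC ler_pdivlMr// mul1r ltW.
    rewrite -(mulrA (2 * B)); move: (K^-1 * _) => t t1.
    have : 2 * B <= 2 * B * t by rewrite ler_peMr// mulr_ge0.
    by move: (2 * B * t) => u; lra.
  apply: (le_trans (y := e / 4)); last first.
    by rewrite lerDl; apply: mulr_ge0 => //; apply: divr_ge0; [exact: mulr_ge0|exact: ltW].
  rewrite distrC; apply: etaP.
    apply/andP; split.
      by apply: divr_ge0; [apply: addr_ge0 => //; exact: mulr_ge0|exact: ltW].
    rewrite ler_pM2r ?invr_gt0// /S lerD2l mulrC; exact: ler_wpM2l.
  have [r rE] : exists r, C a w = a * r by exists (C a w / a); rewrite mulrC divfK// gt_eqF.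
  have WE : H2 a w = a * (r - c) ^+ 2.
    by rewrite /H2 Ex_C ?(ltW a0)// -cE rE; field; rewrite gt_eqF.
  have rc : `|r - c| <= del.
    have dd : 0 < del ^+ 2 by exact: exprn_gt0.
    rewrite -(ler_pXn2r (n := 2)) ?nnegrE ?(ltW d0)// real_normK ?num_real//.
    rewrite -(ler_pM2l a0) -WE (le_trans WK)//.
    by rewrite -ler_pdivrMr.
  have r2 : c / 2 <= r by move: rc; rewrite ler_norml => /andP[]; lra.
  have r0 : 0 < r by apply: lt_le_trans r2; rewrite divr_gt0.
  pose N := b0 + H2 a w * b1.
  have N0 : 0 <= N by apply: addr_ge0 => //; exact: mulr_ge0.
  have NS : N <= S by rewrite /N /S lerD2l mulrC; exact: ler_wpM2l.
  have -> : (b0 + H2 a w * b1) / c - a / C a w * (b0 + H2 a w * b1) = N * (r - c) / (r * c).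
    by rewrite rE -/N; field; rewrite !gt_eqF.
  have rc0 : 0 < r * c by exact: mulr_gt0.
  rewrite normrM normrM (ger0_norm N0) normfV (gtr0_norm rc0) ltr_pdivrMr//.
  apply: (le_lt_trans (y := S * del)); first exact: ler_pM.
  apply: (lt_le_trans (y := (S + 1) * del)); first by rewrite ltr_pM2r// ltrDl.
  have : eta * (c / 2 * c) <= eta * (r * c).
    by rewrite ler_wpM2l ?(ltW eta0)// ler_wpM2r ?(ltW c0).
  have -> : eta * (c / 2 * c) = eta * c ^+ 2 / 2 by ring.
  have -> : (S + 1) * del = del * (2 * (S + 1)) / 2 by field.
  by apply: le_trans; rewrite ler_pM2r.
have apx := Ex_approx P _ _ _ (e / 4) (2 * B / K) iV iV' iH pt.
rewrite eH in apx.
have apx' : `|Ex P (h \o H2 a) - Ex P (fun w => f (a / C a w * (b0 + H2 a w * b1)))| <= e / 2.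
  rewrite distrC; apply: (le_trans apx); lra.
by apply: (le_trans (ler_distD (Ex P (h \o H2 a)) _ _)); rewrite [e]splitr; exact: lerD.
Unshelve. all: by end_near. Qed.

End clt.

(** * Development factors and the telescoping variance sum *)

Section development_factors.
Context {R : realType} {d : measure_display} {Om : measurableType d}.
Variables (P : probability Om R) (T : nat) (lam : nat -> R)
  (M : nat -> R -> Om -> nat) (Dk : nat -> nat -> Om -> nat)
  (Zk : nat -> nat -> Om -> R) (D : Om -> nat) (Z : Om -> R).
Hypothesis SM : special_model P T lam M Dk Zk D Z.
Hypothesis T0 : (0 < T)%N.
Let EZ := Ex P Z.
Let EZ2 := Ex P (fun w => Z w ^+ 2).
Let q t := prD P D (fun n => (n <= t)%N).
Let EZ0 : 0 < EZ := EZ_gt0 P T lam M Dk Zk D Z SM T0.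
Let q0 t : (1 <= t)%N -> 0 < q t := prD_le_gt0 P T lam M Dk Zk D Z SM T0 t.

Lemma prD_leT : q T = 1.
Proof. by apply: (prD_true P T lam M Dk Zk D Z SM) => n /andP[]. Qed.

Lemma fdevE t : (1 <= t)%N -> fdev P D Z t = q t.+1 / q t.
Proof.
move=> t1; rewrite /fdev.
rewrite (Ex_ZD P T lam M Dk Zk D Z SM (fun n => (n <= t.+1)%N)).2.
rewrite (Ex_ZD P T lam M Dk Zk D Z SM (fun n => (n <= t)%N)).2.
rewrite -/EZ -/(q t) -/(q t.+1).
by have := q0 t t1; move: (q t) (q t.+1) => x y x0; field; rewrite !gt_eqF.
Qed.

Lemma prod_fdev m n : (1 <= m <= n)%N -> \prod_(m <= s < n) fdev P D Z s = q n / q m.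
Proof.
move=> /andP[m1]; rewrite leq_eqVlt => /orP[/eqP <-|mn].
  by rewrite big_geq// divff// gt_eqF// q0.
rewrite -telescope_prodf//; last first.
  by move=> s /andP[ms _]; rewrite gt_eqF// q0// (leq_trans m1)// ltnW.
apply: eq_big_nat => s /andP[ms _].
by rewrite fdevE// (leq_trans m1).
Qed.

(** By independence of D and Z both quotients in the definition equal E[Z^2] / E[Z], which leaves (f
    - 1) (1 + (f - 1)). *)
Lemma sigma2E t : (1 <= t < T)%N ->
  sigma2 P D Z t = EZ2 / EZ * (fdev P D Z t * (fdev P D Z t - 1)).
Proof.
move=> /andP[t1 tT]; rewrite /sigma2.
rewrite (Ex_Z2D P T lam M Dk Zk D Z SM (fun n => n == t.+1)).2.
rewrite (Ex_ZD P T lam M Dk Zk D Z SM (fun n => n == t.+1)).2.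
rewrite (Ex_Z2D P T lam M Dk Zk D Z SM (fun n => (n <= t)%N)).2.
rewrite (Ex_ZD P T lam M Dk Zk D Z SM (fun n => (n <= t)%N)).2.
have e0 : 0 < prD P D (fun n => n == t.+1) by exact: (prD_eq_gt0 P T lam M Dk Zk D Z SM T0).
rewrite -/EZ -/EZ2 -/(q t).
move: (fdev P D Z t) (prD P D _) e0 (q t) (q0 t t1) => f e e0 u u0.
by field; rewrite !gt_eqF.
Qed.

Lemma sum_sigma2 k : (1 <= k <= T)%N ->
  \sum_(k <= t < T) (\prod_(k <= s < t) fdev P D Z s) * sigma2 P D Z t *
     \prod_(t.+1 <= s < T) fdev P D Z s ^+ 2 =
  EZ2 / EZ * ((q k)^-1 * ((q k)^-1 - 1)).
Proof.
move=> /andP[k1 kT].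
(* With q t = P(D <= t) and q T = 1, the summand reduces to E[Z^2] / (E[Z] q k) times 1 / q t - 1 /
   q (t + 1). *)
pose F t := - (EZ2 / EZ / q k / q t).
transitivity (\sum_(k <= t < T) (F t.+1 - F t)).
  apply: eq_big_nat => t /andP[kt tT].
  have t1 : (1 <= t)%N by exact: leq_trans kt.
  rewrite prodrXl !prod_fdev ?t1 ?tT ?k1 ?kt//.
  rewrite sigma2E ?t1// fdevE// prD_leT /F.
  move: (q t) (q0 t t1) (q t.+1) (q0 t.+1 isT) (q k) (q0 k k1) => u u0 v v0 w w0.
  by field; rewrite !gt_eqF.
rewrite telescope_sumr// /F prD_leT.
move: (q k) (q0 k k1) => u u0.
by field; rewrite !gt_eqF.
Qed.

End development_factors.

Theorem theorem3 (R : realType) (d : measure_display) (Om : measurableType d)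
  (P : probability Om R) (T : nat) (lam : nat -> R)
  (M : nat -> R -> Om -> nat) (Dk : nat -> nat -> Om -> nat)
  (Zk : nat -> nat -> Om -> R) (D : Om -> nat) (Z : Om -> R) :
  (2 <= T)%N ->
  special_model P T lam M Dk Zk D Z ->
  forall i : nat, (2 <= i <= T)%N ->
  let k := (T - i + 1)%N in
  let f := fdev P D Z in
  let g := \prod_(k <= s < T) f s in
  let C := fun (a : R) (w : Om) => Cl M Dk Zk a i k w in
  let EZ := Ex P Z in
  let EZ2 := Ex P (fun w => Z w ^+ 2) in
  let p_gt := Pr P [set w | (k < D w)%N] in
  let p_le := Pr P [set w | (D w <= k)%N] in
  let H2 := fun (a : R) (w : Om) => (C a w - Ex P (C a)) ^+ 2 / a in
  let X := fun (a : R) (w : Om) => (Cl M Dk Zk a i T w - C a w * g) ^+ 2 / C a w in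
  let V := fun (a : R) (w : Om) =>
    a / C a w * (Ex P (fun w => (M i a w)%:R) / a * EZ2 * p_gt
                 + H2 a w * (g - 1) ^+ 2) in
  let EH2 := chi2_1_E (fun y => lam i * EZ2 * p_le * y) in
  [/\ (forall a : R, 0 < a -> is_cond_exp P (Dsig T M Dk Zk a) (X a) (V a)),
      cvg_distr P V (fun phi => chi2_1_E (fun y =>
                        phi (EZ2 / EZ * ((g - 1) + (g - 1) ^+ 2 * y)))),
      cvg_distr P H2 (fun phi => chi2_1_E (fun y => phi (lam i * EZ2 * p_le * y))),
      chi2_1_E (fun y => EZ2 / EZ * ((g - 1) + (g - 1) ^+ 2 * y)) =
        (lam i * EZ2 * p_gt + EH2 * (g - 1) ^+ 2) / (lam i * EZ * p_le) &
      (lam i * EZ2 * p_gt + EH2 * (g - 1) ^+ 2) / (lam i * EZ * p_le) =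
        \sum_(k <= t < T)
          (\prod_(k <= s < t) f s) * sigma2 P D Z t * \prod_(t.+1 <= s < T) f s ^+ 2].

Proof.
move=> T2 SM i iT k f g C EZ EZ2 p_gt p_le H2 X V EH2.
have T0 : (0 < T)%N by exact: leq_trans T2.
have /andP[i2 iT'] := iT.
have i1T : (1 <= i <= T)%N by rewrite iT' andbT; exact: leq_trans i2.
have k1 : (1 <= k)%N by rewrite /k addn1.
have kT : (1 <= k <= T)%N by rewrite k1 /k; lia.
have ple0 : 0 < p_le := prD_le_gt0 P T lam M Dk Zk D Z SM T0 k k1.
have psum : p_le + p_gt = 1 := prD_le_gt P T lam M Dk Zk D Z SM k.
have gE : g = p_le^-1.
  by rewrite /g (prod_fdev P T lam M Dk Zk D Z SM T0)// (prD_leT P T lam M Dk Zk D Z SM) div1r.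
have EZ0 : 0 < EZ := EZ_gt0 P T lam M Dk Zk D Z SM T0.
have EZ20 : 0 < EZ2 := EZ2_gt0 P T lam M Dk Zk D Z SM T0.
have li0 : 0 < lam i := sm_lam SM i1T.
have pgt0 : 0 <= p_gt by exact: (prD_ge0 P D (fun n => (k < n)%N)).
have [isq esq] := @normal_second_moment R.
have chi_affine (u v : R) : chi2_1_E (fun y => u + v * y) = u + v.
  transitivity (Ex (normal_prob (0 : R) 1) (fun x => u + v * x ^+ 2)); first by [].
  rewrite ExD; [|exact: L1_cst|exact: L1Z].
  by rewrite ExZ// Ex_cst esq mulr1.
have EH2E : EH2 = lam i * EZ2 * p_le.
  rewrite -[RHS]add0r -chi_affine /EH2; congr chi2_1_E.
  by apply/funext => y; rewrite add0r.
have pgtE : p_gt = 1 - p_le by rewrite -psum; ring.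
(* The limit produced by [slutsky_cvg_distr] and the stated one are the same function of y once g =
   1 / P(D <= k); its value at y = 1, the mean of the chi-squared law, also gives the
   expectation. *)
have limE (y : R) :
    (lam i * EZ2 * p_gt + lam i * EZ2 * p_le * y * (g - 1) ^+ 2) / (lam i * EZ * p_le) =
    EZ2 / EZ * ((g - 1) + (g - 1) ^+ 2 * y).
  have alg (l m m2 p : R) : 0 < l -> 0 < m -> 0 < p ->
      (l * m2 * (1 - p) + l * m2 * p * y * (p^-1 - 1) ^+ 2) / (l * m * p) =
      m2 / m * ((p^-1 - 1) + (p^-1 - 1) ^+ 2 * y).
    by move=> l0 m0 p0; field; rewrite !gt_eqF.
  by rewrite pgtE gE alg.
have meanE : (lam i * EZ2 * p_gt + EH2 * (g - 1) ^+ 2) / (lam i * EZ * p_le) =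
    EZ2 / EZ * ((g - 1) + (g - 1) ^+ 2).
  by rewrite EH2E -(mulr1 (lam i * EZ2 * p_le)) limE mulr1.
split.
- move=> a a0.
  exact: (cond_exp_V P T lam M Dk Zk D Z SM a (ltW a0) i iT a0 gE ple0 psum).
- move=> f0 cf fB.
  have b00 : 0 <= lam i * EZ2 * p_gt by apply: mulr_ge0 => //; apply: mulr_ge0; exact: ltW.
  have := slutsky_cvg_distr P T lam M Dk Zk D Z SM i i1T k k1 _ _ b00 (sqr_ge0 (g - 1)) f0 cf fB.
  rewrite (_ : Ex _ _ = chi2_1_E (fun y => f0 (EZ2 / EZ * ((g - 1) + (g - 1) ^+ 2 * y)))).
    (* The quotient E[M] / a equals lam i only for a nonzero, so the two families are identified
       near infinity. *)
    apply: cvg_trans; apply: near_eq_cvg; near=> a.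
    have a0 : 0 < a by near: a; exact: nbhs_pinfty_gt.
    apply: eq_Ex => w; rewrite /= /V.
    by rewrite (Ex_count P T lam M Dk Zk D Z SM i i1T a (ltW a0)) mulfK// gt_eqF.
  rewrite /chi2_1_E /Ex; congr fine; apply: eq_integral => x _; congr (f0 _)%:E.
  exact: limE.
- exact: (H2_cvg_distr P T lam M Dk Zk D Z SM i i1T k k1).
- rewrite meanE mulrDr -(chi_affine (EZ2 / EZ * (g - 1))); congr chi2_1_E.
  by apply/funext => y; rewrite mulrDr mulrA.
- rewrite meanE (sum_sigma2 P T lam M Dk Zk D Z SM T0)// -/EZ -/EZ2 -gE.
  by congr (_ * _); ring.
Unshelve. all: by end_near. Qed.
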